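(* There is an algorithm for fully dynamic bounded $k$-sum whose amortized processing time per operation is bounded by $\tilde O_k\!\left(\min\{\mathsf{oprs}^{k-2}, \mathsf{r}_{\mathsf{max}}^{(k-2)/(k-1)}\}\right)$, where $\mathsf{oprs}$ is the number of operations.
   Context: Fully dynamic bounded $k$-sum (for an integer $k \ge 3$): an integer bound $\mathsf{r}_{\mathsf{max}}$ is given in advance; $k$ sets $\mathsf{A}_1,\dots,\mathsf{A}_k$ of integers in $[0,\mathsf{r}_{\mathsf{max}}]$ are initially empty. Each operation is one of: (1) insert an integer in $[0,\mathsf{r}_{\mathsf{max}}]$ into some $\mathsf{A}_i$ (not already present there); (2) delete a number currently present from some $\mathsf{A}_i$; (3) a query asking whether there exist $a_1\in\mathsf{A}_1,\dots,a_k\in\mathsf{A}_k$ with $a_1+\dots+a_{k-1}=a_k$. Operations arrive online; $\mathsf{oprs}$ is the total number of operations. Amortized processing time is total running time divided by $\mathsf{oprs}$. $\tilde O_k$ hides polylogarithmic factors and factors depending only on $k$. *)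

(* Defs.v *)
From Stdlib Require Import ZArith List Reals.
Import ListNotations.
Open Scope Z_scope.

(** * Word RAM

    Programs are finite, structured, and act on finitely many registers and on a
    random-access memory of words.  Every operator, register or memory access,
    assignment and test costs one step. *)

Inductive binop := Add | Sub | Mul | Div | Mod | Eq | Lt.

Inductive expr :=
| Cst (z : Z)
| Var (x : nat)
| Read (addr : expr)
| Bin (o : binop) (e1 e2 : expr).

Inductive cmd :=
| Skip
| Assign (x : nat) (e : expr)
| Write (addr e : expr)
| Seq (c1 c2 : cmd)
| If (e : expr) (c1 c2 : cmd)
| While (e : expr) (c : cmd).

Record state := State { regs : nat -> Z; mem : Z -> Z }.

Definition set_reg (s : state) (x : nat) (v : Z) : state :=
  State (fun y => if Nat.eqb y x then v else regs s y) (mem s).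

Definition set_mem (s : state) (a v : Z) : state :=
  State (regs s) (fun b => if b =? a then v else mem s b).

(** A [w]-bit word is read as a signed integer.  A computation whose
    intermediate result is not representable gets stuck instead of wrapping
    around; hence a completed execution is also an execution, with the same
    cost, of the machine with modular arithmetic, and of every machine with
    longer words. *)
Definition word (w : Z) (z : Z) : option Z :=
  if ((- 2 ^ (w - 1) <=? z) && (z <? 2 ^ (w - 1)))%bool then Some z else None.

Definition binop_sem (w : Z) (o : binop) (a b : Z) : option Z :=
  match o with
  | Add => word w (a + b)
  | Sub => word w (a - b)
  | Mul => word w (a * b)
  | Div => if b =? 0 then None else word w (a / b)
  | Mod => if b =? 0 then None else word w (a mod b)
  | Eq => word w (if a =? b then 1 else 0)
  | Lt => word w (if a <? b then 1 else 0)
  end.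

Fixpoint eval (w : Z) (s : state) (e : expr) : option Z :=
  match e with
  | Cst z => word w z
  | Var x => Some (regs s x)
  | Read e1 =>
      match eval w s e1 with
      | Some a => Some (mem s a)
      | None => None
      end
  | Bin o e1 e2 =>
      match eval w s e1, eval w s e2 with
      | Some a, Some b => binop_sem w o a b
      | _, _ => None
      end
  end.

Fixpoint expr_cost (e : expr) : nat :=
  match e with
  | Cst _ | Var _ => 1
  | Read e1 => S (expr_cost e1)
  | Bin _ e1 e2 => S (expr_cost e1 + expr_cost e2)
  end.

(** [exec w c s n s']: with [w]-bit words, [c] started in [s] halts in [s']
    after [n] steps. *)
Inductive exec (w : Z) : cmd -> state -> nat -> state -> Prop :=
| exec_skip s :
    exec w Skip s 1 s
| exec_assign x e s v :
    eval w s e = Some v ->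
    exec w (Assign x e) s (1 + expr_cost e) (set_reg s x v)
| exec_write e1 e2 s a v :
    eval w s e1 = Some a ->
    eval w s e2 = Some v ->
    exec w (Write e1 e2) s (1 + expr_cost e1 + expr_cost e2) (set_mem s a v)
| exec_seq c1 c2 s s1 s2 n1 n2 :
    exec w c1 s n1 s1 ->
    exec w c2 s1 n2 s2 ->
    exec w (Seq c1 c2) s (n1 + n2) s2
| exec_if_true e c1 c2 s s1 v n :
    eval w s e = Some v -> v <> 0 ->
    exec w c1 s n s1 ->
    exec w (If e c1 c2) s (1 + expr_cost e + n) s1
| exec_if_false e c1 c2 s s1 n :
    eval w s e = Some 0 ->
    exec w c2 s n s1 ->
    exec w (If e c1 c2) s (1 + expr_cost e + n) s1
| exec_while_true e c s s1 s2 v n1 n2 :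
    eval w s e = Some v -> v <> 0 ->
    exec w c s n1 s1 ->
    exec w (While e c) s1 n2 s2 ->
    exec w (While e c) s (1 + expr_cost e + n1 + n2) s2
| exec_while_false e c s :
    eval w s e = Some 0 ->
    exec w (While e c) s (1 + expr_cost e) s.

(** * Fully dynamic bounded k-sum *)

Inductive operation :=
| Insert (i : nat) (a : Z)
| Delete (i : nat) (a : Z)
| Query.

(** The sets [A_1, ..., A_k]; only the indices [1 <= i <= k] are meaningful. *)
Definition sets := nat -> Z -> Prop.

Definition empty_sets : sets := fun _ _ => False.

Definition update (A : sets) (o : operation) : sets :=
  match o with
  | Insert i a => fun j b => A j b \/ (j = i /\ b = a)
  | Delete i a => fun j b => A j b /\ ~ (j = i /\ b = a)
  | Query => A
  end.

Definition valid_op (k : nat) (rmax : Z) (A : sets) (o : operation) : Prop :=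
  match o with
  | Insert i a => (1 <= i <= k)%nat /\ 0 <= a <= rmax /\ ~ A i a
  | Delete i a => (1 <= i <= k)%nat /\ A i a
  | Query => True
  end.

Fixpoint valid_ops (k : nat) (rmax : Z) (A : sets) (oprs : list operation)
  : Prop :=
  match oprs with
  | [] => True
  | o :: oprs' =>
      valid_op k rmax A o /\ valid_ops k rmax (update A o) oprs'
  end.

Definition has_ksum (k : nat) (A : sets) : Prop :=
  exists a : nat -> Z,
    (forall i, (1 <= i <= k)%nat -> A i (a i)) /\
    fold_right Z.add 0 (map a (seq 1 (k - 1))) = a k.

(** * Online algorithms *)

(** [init] finds [rmax] in register 0.  [on_insert] and [on_delete] find the
    index of the set in register 0 and the integer in register 1.  [on_query]
    leaves its answer (1 for yes, 0 for no) in register 0.  Everything else in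
    the registers and in memory persists from one operation to the next. *)
Record algorithm := Algorithm {
  init : cmd;
  on_insert : cmd;
  on_delete : cmd;
  on_query : cmd
}.

Definition zero_state : state := State (fun _ => 0) (fun _ => 0).

(** [serve w k P A s oprs n]: when the sets are [A] and the machine is in state
    [s], [P] processes the operations [oprs] one after the other, answering all
    queries correctly, in [n] steps altogether. *)
Inductive serve (w : Z) (k : nat) (P : algorithm)
  : sets -> state -> list operation -> nat -> Prop :=
| serve_nil A s :
    serve w k P A s [] 0
| serve_insert A s i a oprs n s' m :
    exec w (on_insert P) (set_reg (set_reg s 0 (Z.of_nat i)) 1 a) n s' ->
    serve w k P (update A (Insert i a)) s' oprs m ->
    serve w k P A s (Insert i a :: oprs) (n + m)
| serve_delete A s i a oprs n s' m :
    exec w (on_delete P) (set_reg (set_reg s 0 (Z.of_nat i)) 1 a) n s' ->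
    serve w k P (update A (Delete i a)) s' oprs m ->
    serve w k P A s (Delete i a :: oprs) (n + m)
| serve_query A s oprs n s' m :
    exec w (on_query P) s n s' ->
    (has_ksum k A /\ regs s' 0%nat = 1 \/
     ~ has_ksum k A /\ regs s' 0%nat = 0) ->
    serve w k P A s' oprs m ->
    serve w k P A s (Query :: oprs) (n + m).

(** [P] solves the instance, starting from a zeroed memory and empty sets, in
    total running time [T], initialization included. *)
Definition solves_in (w : Z) (k : nat) (P : algorithm) (rmax : Z)
  (oprs : list operation) (T : nat) : Prop :=
  exists n s m,
    exec w (init P) (set_reg zero_state 0 rmax) n s /\
    serve w k P empty_sets s oprs m /\
    T = (n + m)%nat.

Definition amortized_time (T : nat) (oprs : list operation) : R :=
  (INR T / INR (length oprs))%R.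

(** The sum of the two parameters, shifted so that its logarithm is at least 1
    on every nonempty sequence of operations. *)
Definition param (rmax : Z) (oprs : list operation) : Z :=
  rmax + Z.of_nat (length oprs) + 2.

(** [min {oprs^(k-2), rmax^((k-2)/(k-1))}]; [rmax = 0] is counted as 1, since no
    algorithm has amortized time 0. *)
Definition ksum_bound (k : nat) (rmax : Z) (oprs : list operation) : R :=
  Rmin (INR (length oprs) ^ (k - 2))
       (Rpower (IZR (Z.max 1 rmax)) (INR (k - 2) / INR (k - 1))).

(* Main.v *)
(** Replacing [a] by [rmax - a] in the last set turns a solution into a [k]-tuple
    of stored values with sum [rmax].  The number of solutions is maintained: an
    update changes it by the number of solutions through the updated element.
    The updates since the last rebuild are kept in a log of length [t]; encode
    every set by its generating polynomial, so that each current set is an old set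
    plus a signed sum of log entries, and tabulate the coefficients of the products
    of old sets over all subfamilies.  Expanding the product of the [k - 1] other
    sets, one enumerates log entries for some of them and looks up the product of
    the old sets for the rest; when no old set is chosen, the last set is looked up
    directly.  This takes [O_k((t + 1)^(k-2))] steps.  The tables are rebuilt as soon
    as [t^(k-1) >= rmax]; a rebuild costs [rmax] up to logarithms, which is at most
    [t] times the claimed bound, and is charged to the [t] logged updates.

    The products are computed by Nussbaumer's algorithm, which is exact over [Z]: a
    negacyclic convolution of length [n = r m] becomes a cyclic convolution of
    length [2 m] over [Z[y]/(y^r + 1)], where [y] supplies the roots of unity of a
    fast Fourier transform, and the remaining products are negacyclic of length [r].
    Every pass is analysed by evaluating both sides at complex points; the
    polynomial identities needed follow by counting roots. *)

Require Import Defs.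
From Stdlib Require Import ZArith List Reals Lia Lra Bool.
From mathcomp Require all_boot all_algebra algC cyclotomic ssrZ.
Import ListNotations.
Open Scope Z_scope.

(** * Nussbaumer's convolution algorithm on arrays *)

(** Three points shape the development. Exactness: table entries reach [(rmax + 1)^k] while words
    have [O_k(log)] bits. Nussbaumer's ring has its own roots of unity, the powers of [y], and a
    linear pass at most doubles the entries, so all values stay polynomial in the parameters and no
    modulus or rounding enters. The price is zero padding, which doubles the array at each level;
    the exponent of the length about halves from level to level, so the total growth is only
    logarithmic. Small instances: the term [oprs^(k-2)] forbids any work of order [rmax] before the
    log is long. At the start all sets are empty, so every table but the constant 1 is zero and
    agrees with the zeroed memory; a single write initialises it. Balance: at a rebuild
    [rmax <= t^(k-1)], which is [t * t^(k-2)] and hence at most [t * oprs^(k-2)], and taking roots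
    gives [rmax <= t * rmax^((k-2)/(k-1))]; one threshold therefore serves both terms of the
    minimum. The targets of lookups can become negative when log values are subtracted; they then
    meet cells that are never written. *)

(* An array holds consecutive blocks of [h] rows of length [r]: the entry at
   [(b * h + j) * r + i] is the coefficient of [x^j y^i] in block [b], an element
   of [Z[y]/(y^r + 1)[x]/(x^h - 1)].  Multiplying a row by [y^e], where
   [0 <= e <= r], rotates it by [e] and changes the sign of what wraps around. *)
Definition negashift (r : Z) (A : Z -> Z) (base i e : Z) : Z :=
  (1 - 2 * (if i <? e then 1 else 0)) * A (base + (i - e) mod r).

(* Splits [x^(2h) - 1 = (x^h - 1) (x^h + 1)]; the second factor becomes
   [x^h - 1] after substituting [y^(r/h) x] for [x]. *)
Definition bfly (r h : Z) (A : Z -> Z) (q : Z) : Z :=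
  let i := q mod r in
  let j := (q / r) mod h in
  let sg := (q / (r * h)) mod 2 in
  let base := q / (r * h) / 2 * (2 * h * r) in
  negashift r A (base + j * r) i (sg * (r / h * j))
  + (1 - 2 * sg) * negashift r A (base + (j + h) * r) i (sg * (r / h * j)).

(* Inverse of [bfly] up to a factor 2. *)
Definition unbfly (r h : Z) (A : Z -> Z) (q : Z) : Z :=
  let i := q mod r in
  let jj := (q / r) mod (2 * h) in
  let j := jj mod h in
  let sg := jj / h in
  let base := q / (r * (2 * h)) * (2 * h * r) in
  A (base + j * r + i)
  + (2 * sg - 1) * negashift r A (base + (j + h) * r) i (r - r / h * j).

(* [t^(i m + j)] becomes [x^j y^i]; the upper half is zero because the product of
   two polynomials of degree below [m] in [x] is wanted modulo [x^(2m) - 1]. *)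
Definition expand (r m : Z) (A : Z -> Z) (q : Z) : Z :=
  let i := q mod r in
  let j := (q / r) mod (2 * m) in
  let b := q / (r * (2 * m)) in
  (if j <? m then 1 else 0) * A (b * (r * m) + i * m + j).

(* Reduces modulo [x^m = y]. *)
Definition fold (r m : Z) (A : Z -> Z) (q : Z) : Z :=
  let j := q mod m in
  let i := (q / m) mod r in
  let base := q / (m * r) * (2 * m * r) in
  A (base + j * r + i) + negashift r A (base + (j + m) * r) i 1.

(** Products of Gaussian integers, since at length 2 the ring is [Z[y]/(y^2 + 1)]. One formula
    serves both parities of [q]: [2 * i - 1] is the sign of the second term and [q - i + 1 - i] the
    partner index in [B]. *)
Definition base2 (A B : Z -> Z) (q : Z) : Z :=
  let i := q mod 2 in
  A (q - i) * B q + (2 * i - 1) * (A (q - i + 1) * B (q - i + 1 - i)).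

(** As [h] runs down from [2^a] to 1, [x] is eliminated: afterwards each block is a single row, an
    instance of the negacyclic problem of length [r]. *)
Fixpoint bflys (r : Z) (a : nat) (A : Z -> Z) : Z -> Z :=
  match a with
  | O => bfly r 1 A
  | S a' => bflys r a' (bfly r (2 ^ Z.of_nat a) A)
  end.

Fixpoint unbflys (r : Z) (a : nat) (A : Z -> Z) : Z -> Z :=
  match a with
  | O => unbfly r 1 A
  | S a' => unbfly r (2 ^ Z.of_nat a) (unbflys r a' A)
  end.

(* [chain v ls]: starting from negacyclic length [2^v], the successive
   splittings [n = r m] are [(r, m) = (2^p, 2^a)] for [(p, a)] in [ls], and the
   final length is 2. *)
Fixpoint chain (v : nat) (ls : list (nat * nat)) : Prop :=
  match ls with
  | [] => v = 1%nat
  | (p, a) :: ls' =>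
      (v = p + a /\ 1 <= a <= p /\ p <= S a)%nat /\ chain p ls'
  end.

Fixpoint forward (ls : list (nat * nat)) (A : Z -> Z) : Z -> Z :=
  match ls with
  | [] => A
  | (p, a) :: ls' =>
      forward ls' (bflys (2 ^ Z.of_nat p) a
                 (expand (2 ^ Z.of_nat p) (2 ^ Z.of_nat a) A))
  end.

Fixpoint backward (ls : list (nat * nat)) (C : Z -> Z) : Z -> Z :=
  match ls with
  | [] => C
  | (p, a) :: ls' =>
      fold (2 ^ Z.of_nat p) (2 ^ Z.of_nat a)
        (unbflys (2 ^ Z.of_nat p) a (backward ls' C))
  end.

(* The factor by which the unnormalised inverse passes scale the result. *)
Fixpoint kappa (ls : list (nat * nat)) : Z :=
  match ls with
  | [] => 1
  | (p, a) :: ls' => 2 ^ Z.of_nat (S a) * kappa ls'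
  end.

Lemma block_index (b h j r i : Z) :
  0 <= j < h -> 0 <= i < r ->
  let q := (b * h + j) * r + i in
  q mod r = i /\ q / r = b * h + j /\ (q / r) mod h = j /\ q / (r * h) = b.
Proof.
  intros Hj Hi q.
  assert (E1 : q / r = b * h + j)
    by (symmetry; apply Z.div_unique with i; unfold q; nia).
  assert (E2 : q mod r = i)
    by (symmetry; apply Z.mod_unique with (b * h + j); unfold q; nia).
  repeat split; auto.
  - rewrite E1. symmetry. apply Z.mod_unique with b; nia.
  - rewrite <- Z.div_div by lia. rewrite E1.
    symmetry. apply Z.div_unique with j; nia.
Qed.

(** The passes use quotients and remainders of a flat index because the program does; the algebra
    needs explicit block, row and column. Here [sg] tells to which of the factors [x^h - 1] and
    [x^h + 1] the output block belongs. *)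
Lemma bfly_index (A : Z -> Z) (b h j r i sg : Z) :
  0 <= j < h -> 0 <= i < r -> 0 <= sg < 2 ->
  bfly r h A (((2 * b + sg) * h + j) * r + i)
  = negashift r A ((b * (2 * h) + j) * r) i (sg * (r / h * j))
    + (1 - 2 * sg) * negashift r A ((b * (2 * h) + (j + h)) * r) i (sg * (r / h * j)).
Proof.
  intros Hj Hi Hs. unfold bfly.
  destruct (block_index (2 * b + sg) h j r i Hj Hi) as (E1 & _ & E2 & E3).
  cbv zeta. rewrite E1, E2, E3.
  replace ((2 * b + sg) mod 2) with sg
    by (apply Z.mod_unique with b; lia).
  replace ((2 * b + sg) / 2) with b by (apply Z.div_unique with sg; lia).
  replace (b * (2 * h * r) + j * r) with ((b * (2 * h) + j) * r) by ring.
  replace (b * (2 * h * r) + (j + h) * r)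
    with ((b * (2 * h) + (j + h)) * r) by ring.
  reflexivity.
Qed.

Lemma unbfly_index (A : Z -> Z) (b h j r i sg : Z) :
  0 <= j < h -> 0 <= i < r -> 0 <= sg < 2 ->
  unbfly r h A ((b * (2 * h) + (sg * h + j)) * r + i)
  = A ((b * (2 * h) + j) * r + i)
    + (2 * sg - 1) * negashift r A ((b * (2 * h) + (j + h)) * r) i (r - r / h * j).
Proof.
  intros Hj Hi Hs. unfold unbfly.
  destruct (block_index b (2 * h) (sg * h + j) r i) as (E1 & _ & E2 & E3);
    [nia | lia |].
  cbv zeta. rewrite E1, E2, E3.
  replace ((sg * h + j) mod h) with j by (apply Z.mod_unique with sg; nia).
  replace ((sg * h + j) / h) with sg by (apply Z.div_unique with j; nia).
  replace (b * (2 * h * r) + j * r) with ((b * (2 * h) + j) * r) by ring.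
  replace (b * (2 * h * r) + (j + h) * r)
    with ((b * (2 * h) + (j + h)) * r) by ring.
  reflexivity.
Qed.

Lemma expand_index (A : Z -> Z) (b m j r i : Z) :
  0 <= j < 2 * m -> 0 <= i < r ->
  expand r m A ((b * (2 * m) + j) * r + i)
  = (if j <? m then 1 else 0) * A (b * (r * m) + i * m + j).
Proof.
  intros Hj Hi. unfold expand.
  destruct (block_index b (2 * m) j r i) as (E1 & _ & E2 & E3); [lia | lia |].
  cbv zeta. rewrite E1, E2, E3. reflexivity.
Qed.

Lemma fold_index (A : Z -> Z) (b m j r i : Z) :
  0 <= j < m -> 0 <= i < r ->
  fold r m A ((b * r + i) * m + j)
  = A ((b * (2 * m) + j) * r + i) + negashift r A ((b * (2 * m) + (j + m)) * r) i 1.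
Proof.
  intros Hj Hi. unfold fold.
  destruct (block_index b r i m j) as (E1 & _ & E2 & E3); [lia | lia |].
  cbv zeta. rewrite E1, E2, E3.
  replace (b * (2 * m * r) + j * r) with ((b * (2 * m) + j) * r) by ring.
  replace (b * (2 * m * r) + (j + m) * r)
    with ((b * (2 * m) + (j + m)) * r) by ring.
  reflexivity.
Qed.

(** * Correctness of the passes, by evaluation at algebraic numbers *)

Module Nussbaumer.
Import all_boot all_algebra algC cyclotomic ssrZ.
Import GRing.Theory Num.Theory.
Local Open Scope ring_scope.

Delimit Scope Z_scope with Z.
#[local] Arguments Z.mul : simpl never.
#[local] Arguments Z.add : simpl never.
#[local] Arguments Z.sub : simpl never.
#[local] Arguments Z.of_nat : simpl never.
#[local] Arguments Z.pow : simpl never.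
Local Notation zn := Z.of_nat.

(** Algebraic numbers supply every root of unity, and the integers embed injectively, so an identity
    proved at sufficiently many points returns to the integers. *)
Definition zC (z : Z) : algC := (int_of_Z z)%:~R.

Lemma zCD a b : zC (a + b)%Z = zC a + zC b.
Proof. by rewrite /zC -[(a + b)%Z]/(a + b) rmorphD /= intrD. Qed.

Lemma zCM a b : zC (a * b)%Z = zC a * zC b.
Proof. by rewrite /zC -[(a * b)%Z]/(a * b) rmorphM /= intrM. Qed.

Lemma zCN a : zC (- a)%Z = - zC a.
Proof. by rewrite /zC -[(- a)%Z]/(- a) rmorphN /= rmorphN. Qed.

Lemma zC_inj : injective zC.
Proof. by move=> a b /intr_inj /(can_inj int_of_ZK). Qed.

Lemma zC0 : zC 0 = 0. Proof. by []. Qed.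

Definition row (r : nat) (A : Z -> Z) (base : Z) (y : algC) : algC :=
  \sum_(i < r) zC (A (base + zn i)%Z) * y ^+ i.

(* The value at [(x, y)] of block [b], read as a polynomial in [x] and [y]. *)
Definition ev2 (h r : nat) (A : Z -> Z) (b : nat) (x y : algC) : algC :=
  \sum_(j < h) row r A ((zn b * zn h + zn j) * zn r)%Z y * x ^+ j.

(** Multiplication by [y^e] sends [y^i] to [y^(i+e)]; the top [e] coefficients wrap around once, as
    [e <= r], and [y^r = -1] gives their sign. Writing [r = e + d] separates the two ranges. *)
Lemma row_sh (r e : nat) (A : Z -> Z) base y :
  (e <= r)%N -> y ^+ r = -1 ->
  \sum_(i < r) zC (negashift (zn r) A base (zn i) (zn e)) * y ^+ i
  = y ^+ e * row r A base y.
Proof.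
move=> le_er; rewrite -(subnKC le_er); move: (r - e)%N => d {r le_er} yr.
rewrite /row [in RHS]addnC big_split_ord [in RHS]big_split_ord /= addrC mulrDr.
congr (_ + _); rewrite big_distrr /=; apply: eq_bigr => i _.
  rewrite /negashift.
  have -> : (zn (e + i) <? zn e)%Z = false by apply/Z.ltb_ge; rewrite -plusE; lia.
  have -> : ((zn (e + i) - zn e) mod zn (e + d))%Z = zn i.
    have := ltn_ord i => /ltP ?; rewrite Z.mod_small -!plusE; lia.
  by rewrite Z.mul_0_r Z.sub_0_r Z.mul_1_l exprD mulrCA.
rewrite /negashift.
have /ltP lt_ie := ltn_ord i.
have -> : (zn i <? zn e)%Z = true by apply/Z.ltb_lt; lia.
have -> : ((zn i - zn e) mod zn (e + d))%Z = zn (d + i).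
  symmetry; apply: (Z.mod_unique _ _ (-1)%Z); rewrite -!plusE; lia.
by rewrite zCM mulrCA -exprD addnA exprD yr !mulN1r mulrN mulNr.
Qed.

Lemma divn_of_nat (a b : nat) : (zn a / zn b)%Z = zn (a %/ b)%N.
Proof.
case: b => [|b]; first by rewrite divn0 Zdiv_0_r.
symmetry; apply: (Z.div_unique _ _ _ (zn (a %% b.+1)%N)).
  by left; have /ltP := ltn_pmod a (ltn0Sn b); lia.
rewrite {1}(divn_eq a b.+1) -plusE -multE; lia.
Qed.

Lemma sumr_nth_pair (h : nat) (F G : nat -> algC) (x : algC) :
  \sum_(j < h) F j * x ^+ j + x ^+ h * (\sum_(j < h) G j * x ^+ j)
  = \sum_(j < 2 * h) (if (j < h)%N then F j else G (j - h)%N) * x ^+ j.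
Proof.
rewrite mul2n -addnn big_split_ord /=; congr (_ + _).
  by apply: eq_bigr => i _; rewrite ltn_ord.
rewrite big_distrr /=; apply: eq_bigr => i _.
by rewrite ltnNge leq_addr /= addKn exprD mulrCA.
Qed.

(** Rows [j] and [j + h] share the power [x^j], which leaves a factor [x^h]. It is known at the
    points used below: 1 or -1 in a butterfly, [y] in [fold]. *)
Lemma ev2_halves (h r : nat) A b x y :
  ev2 (2 * h) r A b x y
  = \sum_(j < h) (row r A ((zn b * (2 * zn h) + zn j) * zn r)%Z y
     + x ^+ h * row r A ((zn b * (2 * zn h) + (zn j + zn h)) * zn r)%Z y)
     * x ^+ j.
Proof.
rewrite /ev2; set f := fun j => row r A ((zn b * zn (2 * h) + j) * zn r)%Z y.
transitivity (\sum_(j < 2 * h)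
   (if (j < h)%N then f (zn j) else f (zn (j - h) + zn h)%Z) * x ^+ j).
  apply: eq_bigr => j _; congr (_ * _).
  case: ltnP => // /leP le_hj; congr f; rewrite -minusE; lia.
rewrite -(sumr_nth_pair h (f \o zn) (fun j => f (zn j + zn h)%Z)).
rewrite big_distrr -big_split /=; apply: eq_bigr => j _.
have e2 : zn (2 * h) = (2 * zn h)%Z by rewrite -multE; lia.
by rewrite /f e2 mulrDl mulrA.
Qed.

Definition sgn (s : bool) : algC := if s then -1 else 1.

Lemma zC_sgn (s : bool) : zC (1 - 2 * (if s then 1 else 0))%Z = sgn s.
Proof. by case: s; rewrite ?Z.mul_1_r //= /zC /= ; rewrite ?NegzE. Qed.

Section Butterfly.

Variables (r h : nat) (y : algC).
Hypotheses (h_gt0 : (0 < h)%N) (dvd_hr : (h %| r)%N) (yr : y ^+ r = -1).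

(** An [h]-th root of -1 made from [y], available because [h] divides [r]: the roots of [x^h + 1]
    are [w] times those of [x^h - 1]. *)
Let w := y ^+ (r %/ h)%N.

Lemma w_pow : w ^+ h = -1.
Proof. by rewrite -exprM divnK. Qed.

Lemma w_unit : w != 0.
Proof.
apply/eqP => w0; have := w_pow; rewrite w0 expr0n eqn0Ngt h_gt0 /= => /eqP.
by rewrite eq_sym oppr_eq0 oner_eq0.
Qed.

Lemma shift_le (j : nat) : (j < h)%N -> (r %/ h * j <= r)%N.
Proof.
by move=> lt_jh; rewrite -[X in (_ <= X)%N](divnK dvd_hr) leq_mul2l ltnW ?orbT.
Qed.

(** For [s] false [x^h = 1] adds the two half-blocks, for [s] true [(w x)^h = -1] subtracts them,
    and the remaining factor [w^j = y^(r/h * j)] is the rotation of row [j]. *)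
Lemma ev2_bfly A b (s : bool) x :
  x ^+ h = 1 ->
  ev2 h r (bfly (zn r) (zn h) A) (2 * b + s) x y
  = ev2 (2 * h) r A b (w ^+ s * x) y.
Proof.
move=> xh; rewrite ev2_halves; apply: eq_bigr => j _.
have /ltP lt_jh := ltn_ord j.
set e := (s * (r %/ h * j))%N.
have le_er : (e <= r)%N.
  by rewrite /e; case: s @e => /=; rewrite ?mul1n ?mul0n // shift_le.
have -> : (w ^+ s * x) ^+ h = sgn s.
  by rewrite exprMn xh mulr1 exprAC w_pow; case: s @e le_er.
rewrite exprMn -exprM mulrA; congr (_ * _).
have -> : w ^+ (s * j) = y ^+ e by rewrite /w -exprM /e mulnCA.
rewrite mulrC mulrDr mulrCA -!(row_sh _ _ _ _ _ le_er yr) big_distrr -big_split /=.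
rewrite {1}/row; apply: eq_bigr => i _.
have /ltP lt_ir := ltn_ord i.
have -> : zn (2 * b + s) = (2 * zn b + (if s then 1 else 0))%Z.
  by rewrite -plusE -multE; case: (s) => /=; lia.
rewrite bfly_index; [|lia|lia|by case: (s); lia].
rewrite divn_of_nat.
have -> : ((if s then 1 else 0) * (zn (r %/ h)%N * zn j))%Z = zn e.
  by rewrite /e -!multE; case: (s); lia.
by rewrite zCD zCM zC_sgn mulrDl mulrA.
Qed.

(** The sum and the difference of the two rows each cancel one row and double the other; this is the
    factor 2 left unnormalised. *)
Lemma ev2_unbfly C b (s : bool) x :
  x ^+ h = 1 ->
  ev2 (2 * h) r (unbfly (zn r) (zn h) C) b (w ^+ s * x) y
  = 2%:R * ev2 h r C (2 * b + s) x y.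
Proof.
move=> xh; rewrite ev2_halves /ev2 big_distrr /=; apply: eq_bigr => j _.
have /ltP lt_jh := ltn_ord j.
have xsh : (w ^+ s * x) ^+ h = sgn s.
  by rewrite exprMn xh mulr1 exprAC w_pow; case: s.
set R0 := row r C ((zn b * (2 * zn h) + zn j) * zn r)%Z y.
set R1 := row r C ((zn b * (2 * zn h) + (zn j + zn h)) * zn r)%Z y.
have rowE (t : bool) :
    row r (unbfly (zn r) (zn h) C)
      ((zn b * (2 * zn h) + (zn t * zn h + zn j)) * zn r)%Z y
    = R0 + sgn t * (w ^- j * R1).
  have le_er : (r - r %/ h * j <= r)%N by rewrite leq_subr.
  (* A rotation needs a nonnegative exponent: [y^r = -1] turns [w^-j] into [- y^(r - r/h * j)],
     whence the amount of rotation and the reversed sign in [unbfly]. *)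
  have -> : w ^- j * R1 = - (y ^+ (r - r %/ h * j)%N * R1).
    have nz : w ^+ j != 0 by rewrite expf_neq0 // w_unit.
    apply: (mulfI nz); rewrite mulrA mulfV // mul1r mulrN mulrA.
    by rewrite -exprM -exprD subnKC ?shift_le // yr mulN1r opprK.
  rewrite -row_sh // mulrN -mulNr big_distrr -big_split /=.
  apply: eq_bigr => i _.
  have /ltP lt_ir := ltn_ord i.
  rewrite unbfly_index; [|lia|lia|by case: (t) => /=; lia].
  rewrite divn_of_nat.
  have -> : (zn r - zn (r %/ h)%N * zn j)%Z = zn (r - r %/ h * j)%N.
    by have /leP := shift_le _ (ltn_ord j); rewrite -minusE -multE; lia.
  rewrite zCD zCM mulrDl mulrA; congr (_ + _ * _ * _).
  by case: (t) => /=; rewrite /zC //= opprK.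
have -> : row r (unbfly (zn r) (zn h) C)
    ((zn b * (2 * zn h) + zn j) * zn r)%Z y = R0 + w ^- j * R1.
  by rewrite -[w ^- j * R1]mul1r -(rowE false); congr row; lia.
have -> : row r (unbfly (zn r) (zn h) C)
    ((zn b * (2 * zn h) + (zn j + zn h)) * zn r)%Z y = R0 - w ^- j * R1.
  by rewrite -[w ^- j * R1]mul1r -mulNr -(rowE true); congr row; lia.
have wj : w ^+ j != 0 by rewrite expf_neq0 // w_unit.
rewrite xsh exprMn !mulrA; congr (_ * _).
have -> : (zn (2 * b + s) * zn h + zn j)%Z
        = (zn b * (2 * zn h) + (zn s * zn h + zn j))%Z.
  by rewrite -plusE -multE; lia.
case: (s) => /=.
  rewrite expr1 mulN1r opprD opprK addrACA subrr add0r -mulr2n.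
  rewrite [LHS]mulrnAl mulrAC mulVf // mul1r [RHS]mulr_natl.
  by rewrite /R1; congr (_ *+ 2); congr row; lia.
rewrite mul1r expr1n mulr1 addrACA subrr addr0 -mulr2n mulr_natl.
by rewrite /R0; congr (_ *+ 2); congr row; lia.
Qed.

End Butterfly.

(** Correctness is kept at the level of values: passes then compose by moving the evaluation point,
    and no product of polynomials in two variables has to be formed. The scalar [k] collects the
    unnormalised factors. *)
Definition cyclic_ok (h r : nat) (k : algC) (A B C : Z -> Z) : Prop :=
  forall b x y, x ^+ h = 1 -> y ^+ r = -1 ->
  ev2 h r C b x y = k * (ev2 h r A b x y * ev2 h r B b x y).

Definition negacyclic_ok (n : nat) (k : algC) (A B C : Z -> Z) : Prop :=
  forall b t, t ^+ n = -1 ->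
  row n C (zn b * zn n)%Z t
  = k * (row n A (zn b * zn n)%Z t * row n B (zn b * zn n)%Z t).

Lemma ev2_1 r A b x y : ev2 1 r A b x y = row r A (zn b * zn r)%Z y.
Proof.
by rewrite /ev2 big_ord1 expr0 mulr1; congr row; rewrite [zn ord0]/=; lia.
Qed.

Lemma cyclic_ok_1 r k A B C :
  negacyclic_ok r k A B C -> cyclic_ok 1 r k A B C.
Proof. by move=> ok b x y _ yr; rewrite !ev2_1 ok. Qed.

(** Every [2h]-th root of unity is [x'] or [w * x'] with [x'^h = 1], so the two output blocks of the
    butterfly account for all points. *)
Lemma cyclic_ok_unbfly h r k A B C :
  (0 < h)%N -> (h %| r)%N ->
  cyclic_ok h r k (bfly (zn r) (zn h) A) (bfly (zn r) (zn h) B) C ->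
  cyclic_ok (2 * h) r (2%:R * k) A B (unbfly (zn r) (zn h) C).
Proof.
move=> h0 hr ok b x y x2h yr.
have [s [x' [x'h ->]]] :
    exists s : bool, exists x', x' ^+ h = 1 /\ x = (y ^+ (r %/ h)%N) ^+ s * x'.
  have : (x ^+ h) ^+ 2 == 1 by rewrite -exprM mulnC x2h.
  rewrite sqrf_eq1 => /orP[]/eqP xh.
    by exists false, x; rewrite expr0 mul1r.
  have wu := w_unit r h y h0 hr yr.
  exists true, (x / (y ^+ (r %/ h)%N)); split.
    by rewrite expr_div_n xh w_pow // divff // oppr_eq0 oner_eq0.
  by rewrite expr1 mulrCA mulfV ?mulr1.
by rewrite ev2_unbfly // ok // !ev2_bfly // !mulrA.
Qed.

Lemma sum_ord_mul (r m : nat) (F : nat -> algC) :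
  \sum_(q < r * m) F q = \sum_(i < r) \sum_(j < m) F (i * m + j)%N.
Proof.
elim: r => [|r IH]; first by rewrite !big_ord0.
by rewrite mulSnr big_split_ord /= IH [RHS]big_ord_recr.
Qed.

(** The coefficient of [x^j] after the substitution of [x^j y^i] for [t^(i m + j)]. *)
Definition col (m r : nat) (A : Z -> Z) (b j : nat) (y : algC) : algC :=
  \sum_(i < r) zC (A (zn b * (zn r * zn m) + zn i * zn m + zn j)%Z) * y ^+ i.

Lemma row_cols m r A b t :
  row (r * m) A (zn b * zn (r * m))%Z t
  = \sum_(j < m) col m r A b j (t ^+ m) * t ^+ j.
Proof.
rewrite /row.
rewrite (sum_ord_mul r m
  (fun q => zC (A (zn b * zn (r * m) + zn q)%Z) * t ^+ q)) exchange_big /=.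
apply: eq_bigr => j _; rewrite /col big_distrl /=; apply: eq_bigr => i _.
rewrite -exprM -mulrA -exprD [(m * i)%N]mulnC; congr (zC (A _) * _).
by rewrite -plusE -!multE; lia.
Qed.

Lemma ev2_expand m r A b x y :
  ev2 (2 * m) r (expand (zn r) (zn m) A) b x y
  = \sum_(j < m) col m r A b j y * x ^+ j.
Proof.
rewrite {1}/ev2 mul2n -addnn big_split_ord /= [X in _ + X]big1 ?addr0.
  apply: eq_bigr => j _; congr (_ * _); apply: eq_bigr => i _.
  have /ltP ? := ltn_ord j; have /ltP ? := ltn_ord i.
  have -> : zn (m + m) = (2 * zn m)%Z by rewrite -plusE; lia.
  rewrite expand_index; [|lia|lia].
  have -> : (zn j <? zn m)%Z = true by apply/Z.ltb_lt; lia.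
  by rewrite Z.mul_1_l.
move=> j _; rewrite [row _ _ _ _]big1 ?mul0r // => i _.
have /ltP ? := ltn_ord j; have /ltP ? := ltn_ord i.
have -> : zn (m + m) = (2 * zn m)%Z by rewrite -plusE; lia.
have -> : zn (m + j) = (zn m + zn j)%Z by rewrite -plusE; lia.
rewrite expand_index; [|lia|lia].
have -> : (zn m + zn j <? zn m)%Z = false by apply/Z.ltb_ge; lia.
by rewrite Z.mul_0_l zC0 mul0r.
Qed.

(** Folding is evaluation on the curve [x = t], [y = t^m]: there [x^m = y], so the upper rows enter
    with one extra factor [y], a rotation by 1. *)
Lemma row_fold m r C b t :
  (0 < r)%N -> t ^+ (r * m) = -1 ->
  row (r * m) (fold (zn r) (zn m) C) (zn b * zn (r * m))%Z t
  = ev2 (2 * m) r C b t (t ^+ m).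
Proof.
move=> r0 tn; rewrite row_cols ev2_halves; apply: eq_bigr => j _.
congr (_ * _); rewrite /col.
have yr : (t ^+ m) ^+ r = -1 by rewrite -exprM mulnC.
rewrite -[X in X * row _ _ _ _]expr1 -row_sh // -big_split /=.
apply: eq_bigr => i _.
have /ltP ? := ltn_ord j; have /ltP ? := ltn_ord i.
have -> : (zn b * (zn r * zn m) + zn i * zn m + zn j)%Z
        = ((zn b * zn r + zn i) * zn m + zn j)%Z by lia.
by rewrite fold_index; [|lia|lia]; rewrite zCD mulrDl.
Qed.

Lemma poly_eq_on_unity n (p : {poly algC}) :
  (0 < n)%N -> (size p <= n)%N -> (forall x, x ^+ n = 1 -> p.[x] = 0) -> p = 0.
Proof.
move=> n0 sp pr; have [z zP] := C_prim_root_exists n0.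
apply: (@roots_geq_poly_eq0 _ p [seq z ^+ i | i <- iota 0 n]).
- apply/allP => _ /mapP[i _ ->]; apply/rootP/pr.
  by rewrite exprAC (prim_expr_order zP) expr1n.
- rewrite map_inj_in_uniq ?iota_uniq // => i j.
  rewrite !mem_iota !add0n /= => lt_in lt_jn /eqP.
  by rewrite (eq_prim_root_expr zP) !modn_small // => /eqP.
- by rewrite size_map size_iota.
Qed.

(* For fixed [y] both sides are polynomials in [x] of degree below [2 m], so
   agreement at the [2 m]-th roots of unity gives agreement at [x = t]. *)
Lemma negacyclic_ok_fold m r k A B C :
  (0 < m)%N -> (0 < r)%N ->
  cyclic_ok (2 * m) r k (expand (zn r) (zn m) A) (expand (zn r) (zn m) B) C ->
  negacyclic_ok (r * m) k A B (fold (zn r) (zn m) C).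
Proof.
move=> m0 r0 ok b t tn; rewrite row_fold // !row_cols.
set y := t ^+ m; have yr : y ^+ r = -1 by rewrite -exprM mulnC.
pose f j := row r C ((zn b * zn (2 * m) + zn j) * zn r)%Z y.
pose pC := \poly_(j < 2 * m) f j.
pose pA := \poly_(j < m) col m r A b j y.
pose pB := \poly_(j < m) col m r B b j y.
have : pC - k *: (pA * pB) = 0.
  apply: (@poly_eq_on_unity (2 * m)); first by rewrite muln_gt0.
    apply: leq_trans (size_polyD _ _) _; rewrite geq_max size_poly size_polyN.
    apply: leq_trans (size_scale_leq _ _) _.
    apply: leq_trans (size_polyMleq _ _) _.
    apply: leq_trans (leq_pred _) _.
    by rewrite mul2n -addnn leq_add ?size_poly.
  move=> x x2m; rewrite !hornerE !horner_poly.
  have := ok b x y x2m yr; rewrite !ev2_expand /ev2 => ->.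
  by rewrite mulrA; apply: subrr.
move=> /(congr1 (fun p => p.[t])); rewrite !hornerE !horner_poly => /eqP.
by rewrite subr_eq0 => /eqP.
Qed.

Lemma negacyclic_ok_base2 A B : negacyclic_ok 2 1 A B (base2 A B).
Proof.
move=> b t t2; rewrite mul1r /row !big_ord_recl !big_ord0 /= /bump /=.
rewrite !addr0 expr0 !mulr1 expr1.
have q0 : (zn b * zn 2 + zn 0)%Z = (zn b * 2)%Z by lia.
have q1 : (zn b * zn 2 + zn 1)%Z = (zn b * 2 + 1)%Z by lia.
rewrite q0 q1 /base2 Z.mod_mul; last by [].
have -> : ((zn b * 2 + 1) mod 2 = 1)%Z.
  by symmetry; apply: (Z.mod_unique _ _ (zn b)); lia.
cbv zeta; rewrite Z.sub_0_r Z.mul_0_r Z.sub_0_r.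
have -> : (zn b * 2 + 1 - 1 = zn b * 2)%Z by lia.
have -> : (zn b * 2 + 1 - 1 = zn b * 2)%Z by lia.
rewrite !zCD !zCM.
have -> : zC (0 - 1) = -1 by [].
have -> : zC (2 * 1 - 1) = 1 by [].
set a0 := zC _; set b0 := zC _; set a1 := zC _; set b1 := zC _.
have -> : (a0 + a1 * t) * (b0 + b1 * t)
        = a0 * b0 + (a0 * b1 + a1 * b0) * t + a1 * b1 * t ^+ 2.
  rewrite mulrDl !mulrDr (mulrA a0 b1) (mulrAC a1 t b0) (mulrACA a1 t b1).
  by rewrite mulrDl expr2 !addrA.
by rewrite t2 mulN1r mul1r mulrN1 addrAC.
Qed.

Lemma zn_pow2 (a : nat) : (2 ^ zn a)%Z = zn (2 ^ a)%N.
Proof.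
elim: a => [|a IH]; first by [].
by rewrite Nat2Z.inj_succ Z.pow_succ_r ?IH ?expnS -?multE; lia.
Qed.

(** The layers [h = 1, 2, ..., 2^a] contribute a factor 2 each, together [2^(a+1)]. *)
Lemma cyclic_ok_unbflys (a r : nat) k A B C :
  (2 ^ a %| r)%N ->
  cyclic_ok 1 r k (bflys (zn r) a A) (bflys (zn r) a B) C ->
  cyclic_ok (2 * 2 ^ a) r (zC (2 ^ zn a.+1)%Z * k) A B (unbflys (zn r) a C).
Proof.
elim: a A B => [|a IH] A B hr ok.
  have -> : zC (2 ^ zn 1)%Z = 2%:R by [].
  exact: cyclic_ok_unbfly.
have hr' : (2 ^ a %| r)%N by apply: dvdn_trans hr; rewrite dvdn_exp2l.
have e2 : zC (2 ^ zn a.+2)%Z = 2%:R * zC (2 ^ zn a.+1)%Z.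
  by rewrite [zn a.+2]Nat2Z.inj_succ Z.pow_succ_r ?zCM; last lia.
have := cyclic_ok_unbfly (2 ^ a.+1) r (zC (2 ^ zn a.+1)%Z * k) A B
  (unbflys (zn r) a C).
rewrite -zn_pow2 e2 -mulrA; apply=> //; first by rewrite expn_gt0.
by rewrite [in X in cyclic_ok X]expnS; apply: IH.
Qed.

Lemma negacyclic_ok_inv v ls A B :
  chain v ls ->
  negacyclic_ok (2 ^ v) (zC (kappa ls)) A B
    (backward ls (base2 (forward ls A) (forward ls B))).
Proof.
elim: ls v A B => [|[p a] ls IH] v A B /=.
  by move=> ->; apply: negacyclic_ok_base2.
case=> -[-> [[_ le_ap] _]] /IH ok.
have e : (2 ^ (p + a) = 2 ^ p * 2 ^ a)%N by rewrite expnD.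
rewrite plusE e !zn_pow2 zCM; apply: negacyclic_ok_fold; rewrite ?expn_gt0 //.
rewrite -(zn_pow2 a.+1); apply: cyclic_ok_unbflys.
  by rewrite dvdn_exp2l //; apply/leP.
(* With a single row per block the value no longer depends on [x]; what remains is the negacyclic
   product of length [2^p], the induction hypothesis. *)
exact/cyclic_ok_1/ok.
Qed.

(** * Integer polynomials and the recovery of their coefficients *)

Definition pol := {poly Z}.
Definition padd (p q : pol) : pol := p + q.
Definition pmul (p q : pol) : pol := p * q.
Definition pzero : pol := 0.
Definition pone : pol := 1.
Definition pmono (c v : Z) : pol := c *: 'X^(Z.to_nat v).
(** Zero coefficients below index 0 let [cf_mono_mul] shift by any amount, and they match the table
    cells of negative index, which are never written. *)
Definition cf (p : pol) (z : Z) : Z := if (z <? 0)%Z then 0%Z else p`_(Z.to_nat z).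

Lemma paddA p q r : padd p (padd q r) = padd (padd p q) r.
Proof. exact: addrA. Qed.
Lemma padd0 p : padd p pzero = p. Proof. exact: addr0. Qed.
Lemma pmulC p q : pmul p q = pmul q p. Proof. exact: mulrC. Qed.
Lemma pmulA p q r : pmul p (pmul q r) = pmul (pmul p q) r.
Proof. exact: mulrA. Qed.
Lemma pmul1 p : pmul pone p = p. Proof. exact: mul1r. Qed.
Lemma pmul0 p : pmul pzero p = pzero. Proof. exact: mul0r. Qed.
Lemma pmulDl p q r : pmul (padd p q) r = padd (pmul p r) (pmul q r).
Proof. exact: mulrDl. Qed.

Lemma cf_neg p z : (z < 0)%Z -> cf p z = 0%Z.
Proof. by rewrite /cf => /Z.ltb_lt ->. Qed.

Lemma cf_nat p i : cf p (zn i) = p`_i.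
Proof.
by rewrite /cf Nat2Z.id; case: Z.ltb_spec => //; lia.
Qed.

Lemma cf_zero z : cf pzero z = 0%Z.
Proof. by rewrite /cf coef0; case: ifP. Qed.

Lemma cf_one z : cf pone z = (if (z =? 0)%Z then 1%Z else 0%Z).
Proof.
rewrite /cf coef1; case: Z.ltb_spec => ?; case: Z.eqb_spec => ? //.
- lia.
- by subst z.
- by case: eqP => // e; have {}e : Z.to_nat z = O := e; lia.
Qed.

Lemma cf_add p q z : cf (padd p q) z = (cf p z + cf q z)%Z.
Proof. by rewrite /cf coefD; case: ifP. Qed.

Lemma cf_mono_mul c v p z :
  (0 <= v)%Z -> cf (pmul (pmono c v) p) z = (c * cf p (z - v))%Z.
Proof.
move=> v0; rewrite /cf /pmul /pmono -scalerAl coefZ coefXnM.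
case: Z.ltb_spec => [?|z0]; case: Z.ltb_spec => [?|?]; try lia.
- by case: ltnP => [_|/leP ?]; [rewrite mulr0 Z.mul_0_r | lia].
- case: ltnP => [/ltP ?|_]; first lia.
  have -> : (Z.to_nat z - Z.to_nat v)%N = Z.to_nat (z - v)%Z.
    by rewrite -minusE; lia.
  by [].
Qed.

Lemma pol_ext p q : (forall z, cf p z = cf q z) -> p = q.
Proof. by move=> e; apply/polyP => i; rewrite -!cf_nat e. Qed.

(* The odd powers of a primitive [2 N]-th root of unity are [N] distinct roots
   of [t ^ N = - 1]. *)
Lemma negacyclic_coef (N : nat) k A B C (p q : pol) :
  (0 < N)%N -> (size p + size q <= N.+1)%N ->
  (forall i, (i < N)%N -> A (zn i) = p`_i) ->
  (forall i, (i < N)%N -> B (zn i) = q`_i) ->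
  negacyclic_ok N (zC k) A B C ->
  forall i, (i < N)%N -> C (zn i) = (k * (p * q)`_i)%Z.
Proof.
move=> N0 sz eA eB ok i lt_iN.
have [u uP] : {u : algC | (2 * N).-primitive_root u}.
  by apply: C_prim_root_exists; rewrite muln_gt0.
have uN : u ^+ N = -1.
  have : (u ^+ N) ^+ 2 == 1 by rewrite -exprM mulnC (prim_expr_order uP).
  rewrite sqrf_eq1 => /orP[]/eqP // uN1.
  have := prim_order_dvd uP N; rewrite uN1 eqxx => /dvdn_leq.
  by rewrite N0 => /(_ isT); rewrite leqNgt -{1}[N]mul1n ltn_pmul2r.
pose D : {poly algC} := \poly_(i < N) zC (C (zn i) - k * (p * q)`_i)%Z.
suff D0 : D = 0.
  have := congr1 (fun d : {poly algC} => d`_i) D0.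
  rewrite coef_poly lt_iN coef0 -zC0 => /zC_inj; lia.
apply: (@roots_geq_poly_eq0 _ D [seq u ^+ (2 * j).+1 | j <- iota 0 N]).
- apply/allP => _ /mapP[j _ ->]; apply/rootP.
  set t := u ^+ _; have tN : t ^+ N = -1.
    by rewrite /t exprAC uN exprS mulnC exprM sqrr_sign mulr1.
  have evP (f : pol) (F : Z -> Z) : (size f <= N)%N ->
      (forall i, (i < N)%N -> F (zn i) = f`_i) ->
      row N F (zn 0 * zn N)%Z t = (map_poly zC f).[t].
    move=> sf eF; have mf : (size (map_poly zC f) <= N)%N.
      by apply: leq_trans (size_poly _ _) sf.
    rewrite (horner_coef_wide _ mf) /row; apply: eq_bigr => j' _.
    by rewrite coef_map_id0 // Z.mul_0_l Z.add_0_l eF.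
  have zmorph (f g : pol) : map_poly zC (f * g) = map_poly zC f * map_poly zC g.
    have zE (h : pol) : map_poly zC h = map_poly (intr : int -> algC) (map_poly int_of_Z h).
      by apply/polyP => l; rewrite !coef_map_id0.
    by rewrite !zE !rmorphM.
  (* The bound on [size p + size q] limits each size to [N] only if the other is positive, so a zero
     factor is treated apart. *)
  case: (posnP (size p)) => [/eqP|sp]; last case: (posnP (size q)) => [/eqP|sq].
  + rewrite size_poly_eq0 => /eqP p0; rewrite horner_poly.
    have := ok 0%N t tN; rewrite [row N A _ _]big1 ?mul0r ?mulr0.
      rewrite /row => h; rewrite -[RHS]h; apply: eq_bigr => j' _.
      by rewrite p0 mul0r coef0 Z.mul_0_r Z.sub_0_r Z.mul_0_l.
    by move=> j' _; rewrite Z.mul_0_l Z.add_0_l eA // p0 coef0 mul0r.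
  + rewrite size_poly_eq0 => /eqP q0; rewrite horner_poly.
    have := ok 0%N t tN; rewrite [row N B _ _]big1 ?mulr0.
      rewrite /row => h; rewrite -[RHS]h; apply: eq_bigr => j' _.
      by rewrite q0 mulr0 coef0 Z.mul_0_r Z.sub_0_r Z.mul_0_l.
    by move=> j' _; rewrite Z.mul_0_l Z.add_0_l eB // q0 coef0 mul0r.
  have szp : (size p <= N)%N.
    by rewrite -ltnS; apply: leq_trans sz; rewrite -[X in (X < _)%N]addn0 ltn_add2l.
  have szq : (size q <= N)%N.
    by rewrite -ltnS; apply: leq_trans sz; rewrite -[X in (X < _)%N]add0n ltn_add2r.
  have szpq : (size (p * q)%R <= N)%N.
    apply: leq_trans (size_polyMleq _ _) _.
    by rewrite -ltnS prednK // addn_gt0 sp.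
  have := ok 0%N t tN; rewrite (evP p A) // (evP q B) // -hornerM -zmorph.
  rewrite -(evP (p * q) (fun z => (p * q)`_(Z.to_nat z))) //; last first.
    by move=> i' _; rewrite Nat2Z.id.
  rewrite horner_poly /row big_distrr /= => /eqP; rewrite -subr_eq0 -sumrB => /eqP h.
  rewrite -[RHS]h; apply: eq_bigr => j' _.
  by rewrite Z.mul_0_l !Z.add_0_l Nat2Z.id zCD zCN zCM mulrBl mulrA.
- rewrite map_inj_in_uniq ?iota_uniq // => i1 i2.
  rewrite !mem_iota !add0n /= => lt1 lt2 /eqP.
  rewrite (eq_prim_root_expr uP) !modn_small.
  + by rewrite eqSS eqn_pmul2l // => /eqP.
  + by move/leP: lt2 => ?; apply/leP; rewrite -multE; lia.
  + by move/leP: lt1 => ?; apply/leP; rewrite -multE; lia.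
- by rewrite size_map size_iota size_poly.
Qed.

(** Coefficients of the product up to [R] involve only coefficients of the factors up to [R], so
    both are truncated there. The truncated product has degree at most [2 R], below [2^v], so
    nothing wraps around. *)
Theorem nussbaumer (v : nat) ls (R : Z) (A B : Z -> Z) (p q : pol) :
  chain v ls -> (0 <= R)%Z -> (2 * R + 2 <= 2 ^ Z.of_nat v)%Z ->
  (forall z, (0 <= z < 2 ^ Z.of_nat v)%Z ->
   A z = if (z <? R + 1)%Z then cf p z else 0%Z) ->
  (forall z, (0 <= z < 2 ^ Z.of_nat v)%Z ->
   B z = if (z <? R + 1)%Z then cf q z else 0%Z) ->
  forall z, (0 <= z <= R)%Z ->
  backward ls (base2 (forward ls A) (forward ls B)) z = (kappa ls * cf (pmul p q) z)%Z.
Proof.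
move=> ch R0; rewrite zn_pow2 => RN eA eB z zR.
pose d := (Z.to_nat R).+1.
pose p' : pol := take_poly d p; pose q' : pol := take_poly d q.
have trunc (F : Z -> Z) (f : pol) :
    (forall z, (0 <= z < zn (2 ^ v)%N)%Z ->
     F z = if (z <? R + 1)%Z then cf f z else 0%Z) ->
    forall i, (i < 2 ^ v)%N -> F (zn i) = (take_poly d f)`_i.
  move=> e i /ltP lt_i; rewrite e; last lia.
  rewrite cf_nat coef_take_poly.
  by case: Z.ltb_spec => ?; case: ltnP => [/ltP|/leP] //; rewrite /d; lia.
have szN : (size p' + size q' <= (2 ^ v).+1)%N.
  apply: (@leq_trans (d + d)); first by rewrite leq_add ?size_take_poly.
  by apply/leP; rewrite -plusE /d; lia.
have := negacyclic_coef (2 ^ v) _ _ _ _ p' q' _ szN (trunc _ _ eA) (trunc _ _ eB)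
  (negacyclic_ok_inv v ls A B ch) (Z.to_nat z).
rewrite Z2Nat.id; last lia.
move=> ->; rewrite ?expn_gt0 //; last by apply/ltP; lia.
rewrite /cf; case: Z.ltb_spec => ?; first lia.
congr (_ * _)%Z; rewrite /pmul !coefM; apply: eq_bigr => i _.
rewrite !coef_take_poly.
have /ltP lt_i := ltn_ord i.
have -> : (i < d)%N by apply/ltP; rewrite /d; lia.
by have -> : (Z.to_nat z - i < d)%N by apply/ltP; rewrite -minusE /d; lia.
Qed.

End Nussbaumer.

(* Every pass computes each entry from at most two entries, with coefficients of
   absolute value at most 1; so it reads only the first [L] entries and at most
   doubles the amplitude. *)
Definition lin2 (f : (Z -> Z) -> Z) (L : Z) : Prop :=
  exists s x t y, 0 <= x < L /\ 0 <= y < L /\ Z.abs s <= 1 /\ Z.abs t <= 1 /\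
    forall A, f A = s * A x + t * A y.

Lemma lin2_ext f L A A' :
  lin2 f L -> (forall i, 0 <= i < L -> A i = A' i) -> f A = f A'.
Proof.
  intros (s & x & t & y & Hx & Hy & _ & _ & E) H. rewrite !E, !H; auto.
Qed.

Lemma lin2_bound f L A amp :
  lin2 f L -> (forall i, 0 <= i < L -> Z.abs (A i) <= amp) ->
  Z.abs (f A) <= 2 * amp.
Proof.
  intros (s & x & t & y & Hx & Hy & Hs & Ht & E) H. rewrite E.
  pose proof (H x Hx). pose proof (H y Hy).
  assert (Z.abs (s * A x) <= amp) by (rewrite Z.abs_mul; nia).
  assert (Z.abs (t * A y) <= amp) by (rewrite Z.abs_mul; nia).
  lia.
Qed.

Lemma block_decomp (q h r nb : Z) :
  0 < r -> 0 < h -> 0 <= q < nb * h * r ->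
  exists b j i, q = (b * h + j) * r + i /\ 0 <= b < nb /\ 0 <= j < h /\ 0 <= i < r.
Proof.
  intros Hr Hh Hq.
  exists (q / r / h), ((q / r) mod h), (q mod r).
  pose proof (Z.div_mod q r ltac:(lia)). pose proof (Z.mod_pos_bound q r Hr).
  pose proof (Z.div_mod (q / r) h ltac:(lia)).
  pose proof (Z.mod_pos_bound (q / r) h Hh).
  assert (0 <= q / r) by (apply Z.div_pos; lia).
  assert (q / r < nb * h) by (apply Z.div_lt_upper_bound; lia).
  assert (0 <= q / r / h) by (apply Z.div_pos; lia).
  assert (q / r / h < nb) by (apply Z.div_lt_upper_bound; lia).
  repeat split; lia.
Qed.

Lemma row_index (row k H r : Z) :
  0 <= row < H -> 0 <= k < r -> 0 <= row * r + k < H * r.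
Proof. nia. Qed.

Lemma sgn_abs (b : bool) : Z.abs (1 - 2 * (if b then 1 else 0)) <= 1.
Proof. destruct b; lia. Qed.

Lemma bfly_lin2 r h nb q :
  0 < r -> 0 < h -> 0 <= q < nb * (2 * h) * r ->
  lin2 (fun A => bfly r h A q) (nb * (2 * h) * r).
Proof.
  intros Hr Hh Hq.
  destruct (block_decomp q h r (2 * nb) Hr Hh ltac:(lia))
    as (b' & j & i & -> & Hb & Hj & Hi).
  pose proof (Z.div_mod b' 2 ltac:(lia)) as E.
  pose proof (Z.mod_pos_bound b' 2 ltac:(lia)) as Hsg.
  set (b := b' / 2) in *. set (sg := b' mod 2) in *. clearbody b sg. subst b'.
  pose proof (Z.mod_pos_bound (i - sg * (r / h * j)) r Hr) as Hm.
  exists (1 - 2 * (if i <? sg * (r / h * j) then 1 else 0)),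
    ((b * (2 * h) + j) * r + (i - sg * (r / h * j)) mod r),
    ((1 - 2 * sg) * (1 - 2 * (if i <? sg * (r / h * j) then 1 else 0))),
    ((b * (2 * h) + (j + h)) * r + (i - sg * (r / h * j)) mod r).
  split; [apply row_index; [apply row_index; lia | lia]|].
  split; [apply row_index; [apply row_index; lia | lia]|].
  split; [apply sgn_abs|]. split.
  { rewrite Z.abs_mul. pose proof (sgn_abs (i <? sg * (r / h * j))).
    assert (Z.abs (1 - 2 * sg) <= 1) by lia. nia. }
  intros A. rewrite bfly_index by lia. unfold negashift. ring.
Qed.

Lemma unbfly_lin2 r h nb q :
  0 < r -> 0 < h -> 0 <= q < nb * (2 * h) * r ->
  lin2 (fun A => unbfly r h A q) (nb * (2 * h) * r).
Proof.
  intros Hr Hh Hq.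
  destruct (block_decomp q (2 * h) r nb Hr ltac:(lia) ltac:(lia))
    as (b & jj & i & -> & Hb & Hjj & Hi).
  pose proof (Z.div_mod jj h ltac:(lia)) as E.
  pose proof (Z.mod_pos_bound jj h Hh) as Hj.
  assert (Hsg : 0 <= jj / h < 2).
  { split; [apply Z.div_pos | apply Z.div_lt_upper_bound]; lia. }
  set (sg := jj / h) in *. set (j := jj mod h) in *. clearbody j sg.
  replace jj with (sg * h + j) by lia.
  pose proof (Z.mod_pos_bound (i - (r - r / h * j)) r Hr) as Hm.
  exists 1, ((b * (2 * h) + j) * r + i),
    ((2 * sg - 1) * (1 - 2 * (if i <? (r - r / h * j) then 1 else 0))),
    ((b * (2 * h) + (j + h)) * r + (i - (r - r / h * j)) mod r).
  split; [apply row_index; [apply row_index; lia | lia]|].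
  split; [apply row_index; [apply row_index; lia | lia]|].
  split; [lia|]. split.
  { rewrite Z.abs_mul. pose proof (sgn_abs (i <? (r - r / h * j))).
    assert (Z.abs (2 * sg - 1) <= 1) by lia. nia. }
  intros A. rewrite unbfly_index by lia. unfold negashift. ring.
Qed.

Lemma expand_lin2 r m nb q :
  0 < r -> 0 < m -> 0 <= q < nb * (2 * m) * r ->
  lin2 (fun A => expand r m A q) (nb * (r * m)).
Proof.
  intros Hr Hm Hq.
  destruct (block_decomp q (2 * m) r nb Hr ltac:(lia) ltac:(lia))
    as (b & j & i & -> & Hb & Hj & Hi).
  assert (0 < nb * (r * m)) by nia.
  destruct (Z.ltb_spec j m) as [Hjm|Hjm].
  - exists 1, ((b * r + i) * m + j), 0, 0.
    replace (nb * (r * m)) with ((nb * r) * m) in * by ring.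
    split; [apply row_index; [apply row_index; lia | lia]|].
    repeat split; try lia. intros A. rewrite expand_index by lia.
    replace (j <? m) with true by (symmetry; apply Z.ltb_lt; lia).
    replace (b * (r * m) + i * m + j) with ((b * r + i) * m + j) by ring. ring.
  - exists 0, 0, 0, 0. repeat split; try lia. intros A. rewrite expand_index by lia.
    replace (j <? m) with false by (symmetry; apply Z.ltb_ge; lia). ring.
Qed.

Lemma fold_lin2 r m nb q :
  0 < r -> 0 < m -> 0 <= q < nb * (r * m) ->
  lin2 (fun A => fold r m A q) (nb * (2 * m) * r).
Proof.
  intros Hr Hm Hq.
  destruct (block_decomp q r m nb Hm Hr ltac:(lia))
    as (b & i & j & -> & Hb & Hi & Hj).
  pose proof (Z.mod_pos_bound (i - 1) r Hr) as Hmd.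
  exists 1, ((b * (2 * m) + j) * r + i), (1 - 2 * (if i <? 1 then 1 else 0)),
    ((b * (2 * m) + (j + m)) * r + (i - 1) mod r).
  split; [apply row_index; [apply row_index; lia | lia]|].
  split; [apply row_index; [apply row_index; lia | lia]|].
  split; [lia|]. split; [apply sgn_abs|].
  intros A. rewrite fold_index by lia. unfold negashift. ring.
Qed.

(** The only pass that multiplies data: it squares the amplitude where the linear passes double it.
    The even length keeps the pairs inside the array. *)
Lemma base2_reads nb q A A' B B' amp :
  0 <= q < 2 * nb ->
  (forall i, 0 <= i < 2 * nb -> A i = A' i) ->
  (forall i, 0 <= i < 2 * nb -> B i = B' i) ->
  (forall i, 0 <= i < 2 * nb -> Z.abs (A' i) <= amp) ->
  (forall i, 0 <= i < 2 * nb -> Z.abs (B' i) <= amp) ->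
  base2 A B q = base2 A' B' q /\ Z.abs (base2 A' B' q) <= 2 * (amp * amp).
Proof.
  intros Hq HA HB HbA HbB. unfold base2.
  pose proof (Z.div_mod q 2 ltac:(lia)). pose proof (Z.mod_pos_bound q 2 ltac:(lia)).
  set (i := q mod 2) in *. clearbody i. cbv zeta.
  set (z := q - i + 1 - i). set (y := q - i + 1). set (x := q - i).
  assert (0 <= x < 2 * nb /\ 0 <= y < 2 * nb /\ 0 <= z < 2 * nb) as (Hx & Hy & Hz)
    by (unfold x, y, z; lia).
  rewrite !HA, !HB by lia. split; [reflexivity|].
  assert (forall a b, Z.abs a <= amp -> Z.abs b <= amp -> Z.abs (a * b) <= amp * amp).
  { intros. rewrite Z.abs_mul. nia. }
  pose proof (H1 _ _ (HbA x Hx) (HbB q Hq)).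
  pose proof (H1 _ _ (HbA y Hy) (HbB z Hz)).
  assert (Hs1 : Z.abs (2 * i - 1) = 1) by lia.
  eapply Z.le_trans; [apply Z.abs_triangle|]. rewrite (Z.abs_mul (2 * i - 1)), Hs1. lia.
Qed.

(** * Number of passes, growth of the values and of the arrays *)

Definition npass (ls : list (nat * nat)) : nat :=
  fold_right (fun pa n => snd pa + 2 + n)%nat 0%nat ls.

Lemma npass_cons p a ls : npass ((p, a) :: ls) = (a + 2 + npass ls)%nat.
Proof. reflexivity. Qed.

(** A level makes one [expand] and [a + 1] butterflies, and [a + 2 + 4 p <= 4 (p + a)]. Values thus
    grow by at most [2^(4 v)], the fourth power of the transform length; this is the origin of
    [(4 * R + 4) ^ 4] below. *)
Lemma npass_bound v ls : chain v ls -> (npass ls <= 4 * v)%nat.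
Proof.
  revert v. induction ls as [|[p a] ls IH]; intros v.
  - simpl. lia.
  - intros [H1 H2]. rewrite npass_cons. apply IH in H2. lia.
Qed.

Lemma chain_length v ls : chain v ls -> (length ls < v)%nat.
Proof.
  revert v. induction ls as [|[p a] ls IH]; intros v; simpl; [lia|].
  intros [H1 H2]. apply IH in H2. lia.
Qed.

(** Padding doubles the array at each level while the exponent drops to [p <= (v + 1) / 2]. The form
    with [v - 1] is the one that passes through the induction: [2 * (p - 1) <= v - 1] absorbs the
    rounding. *)
Lemma chain_blowup v ls :
  chain v ls -> (2 ^ length ls <= 2 * v /\ (2 <= v -> 2 ^ length ls <= 2 * (v - 1)))%nat.
Proof.
  revert v. induction ls as [|[p a] ls IH]; intros v.
  - simpl. lia.
  - intros [H1 H2]. destruct (IH _ H2) as [I1 I2].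
    apply chain_length in H2 as Hl. cbn [length]. rewrite Nat.pow_succ_r'.
    destruct ls as [|[p' a'] ls]; cbn [length] in *; simpl Nat.pow in *; lia.
Qed.

Lemma chain_exists v : (1 <= v)%nat -> exists ls, chain v ls.
Proof.
  induction v as [v IH] using lt_wf_ind. intros Hv.
  destruct (Nat.eq_dec v 1) as [->|Hne]; [now exists []|].
  pose proof (Nat.div_mod v 2 ltac:(lia)). pose proof (Nat.mod_upper_bound v 2 ltac:(lia)).
  destruct (IH (v - v / 2)%nat) as [ls Hls]; [lia|lia|].
  exists ((v - v / 2, v / 2)%nat :: ls). cbn [chain]. split; [lia|auto].
Qed.

Lemma kappa_pos ls : 0 < kappa ls.
Proof.
  induction ls as [|[p a] ls IH]; [simpl; lia|].
  change (0 < 2 ^ Z.of_nat (S a) * kappa ls).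
  apply Z.mul_pos_pos; auto. apply Z.pow_pos_nonneg; lia.
Qed.

Lemma kappa_bound ls : kappa ls <= 2 ^ Z.of_nat (npass ls).
Proof.
  induction ls as [|[p a] ls IH]; [simpl; lia|].
  rewrite npass_cons.
  change (kappa ((p, a) :: ls)) with (2 ^ Z.of_nat (S a) * kappa ls).
  rewrite Nat2Z.inj_add, Z.pow_add_r by lia. pose proof (kappa_pos ls).
  assert (2 ^ Z.of_nat (S a) <= 2 ^ Z.of_nat (a + 2)) by (apply Z.pow_le_mono_r; lia).
  nia.
Qed.

(** * Total correctness and cost of programs *)

#[local] Arguments Z.add : simpl never.
#[local] Arguments Z.sub : simpl never.
#[local] Arguments Z.mul : simpl never.
#[local] Arguments Z.pow : simpl never.
#[local] Arguments Z.of_nat : simpl never.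

Notation "a '+!' b" := (Bin Defs.Add a b) (at level 50, left associativity).
Notation "a '-!' b" := (Bin Sub a b) (at level 50, left associativity).
Notation "a '*!' b" := (Bin Mul a b) (at level 40, left associativity).
Notation "a '/!' b" := (Bin Div a b) (at level 40, left associativity).
Notation "a '%!' b" := (Bin Mod a b) (at level 40, left associativity).
Notation "a '=!' b" := (Bin Eq a b) (at level 70, no associativity).
Notation "a '<!' b" := (Bin Lt a b) (at level 70, no associativity).
Notation "c1 ';;' c2" := (Seq c1 c2) (at level 90, right associativity).
Notation "x '::=' e" := (Assign x e) (at level 85, no associativity).

Definition For (x : nat) (lim : expr) (body : cmd) : cmd :=
  x ::= Cst 0 ;; While (Var x <! lim) (body ;; x ::= Var x +! Cst 1).

Definition bop (o : binop) (a b : Z) : Z :=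
  match o with
  | Defs.Add => a + b
  | Sub => a - b
  | Mul => a * b
  | Div => a / b
  | Mod => a mod b
  | Eq => if a =? b then 1 else 0
  | Lt => if a <? b then 1 else 0
  end.

(* Evaluation without overflow. *)
Fixpoint ev (s : state) (e : expr) : Z :=
  match e with
  | Cst z => z
  | Var x => regs s x
  | Read e1 => mem s (ev s e1)
  | Bin o e1 e2 => bop o (ev s e1) (ev s e2)
  end.

(** Exponent of [V] in a bound on the value: an operation on operands bounded by numbers at least 2
    is bounded by their product, so leaves are counted. A read returns at most [V], but its address
    must be representable as well. *)
Fixpoint esz (e : expr) : nat :=
  match e with
  | Cst _ | Var _ => 1
  | Read e1 => esz e1
  | Bin _ e1 e2 => esz e1 + esz e2
  end.

Definition ec (e : expr) : Z := Z.of_nat (expr_cost e).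

Lemma ec_var x : ec (Var x) = 1. Proof. reflexivity. Qed.
Lemma ec_cst z : ec (Cst z) = 1. Proof. reflexivity. Qed.
Lemma ec_read e : ec (Read e) = 1 + ec e.
Proof. unfold ec. simpl expr_cost. lia. Qed.
Lemma ec_bin o e1 e2 : ec (Bin o e1 e2) = 1 + ec e1 + ec e2.
Proof. unfold ec. simpl expr_cost. lia. Qed.

Ltac ecs := repeat (progress rewrite ?ec_bin, ?ec_read, ?ec_var, ?ec_cst in *).

Ltac esz_side := simpl; lia.
Ltac ec_side := ecs; lia.

Lemma set_reg_eq s x v : regs (set_reg s x v) x = v.
Proof. simpl. now rewrite Nat.eqb_refl. Qed.

Lemma set_reg_neq s x y v : y <> x -> regs (set_reg s x v) y = regs s y.
Proof. intros H. simpl. now apply Nat.eqb_neq in H as ->. Qed.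

(* If all registers and memory cells are at most [V] in absolute value, then an
   expression of size at most [K] takes intermediate values at most [V ^ K] and so
   never gets stuck on overflow.  [M] is the number of arrays: entry [i] of array
   [tau] is at address [i * M + tau]. *)
Class Machine := {
  word_size : Z;
  V : Z;
  M : Z;
  K : nat;
  V_ge : 2 <= V;
  M_range : 8 <= M <= V;
  K_ge : (300 <= K)%nat;
  word_fits : V ^ Z.of_nat K < 2 ^ (word_size - 1)
}.

Section Machine.

Context {mc : Machine}.

Let HV : 2 <= V := V_ge.
Let HM : 8 <= M <= V := M_range.
Let HK0 : (300 <= K)%nat := K_ge.
Let HW : V ^ Z.of_nat K < 2 ^ (word_size - 1) := word_fits.

Fixpoint okE (s : state) (e : expr) : Prop :=
  match e with
  | Cst z => Z.abs z <= V
  | Var _ => True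
  | Read e1 => okE s e1
  | Bin o e1 e2 =>
      okE s e1 /\ okE s e2 /\
      match o with Div | Mod => ev s e2 <> 0 | _ => True end
  end.

Definition small (s : state) : Prop :=
  (forall x, Z.abs (regs s x) <= V) /\ (forall a, Z.abs (mem s a) <= V).

Lemma esz_pos e : (1 <= esz e)%nat.
Proof. induction e; simpl; lia. Qed.

Lemma V_pow_mono a b : (a <= b)%nat -> V ^ Z.of_nat a <= V ^ Z.of_nat b.
Proof. intros. apply Z.pow_le_mono_r; lia. Qed.

Lemma V_pow_ge e : V <= V ^ Z.of_nat (esz e).
Proof.
  rewrite <- (Z.pow_1_r V) at 1. apply Z.pow_le_mono_r; [lia|].
  pose proof (esz_pos e). lia.
Qed.

Lemma word_ok z : Z.abs z <= V ^ Z.of_nat K -> word word_size z = Some z.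
Proof.
  intros H. unfold word.
  replace ((- 2 ^ (word_size - 1) <=? z) && (z <? 2 ^ (word_size - 1)))%bool with true; auto.
  symmetry. apply andb_true_intro. split; [apply Z.leb_le | apply Z.ltb_lt]; lia.
Qed.

Lemma bop_bound o a b x y :
  Z.abs a <= x -> Z.abs b <= y -> 2 <= x -> 2 <= y ->
  match o with Div | Mod => b <> 0 | _ => True end ->
  Z.abs (bop o a b) <= x * y.
Proof.
  intros Ha Hb Hx Hy Hd. destruct o; simpl; try nia.
  - assert (Z.abs (a / b) <= Z.abs a).
    { assert (a = b * (a / b) + a mod b) by (apply Z.div_mod; lia).
      destruct (Z.lt_ge_cases b 0).
      - pose proof (Z.mod_neg_bound a b ltac:(lia)). nia.
      - pose proof (Z.mod_pos_bound a b ltac:(lia)). nia. }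
    nia.
  - assert (Z.abs (a mod b) <= Z.abs b).
    { destruct (Z.lt_ge_cases b 0).
      - pose proof (Z.mod_neg_bound a b ltac:(lia)). lia.
      - pose proof (Z.mod_pos_bound a b ltac:(lia)). lia. }
    nia.
  - destruct (a =? b); nia.
  - destruct (a <? b); nia.
Qed.

Lemma ev_bound s e :
  small s -> okE s e -> Z.abs (ev s e) <= V ^ Z.of_nat (esz e).
Proof.
  intros [Hr Hm]. induction e as [z|x|e IH|o e1 IH1 e2 IH2]; intros Hok.
  - change (V ^ Z.of_nat (esz (Cst z))) with (V ^ 1). rewrite Z.pow_1_r. exact Hok.
  - change (V ^ Z.of_nat (esz (Var x))) with (V ^ 1). rewrite Z.pow_1_r. apply Hr.
  - simpl. eapply Z.le_trans; [apply Hm | apply V_pow_ge].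
  - destruct Hok as (H1 & H2 & H3). simpl ev. simpl esz.
    rewrite Nat2Z.inj_add, Z.pow_add_r by lia.
    pose proof (V_pow_ge e1). pose proof (V_pow_ge e2).
    apply bop_bound; auto; lia.
Qed.

Lemma eval_ev s e :
  small s -> okE s e -> (esz e <= K)%nat -> eval word_size s e = Some (ev s e).
Proof.
  intros Hs. induction e as [z|x|e IH|o e1 IH1 e2 IH2]; intros Hok HK.
  - apply word_ok. change (ev s (Cst z)) with z. simpl in Hok.
    eapply Z.le_trans; [exact Hok|].
    eapply Z.le_trans; [apply (V_pow_ge (Cst z)) | apply V_pow_mono, HK].
  - reflexivity.
  - simpl. now rewrite IH.
  - pose proof (ev_bound s (Bin o e1 e2) Hs Hok) as Hb.
    assert (Hw : word word_size (bop o (ev s e1) (ev s e2))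
                 = Some (bop o (ev s e1) (ev s e2))).
    { apply word_ok. eapply Z.le_trans; [exact Hb | apply V_pow_mono, HK]. }
    destruct Hok as (H1 & H2 & H3). simpl in HK. simpl.
    rewrite IH1, IH2 by (auto; lia).
    destruct o; simpl in *; auto;
      (replace (ev s e2 =? 0) with false by (symmetry; apply Z.eqb_neq; auto));
      exact Hw.
Qed.

Lemma small_set_reg s x v : small s -> Z.abs v <= V -> small (set_reg s x v).
Proof.
  intros [Hr Hm] Hv. split; simpl; auto. intros y. now destruct (Nat.eqb y x).
Qed.

Lemma small_set_mem s a v : small s -> Z.abs v <= V -> small (set_mem s a v).
Proof.
  intros [Hr Hm] Hv. split; simpl; auto. intros y. now destruct (y =? a).
Qed.

(** Total correctness with a step bound. Smallness of the final state is part of it, so that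
    overflow needs attention only where a value is stored. *)
Definition trm (c : cmd) (s : state) (n : Z) (Q : state -> Prop) : Prop :=
  exists m s', exec word_size c s m s' /\ Z.of_nat m <= n /\ small s' /\ Q s'.

Lemma trm_weaken c s n n' (Q Q' : state -> Prop) :
  trm c s n Q -> n <= n' -> (forall s', small s' -> Q s' -> Q' s') ->
  trm c s n' Q'.
Proof.
  intros (m & s' & He & Hm & Hs & HQ) Hn HQ'. exists m, s'.
  repeat split; auto; try lia; apply Hs.
Qed.

Lemma trm_assign x e s n (Q : state -> Prop) :
  small s -> okE s e -> (esz e <= K)%nat -> Z.abs (ev s e) <= V ->
  1 + ec e <= n -> Q (set_reg s x (ev s e)) -> trm (x ::= e) s n Q.
Proof.
  intros Hs Hok HK Hv Hn HQ. do 2 eexists. split; [|split; [|split; [|exact HQ]]].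
  - apply exec_assign, eval_ev; auto.
  - unfold ec in Hn. lia.
  - now apply small_set_reg.
Qed.

Lemma trm_write e1 e2 s n (Q : state -> Prop) :
  small s -> okE s e1 -> okE s e2 -> (esz e1 <= K)%nat -> (esz e2 <= K)%nat ->
  Z.abs (ev s e2) <= V -> 1 + ec e1 + ec e2 <= n ->
  Q (set_mem s (ev s e1) (ev s e2)) -> trm (Write e1 e2) s n Q.
Proof.
  intros Hs Ho1 Ho2 HK1 HK2 Hv Hn HQ.
  do 2 eexists. split; [|split; [|split; [|exact HQ]]].
  - apply exec_write; apply eval_ev; auto.
  - unfold ec in Hn. lia.
  - now apply small_set_mem.
Qed.

Lemma trm_seq c1 c2 s n1 n2 (Q1 Q : state -> Prop) :
  trm c1 s n1 Q1 -> (forall s', small s' -> Q1 s' -> trm c2 s' n2 Q) ->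
  trm (c1 ;; c2) s (n1 + n2) Q.
Proof.
  intros (m1 & s1 & He1 & Hm1 & Hs1 & HQ1) H2.
  destruct (H2 s1 Hs1 HQ1) as (m2 & s2 & He2 & Hm2 & Hs2 & HQ2).
  exists (m1 + m2)%nat, s2. split; [econstructor; eauto|].
  repeat split; auto; try lia; apply Hs2.
Qed.

Lemma trm_if e c1 c2 s n (Q : state -> Prop) :
  small s -> okE s e -> (esz e <= K)%nat ->
  (ev s e <> 0 -> trm c1 s n Q) -> (ev s e = 0 -> trm c2 s n Q) ->
  trm (If e c1 c2) s (1 + ec e + n) Q.
Proof.
  intros Hs Hok HK H1 H2. destruct (Z.eq_dec (ev s e) 0) as [E|E].
  - destruct (H2 E) as (m & s' & He & Hm & Hs' & HQ).
    exists (1 + expr_cost e + m)%nat, s'. split.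
    + apply exec_if_false; auto. rewrite <- E. apply eval_ev; auto.
    + unfold ec. repeat split; auto; try lia; apply Hs'.
  - destruct (H1 E) as (m & s' & He & Hm & Hs' & HQ).
    exists (1 + expr_cost e + m)%nat, s'. split.
    + eapply exec_if_true; eauto. apply eval_ev; auto.
    + unfold ec. repeat split; auto; try lia; apply Hs'.
Qed.

Lemma trm_skip s n (Q : state -> Prop) : small s -> 1 <= n -> Q s -> trm Skip s n Q.
Proof. intros Hs Hn HQ. exists 1%nat, s. repeat split; auto; try lia; try apply Hs. constructor. Qed.

(** The invariant is indexed by the number of rounds that remain, which gives termination and cost
    at once. *)
Lemma trm_while e c (I : nat -> state -> Prop) nb (Q : state -> Prop) N :
  (esz e <= K)%nat ->
  (forall j s, small s -> I (S j) s ->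
     okE s e /\ ev s e <> 0 /\ trm c s nb (I j)) ->
  (forall s, small s -> I O s -> okE s e /\ ev s e = 0 /\ Q s) ->
  forall s n, small s -> I N s ->
  Z.of_nat N * (1 + ec e + nb) + 1 + ec e <= n -> trm (While e c) s n Q.
Proof.
  intros HK HS H0. induction N as [|N IH]; intros s n Hs HI Hn.
  - destruct (H0 s Hs HI) as (Hok & Hev & HQ).
    exists (1 + expr_cost e)%nat, s. split.
    + apply exec_while_false. rewrite <- Hev. apply eval_ev; auto.
    + unfold ec in Hn. repeat split; auto; try lia; apply Hs.
  - destruct (HS N s Hs HI) as (Hok & Hev & m & s' & He & Hm & Hs' & HI').
    destruct (IH s' (n - (1 + ec e + nb)) Hs' HI') as (m2 & s2 & He2 & Hm2 & Hs2 & HQ2);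
      [lia|].
    exists (1 + expr_cost e + m + m2)%nat, s2. split.
    + eapply exec_while_true; eauto. apply eval_ev; auto.
    + unfold ec in *. repeat split; auto; try lia; apply Hs2.
Qed.

Lemma trm_while_step e c s n1 n2 n (Q1 Q : state -> Prop) :
  small s -> okE s e -> (esz e <= K)%nat -> ev s e <> 0 ->
  trm c s n1 Q1 ->
  (forall s', small s' -> Q1 s' -> trm (While e c) s' n2 Q) ->
  1 + ec e + n1 + n2 <= n -> trm (While e c) s n Q.
Proof.
  intros Hs Hok HK Hev (m1 & s1 & He1 & Hm1 & Hs1 & HQ1) H2 Hn.
  destruct (H2 s1 Hs1 HQ1) as (m2 & s2 & He2 & Hm2 & Hs2 & HQ2).
  exists (1 + expr_cost e + m1 + m2)%nat, s2. split.
  - eapply exec_while_true; eauto. apply eval_ev; auto.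
  - unfold ec in *. repeat split; auto; try lia; apply Hs2.
Qed.

Lemma trm_while_exit e c s n (Q : state -> Prop) :
  small s -> okE s e -> (esz e <= K)%nat -> ev s e = 0 -> 1 + ec e <= n -> Q s ->
  trm (While e c) s n Q.
Proof.
  intros Hs Hok HK Hev Hn HQ. exists (1 + expr_cost e)%nat, s. split.
  - apply exec_while_false. rewrite <- Hev. apply eval_ev; auto.
  - unfold ec in *. repeat split; auto; try lia; apply Hs.
Qed.

Lemma trm_seq_le c1 c2 s n1 n2 n (Q1 Q : state -> Prop) :
  trm c1 s n1 Q1 -> (forall s', small s' -> Q1 s' -> trm c2 s' n2 Q) ->
  n1 + n2 <= n -> trm (c1 ;; c2) s n Q.
Proof.
  intros H1 H2 Hn. eapply trm_weaken; [eapply trm_seq; eauto | lia | auto].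
Qed.

Lemma trm_bind c1 c2 s n1 n2 n (Q : state -> Prop) :
  trm c1 s n1 (fun s' => trm c2 s' n2 Q) -> n1 + n2 <= n -> trm (c1 ;; c2) s n Q.
Proof. intros H1 Hn. eapply trm_seq_le; [exact H1 | intros s' _ H; exact H | exact Hn]. Qed.

Lemma trm_assign_seq x e c s n2 n (Q : state -> Prop) :
  small s -> okE s e -> (esz e <= K)%nat -> Z.abs (ev s e) <= V ->
  (small (set_reg s x (ev s e)) -> trm c (set_reg s x (ev s e)) n2 Q) ->
  1 + ec e + n2 <= n -> trm (x ::= e ;; c) s n Q.
Proof.
  intros. eapply trm_seq_le with (n1 := 1 + ec e); [|intros s' Hs' E|eassumption].
  - apply trm_assign with (Q := fun s' => s' = set_reg s x (ev s e)); auto. lia.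
  - cbv beta in E. subst s'. auto.
Qed.

Lemma trm_for x lim body (I : Z -> state -> Prop) nb N s n (Q : state -> Prop) :
  (2 + esz lim <= K)%nat -> 0 <= N <= V ->
  small s -> I 0 (set_reg s x 0) ->
  (forall i s', 0 <= i <= N -> small s' -> I i s' -> regs s' x = i ->
     okE s' lim /\ ev s' lim = N) ->
  (forall i s', 0 <= i < N -> small s' -> I i s' -> regs s' x = i ->
     trm body s' nb (fun s'' => regs s'' x = i /\ I (i + 1) (set_reg s'' x (i + 1)))) ->
  (forall s', small s' -> I N s' -> regs s' x = N -> Q s') ->
  N * (ec lim + nb + 7) + ec lim + 5 <= n ->
  trm (For x lim body) s n Q.
Proof.
  intros HK HN Hs HI0 Hlim Hbody HQ Hn. unfold For.
  assert (He : ec (Var x <! lim) = 2 + ec lim) by (ecs; lia).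
  replace n with (2 + (n - 2)) by lia.
  apply trm_seq with (Q1 := fun s' => s' = set_reg s x 0).
  { apply trm_assign; auto; simpl; try lia; ecs; lia. }
  intros s1 Hs1 ->.
  apply trm_while with (nb := nb + 4) (N := Z.to_nat N)
    (I := fun j s' => Z.of_nat j <= N /\ regs s' x = N - Z.of_nat j /\ I (N - Z.of_nat j) s').
  - simpl; lia.
  - intros j s' Hs' (Hj & Hx & HI).
    destruct (Hlim (N - Z.of_nat (S j)) s' ltac:(lia) Hs' HI Hx) as [Ho El].
    split; [simpl; auto|]. split.
    { simpl. rewrite El, Hx.
      replace (N - Z.of_nat (S j) <? N) with true by (symmetry; apply Z.ltb_lt; lia). lia. }
    apply trm_seq with (Q1 := fun s'' => regs s'' x = N - Z.of_nat (S j) /\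
      I (N - Z.of_nat (S j) + 1) (set_reg s'' x (N - Z.of_nat (S j) + 1))).
    { apply Hbody; auto. lia. }
    intros s2 Hs2 [Hx2 HI2].
    replace (N - Z.of_nat (S j) + 1) with (N - Z.of_nat j) in HI2 by lia.
    apply trm_assign; auto; simpl; try lia.
    { ecs; lia. }
    replace (regs s2 x + 1) with (N - Z.of_nat j) by lia.
    rewrite Nat.eqb_refl. repeat split; auto. lia.
  - intros s' Hs' (_ & Hx & HI). simpl in Hx, HI. rewrite Z.sub_0_r in Hx, HI.
    destruct (Hlim N s' ltac:(lia) Hs' HI Hx) as [Ho El].
    simpl. rewrite El, Hx, Z.ltb_irrefl. auto.
  - apply small_set_reg; auto. lia.
  - rewrite Z2Nat.id, Z.sub_diag by lia. repeat split; auto; try lia.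
    apply set_reg_eq.
  - rewrite He, Z2Nat.id by lia. lia.
Qed.

(** Interleaving leaves every array unbounded in both directions: lengths depend on the instance,
    and only [M] is fixed with the program. *)
Definition arr (s : state) (tau i : Z) : Z := mem s (i * M + tau).
Definition Rd (tau : Z) (e : expr) : expr := Read (e *! Cst M +! Cst tau).
Definition Wr (tau : Z) (e1 e2 : expr) : cmd := Write (e1 *! Cst M +! Cst tau) e2.

Lemma arr_set_mem s tau i v tau' i' :
  0 <= tau < M -> 0 <= tau' < M ->
  arr (set_mem s (i * M + tau) v) tau' i'
  = if ((tau' =? tau) && (i' =? i))%bool then v else arr s tau' i'.
Proof.
  intros H H'. unfold arr. simpl.
  destruct (Z.eqb_spec tau' tau) as [->|Ht]; simpl.
  - destruct (Z.eqb_spec i' i) as [->|Hi]; simpl.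
    + now rewrite Z.eqb_refl.
    + replace (i' * M + tau =? i * M + tau) with false; auto.
      symmetry. apply Z.eqb_neq. nia.
  - replace (i' * M + tau' =? i * M + tau) with false; auto.
    symmetry. apply Z.eqb_neq. intros E. destruct (Z.lt_trichotomy i' i) as [|[->|]]; nia.
Qed.

Lemma arr_set_mem_neq s tau i v tau' i' :
  0 <= tau < M -> 0 <= tau' < M -> tau' <> tau ->
  arr (set_mem s (i * M + tau) v) tau' i' = arr s tau' i'.
Proof.
  intros. rewrite arr_set_mem by auto.
  now replace (tau' =? tau) with false by (symmetry; now apply Z.eqb_neq).
Qed.

Lemma arr_set_reg s x v tau i : arr (set_reg s x v) tau i = arr s tau i.
Proof. reflexivity. Qed.

Definition frame (xs : list nat) (ts : list Z) (s s' : state) : Prop :=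
  (forall x, ~ In x xs -> regs s' x = regs s x) /\
  (forall tau i, 0 <= tau < M -> ~ In tau ts -> arr s' tau i = arr s tau i).

Lemma frame_refl xs ts s : frame xs ts s s.
Proof. split; auto. Qed.

Lemma frame_trans xs ts xs' ts' ys us s1 s2 s3 :
  frame xs ts s1 s2 -> frame xs' ts' s2 s3 ->
  incl xs ys -> incl xs' ys -> incl ts us -> incl ts' us ->
  frame ys us s1 s3.
Proof.
  intros [A1 B1] [A2 B2] H1 H2 H3 H4. split; intros.
  - rewrite A2, A1; auto.
  - rewrite B2, B1; auto.
Qed.

Lemma frame_set_reg xs ts s x v : In x xs -> frame xs ts s (set_reg s x v).
Proof.
  intros H. split; intros; auto. apply set_reg_neq. congruence.
Qed.

Lemma frame_set_mem xs ts s tau i v :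
  0 <= tau < M -> In tau ts -> frame xs ts s (set_mem s (i * M + tau) v).
Proof.
  intros H Hi. split; intros; auto. rewrite arr_set_mem by auto.
  destruct (Z.eqb_spec tau0 tau); [congruence|auto].
Qed.

Lemma trm_wr tau e1 e2 s n (Q : state -> Prop) :
  small s -> 0 <= tau < M -> okE s e1 -> okE s e2 ->
  (esz e1 + 2 <= K)%nat -> (esz e2 <= K)%nat ->
  Z.abs (ev s e2) <= V -> 5 + ec e1 + ec e2 <= n ->
  Q (set_mem s (ev s e1 * M + tau) (ev s e2)) -> trm (Wr tau e1 e2) s n Q.
Proof.
  intros. unfold Wr. apply trm_write; auto; simpl; try lia; auto.
  - repeat split; auto; try lia.
  - ecs. lia.
Qed.

Lemma trm_wr_seq tau e1 e2 c s n2 n (Q : state -> Prop) :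
  small s -> 0 <= tau < M -> okE s e1 -> okE s e2 ->
  (esz e1 + 2 <= K)%nat -> (esz e2 <= K)%nat ->
  Z.abs (ev s e2) <= V ->
  (forall s', small s' -> s' = set_mem s (ev s e1 * M + tau) (ev s e2) ->
     trm c s' n2 Q) ->
  5 + ec e1 + ec e2 + n2 <= n -> trm (Wr tau e1 e2 ;; c) s n Q.
Proof.
  intros. eapply trm_seq_le with (n1 := 5 + ec e1 + ec e2);
    [|intros s' Hs' E|eassumption].
  - apply trm_wr with
      (Q := fun s' => s' = set_mem s (ev s e1 * M + tau) (ev s e2)); auto. lia.
  - auto.
Qed.

(* The values are computed into the scratch array 0 first because [E] may read
   any entry of the array that it overwrites. *)
Definition pass (tau : Z) (E : expr) : cmd :=
  For 5 (Var 7) (Wr 0 (Var 5) E) ;; For 5 (Var 7) (Wr tau (Var 5) (Rd 0 (Var 5))).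

Lemma trm_pass tau E s n g (Q : state -> Prop) :
  small s -> 0 < tau < M -> 0 <= regs s 7 -> (esz E <= K)%nat ->
  (forall i s', 0 <= i < regs s 7 -> frame [5%nat] [0] s s' -> small s' ->
     regs s' 5 = i -> okE s' E /\ ev s' E = g i /\ Z.abs (g i) <= V) ->
  regs s 7 * (ec E + 40) + 20 <= n ->
  (forall s', small s' -> frame [5%nat] [0; tau] s s' ->
    (forall i, arr s' tau i
       = if ((0 <=? i) && (i <? regs s 7))%bool then g i else arr s tau i) -> Q s') ->
  trm (pass tau E) s n Q.
Proof.
  intros Hs Ht HL HE Hg Hn HQ. unfold pass.
  set (L := regs s 7) in *.
  assert (HLV : L <= V) by (destruct Hs as [Hr _]; specialize (Hr 7%nat); fold L in Hr; lia).
  replace n with ((L * (ec E + 16) + 10) + (n - (L * (ec E + 16) + 10))) by lia.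
  apply trm_seq with (Q1 := fun s' => frame [5%nat] [0] s s' /\
     forall i, 0 <= i < L -> arr s' 0 i = g i).
  { apply trm_for with (N := L) (nb := 6 + ec E)
      (I := fun k s' => frame [5%nat] [0] s s' /\ forall i, 0 <= i < k -> arr s' 0 i = g i);
      auto; try lia; try (simpl; lia).
    - split; [apply frame_set_reg; simpl; auto | intros; lia].
    - intros i s' Hi Hs' [[Hf _] _] Hx. simpl. rewrite Hf by (simpl; lia). auto.
    - intros i s' Hi Hs' [Hf Ha] Hx.
      destruct (Hg i s' Hi Hf Hs' Hx) as (Ho & Ee & Hb).
      apply trm_wr; auto; try lia; try exact I; try (simpl; lia).
      { ecs; lia. }
      change (ev s' (Var 5)) with (regs s' 5).
      rewrite Ee, Hx. split; auto. split.
      + eapply frame_trans; [|apply frame_set_reg with (xs := [5%nat]) (ts := [0])| | | |];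
          try apply incl_refl; [|simpl; auto].
        eapply frame_trans; [exact Hf | | | | |]; try apply incl_refl.
        apply frame_set_mem; [lia | simpl; auto].
      + intros i' Hi'. rewrite arr_set_reg, arr_set_mem by lia. simpl.
        destruct (Z.eqb_spec i' i); [now subst | apply Ha; lia].
    - ecs. lia. }
  intros s1 Hs1 [Hf1 Ha1].
  assert (HL1 : regs s1 7 = L) by (apply (proj1 Hf1); simpl; lia).
  apply trm_for with (N := L) (nb := 14)
    (I := fun k s' => frame [5%nat] [0; tau] s s' /\
       (forall i, 0 <= i < L -> arr s' 0 i = g i) /\
       forall i, arr s' tau i
         = if ((0 <=? i) && (i <? k))%bool then g i else arr s tau i);
    auto; try lia; try (simpl; lia).
  - split; [|split]; intros.
    + eapply frame_trans; [exact Hf1 | apply frame_set_reg with (xs := [5%nat]) (ts := []) | | | |];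
        try apply incl_refl; try (simpl; auto; fail); intros z Hz; simpl in *; tauto.
    + apply Ha1; auto.
    + rewrite arr_set_reg, (proj2 Hf1); [| lia | simpl; lia].
      replace ((0 <=? i) && (i <? 0))%bool with false; auto.
      symmetry. apply andb_false_iff.
      rewrite Z.leb_gt, Z.ltb_ge. lia.
  - intros i s' Hi Hs' [[Hf _] _] Hx. simpl. rewrite Hf by (simpl; lia). auto.
  - intros i s' Hi Hs' (Hf & H0 & Ha) Hx.
    assert (Ee : ev s' (Rd 0 (Var 5)) = g i).
    { change (arr s' 0 (regs s' 5) = g i). rewrite Hx. auto. }
    assert (Hb : Z.abs (g i) <= V) by (rewrite <- Ee; apply Hs').
    apply trm_wr; auto; try lia; try exact I; try (simpl; lia).
    { unfold Rd. ecs. lia. }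
    rewrite Ee. change (ev s' (Var 5)) with (regs s' 5). rewrite Hx.
    split; auto. split; [|split].
    + eapply frame_trans; [|apply frame_set_reg with (xs := [5%nat]) (ts := [])| | | |];
        try apply incl_refl; try (simpl; auto; fail); [|intros z Hz; simpl in *; tauto].
      eapply frame_trans; [exact Hf | | | | |]; try apply incl_refl.
      apply frame_set_mem; [lia | simpl; auto].
    + intros i' Hi'. rewrite arr_set_reg, arr_set_mem by lia.
      replace (0 =? tau) with false by (symmetry; apply Z.eqb_neq; lia). simpl. auto.
    + intros i'. rewrite arr_set_reg, arr_set_mem, Z.eqb_refl, Ha by lia.
      change (true && (i' =? i))%bool with (i' =? i).
      destruct (Z.eqb_spec i' i) as [->|].
      * replace ((0 <=? i) && (i <? i + 1))%bool with true; auto.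
        symmetry. apply andb_true_intro. rewrite Z.leb_le, Z.ltb_lt. lia.
      * replace (i' <? i + 1) with (i' <? i); auto.
        destruct (Z.ltb_spec i' i), (Z.ltb_spec i' (i + 1)); auto; lia.
  - intros s' Hs' (Hf & _ & Ha) _. apply HQ; auto.
  - ecs. lia.
Qed.

End Machine.

Ltac conjs := repeat match goal with |- _ /\ _ => split end.

Ltac fr_side := simpl in *; lia.

Ltac unframe :=
  repeat match goal with
    | H : frame _ _ _ ?s |- context [regs ?s ?x] => rewrite (proj1 H x) by fr_side
    | H : frame _ _ _ ?s |- context [arr ?s ?tau ?i] =>
        rewrite (proj2 H tau i) by fr_side
    end.

Ltac frm :=
  split; [intros ?x ?Hx | intros ?tau ?i ?Ht ?Hx];
  repeat first
    [ reflexivity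
    | match goal with
      | H : frame _ _ _ ?s |- regs ?s ?x = _ => rewrite (proj1 H x) by fr_side
      | H : frame _ _ _ ?s |- arr ?s ?tau ?i = _ =>
          rewrite (proj2 H tau i) by fr_side
      end
    | rewrite set_reg_neq by fr_side
    | rewrite arr_set_reg
    | rewrite arr_set_mem_neq by fr_side
    | progress simpl regs ].

(** * The convolution program *)

(* Register 3 holds the number of solutions and register 4 the length of the log;
   5 is the loop counter of [pass], 14 to 16 are the stored value, the sign and the
   set of the current update, and [gen] uses three registers per nesting level from
   20 on.  Arrays: 0 is scratch space, 1 and 2 are the operands of a convolution, 3
   is the stack of block lengths, 4 to 6 are the values, sets and signs of the log. *)
Notation rR := 2%nat (only parsing).
Notation rq := 5%nat (only parsing).
Notation rN := 6%nat (only parsing).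
Notation rL := 7%nat (only parsing).
Notation rn := 8%nat (only parsing).
Notation rr := 9%nat (only parsing).
Notation rm := 10%nat (only parsing).
Notation rh := 11%nat (only parsing).
Notation rl := 12%nat (only parsing).
Notation rk := 13%nat (only parsing).

Definition conv_regs : list nat := [5; 6; 7; 8; 9; 10; 11; 12; 13]%nat.

Section Conv.

Context {mc : Machine}.

Let HV : 2 <= V := V_ge.
Let HM : 8 <= M <= V := M_range.
Let HK0 : (300 <= K)%nat := K_ge.

Definition shE (tau : Z) (base i e : expr) : expr :=
  (Cst 1 -! Cst 2 *! (i <! e)) *! Rd tau (base +! (i -! e) %! Var rr).

(** Follows the body of [bfly] symbol by symbol, so that the two agree by conversion. Signs and case
    distinctions are arithmetic on comparisons, which keeps the loop body free of branches. *)
Definition bflyE (tau : Z) : expr :=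
  let r := Var rr in let h := Var rh in let q := Var rq in
  let i := q %! r in
  let j := (q /! r) %! h in
  let sg := (q /! (r *! h)) %! Cst 2 in
  let base := q /! (r *! h) /! Cst 2 *! (Cst 2 *! h *! r) in
  shE tau (base +! j *! r) i (sg *! (r /! h *! j))
  +! (Cst 1 -! Cst 2 *! sg)
     *! shE tau (base +! (j +! h) *! r) i (sg *! (r /! h *! j)).

Definition unbflyE (tau : Z) : expr :=
  let r := Var rr in let h := Var rh in let q := Var rq in
  let i := q %! r in
  let jj := (q /! r) %! (Cst 2 *! h) in
  let j := jj %! h in
  let sg := jj /! h in
  let base := q /! (r *! (Cst 2 *! h)) *! (Cst 2 *! h *! r) in
  Rd tau (base +! j *! r +! i)
  +! (Cst 2 *! sg -! Cst 1)
     *! shE tau (base +! (j +! h) *! r) i (r -! r /! h *! j).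

Definition expandE (tau : Z) : expr :=
  let r := Var rr in let m := Var rm in let q := Var rq in
  let i := q %! r in
  let j := (q /! r) %! (Cst 2 *! m) in
  let b := q /! (r *! (Cst 2 *! m)) in
  (j <! m) *! Rd tau (b *! (r *! m) +! i *! m +! j).

Definition foldE (tau : Z) : expr :=
  let r := Var rr in let m := Var rm in let q := Var rq in
  let j := q %! m in
  let i := (q /! m) %! r in
  let base := q /! (m *! r) *! (Cst 2 *! m *! r) in
  Rd tau (base +! j *! r +! i) +! shE tau (base +! (j +! m) *! r) i (Cst 1).

Definition base2E : expr :=
  let q := Var rq in
  let i := q %! Cst 2 in
  Rd 1 (q -! i) *! Rd 2 q
  +! (Cst 2 *! i -! Cst 1)
     *! (Rd 1 (q -! i +! Cst 1) *! Rd 2 (q -! i +! Cst 1 -! i)).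

Lemma ev_bflyE tau s :
  ev s (bflyE tau) = bfly (regs s rr) (regs s rh) (arr s tau) (regs s rq).
Proof. reflexivity. Qed.

Lemma ev_unbflyE tau s :
  ev s (unbflyE tau) = unbfly (regs s rr) (regs s rh) (arr s tau) (regs s rq).
Proof. reflexivity. Qed.

Lemma ev_expandE tau s :
  ev s (expandE tau) = expand (regs s rr) (regs s rm) (arr s tau) (regs s rq).
Proof. reflexivity. Qed.

Lemma ev_foldE tau s :
  ev s (foldE tau) = fold (regs s rr) (regs s rm) (arr s tau) (regs s rq).
Proof. reflexivity. Qed.

Lemma ev_base2E s : ev s base2E = base2 (arr s 1) (arr s 2) (regs s rq).
Proof. reflexivity. Qed.

Lemma okE_bflyE tau s :
  0 <= tau < M -> 0 < regs s rr -> 0 < regs s rh -> okE s (bflyE tau).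
Proof. intros. simpl. repeat split; try lia; nia. Qed.

Lemma okE_unbflyE tau s :
  0 <= tau < M -> 0 < regs s rr -> 0 < regs s rh -> okE s (unbflyE tau).
Proof. intros. simpl. repeat split; try lia; nia. Qed.

Lemma okE_expandE tau s :
  0 <= tau < M -> 0 < regs s rr -> 0 < regs s rm -> okE s (expandE tau).
Proof. intros. simpl. repeat split; try lia; nia. Qed.

Lemma okE_foldE tau s :
  0 <= tau < M -> 0 < regs s rr -> 0 < regs s rm -> okE s (foldE tau).
Proof. intros. simpl. repeat split; try lia; nia. Qed.

Lemma okE_base2E s : okE s base2E.
Proof. simpl. repeat split; lia. Qed.

(** The amplitude is carried along because only values up to [V] may be stored. *)
Definition holds (s : state) (tau L : Z) (A : Z -> Z) (amp : Z) : Prop :=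
  forall i, 0 <= i < L -> arr s tau i = A i /\ Z.abs (A i) <= amp.

Lemma holds_frame xs ts s s' tau L A amp :
  holds s tau L A amp -> frame xs ts s s' -> 0 <= tau < M -> ~ In tau ts ->
  holds s' tau L A amp.
Proof. intros H [_ F] Ht Hn i Hi. rewrite F by auto. auto. Qed.

(** By [lin2] only the first [L0] entries are read, so agreement with [A] there suffices. The
    longest expression, [bflyE], costs 167; 170 bounds them all, and 210 adds the 40 per entry of
    [trm_pass]. *)
Lemma trm_pass_lin tau E s n L0 L G A amp (Q : state -> Prop) :
  small s -> 0 < tau < M -> regs s rL = L -> 0 <= L -> (esz E <= K)%nat ->
  ec E <= 170 ->
  (forall i s', 0 <= i < L -> frame [5%nat] [0] s s' -> regs s' rq = i ->
     okE s' E /\ ev s' E = G (arr s' tau) i) ->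
  (forall i, 0 <= i < L -> lin2 (fun A => G A i) L0) ->
  holds s tau L0 A amp -> 2 * amp <= V ->
  L * 210 + 20 <= n ->
  (forall s', small s' -> frame [5%nat] [0; tau] s s' ->
     holds s' tau L (G A) (2 * amp) -> Q s') ->
  trm (pass tau E) s n Q.
Proof.
  intros Hs Ht HL HL0 HE Hec Hev Hlin Hh Hamp Hn HQ.
  assert (Hg : forall i, 0 <= i < L -> Z.abs (G A i) <= 2 * amp).
  { intros i Hi. apply (lin2_bound _ L0 A amp (Hlin i Hi)). apply Hh. }
  apply trm_pass with (g := G A); auto; try lia.
  - intros i s' Hi Hf Hs' Hq. rewrite HL in Hi. destruct (Hev i s' Hi Hf Hq) as [Ho Ee].
    split; auto. split; [|specialize (Hg i Hi); lia].
    rewrite Ee. apply (lin2_ext _ L0 _ _ (Hlin i Hi)).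
    intros x Hx. rewrite (proj2 Hf) by (simpl; lia). apply Hh; auto.
  - rewrite HL. assert (L * (ec E + 40) <= L * 210) by (apply Z.mul_le_mono_nonneg_l; lia). lia.
  - intros s' Hs' Hf Ha. apply HQ; auto. intros i Hi. split; auto.
    rewrite Ha, HL. replace ((0 <=? i) && (i <? L))%bool with true; auto.
    symmetry. apply andb_true_intro. rewrite Z.leb_le, Z.ltb_lt. lia.
Qed.

Lemma pow2_pos a : 0 < 2 ^ Z.of_nat a.
Proof. apply Z.pow_pos_nonneg; lia. Qed.

Lemma pow2_S a : 2 ^ Z.of_nat (S a) = 2 * 2 ^ Z.of_nat a.
Proof. rewrite Nat2Z.inj_succ, Z.pow_succ_r by lia. reflexivity. Qed.

Lemma pow2_add a b : 2 ^ Z.of_nat (a + b) = 2 ^ Z.of_nat a * 2 ^ Z.of_nat b.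
Proof. rewrite Nat2Z.inj_add, Z.pow_add_r by lia. reflexivity. Qed.

Definition split_c : cmd :=
  rr ::= Cst 1 ;; rm ::= Var rn ;;
  While (Var rr <! Var rm) (rr ::= Var rr *! Cst 2 ;; rm ::= Var rm /! Cst 2).

(** Doubling [r] and halving [m] until [r >= m] ends at the balanced split; [a <= p <= a + 1] says
    that this takes exactly [p] rounds. The program thus finds the levels of a [chain] by itself. *)
Lemma trm_split s n v p a (Q : state -> Prop) :
  small s -> regs s rn = 2 ^ Z.of_nat v ->
  (v = p + a /\ a <= p /\ p <= S a)%nat ->
  Z.of_nat v * 20 + 20 <= n ->
  (forall s', small s' -> frame [9; 10]%nat [] s s' ->
     regs s' rr = 2 ^ Z.of_nat p -> regs s' rm = 2 ^ Z.of_nat a -> Q s') ->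
  trm split_c s n Q.
Proof.
  intros Hs Hn (Hv & Hap & Hpa) Hc HQ. unfold split_c.
  assert (HVn : 2 ^ Z.of_nat v <= V) by (destruct Hs as [Hr _]; specialize (Hr rn); lia).
  apply trm_assign_seq with (n2 := n - 2); auto; try (simpl; lia); [|ecs; lia].
  intros Hs1.
  apply trm_assign_seq with (n2 := n - 4); auto; try (simpl; lia).
  2: { ecs; lia. }
  intros Hs2.
  apply trm_while with (N := p) (nb := 8)
    (I := fun j s' => (j <= p)%nat /\ frame [9; 10]%nat [] s s' /\
            regs s' rr = 2 ^ Z.of_nat (p - j) /\ regs s' rm = 2 ^ Z.of_nat (a + j));
    try (simpl; lia); auto.
  - intros j s' Hs' (Hj & Hf & E1 & E2). simpl. rewrite E1, E2.
    replace (2 ^ Z.of_nat (p - S j) <? 2 ^ Z.of_nat (a + S j)) with true.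
    2: { symmetry. apply Z.ltb_lt. apply Z.pow_lt_mono_r; lia. }
    conjs; try lia.
    assert (E3 : regs s' rr * 2 = 2 ^ Z.of_nat (p - j)).
    { rewrite E1. replace (p - j)%nat with (S (p - S j)) by lia. rewrite pow2_S. lia. }
    assert (E4 : regs s' rm / 2 = 2 ^ Z.of_nat (a + j)).
    { rewrite E2. replace (a + S j)%nat with (S (a + j)) by lia. rewrite pow2_S.
      rewrite Z.mul_comm, Z.div_mul; lia. }
    assert (2 ^ Z.of_nat (p - j) <= V /\ 2 ^ Z.of_nat (a + j) <= V) as [B1 B2].
    { split; (eapply Z.le_trans; [apply Z.pow_le_mono_r|exact HVn]); lia. }
    pose proof (pow2_pos (p - j)). pose proof (pow2_pos (a + j)).
    apply trm_assign_seq with (n2 := 4); auto; try (simpl; lia); try (ecs; lia).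
    intros Hs3. apply trm_assign; auto; try (simpl; lia); try (ecs; lia).
    simpl. rewrite E3, E4. conjs; auto; try lia; frm.
  - intros s' Hs' (_ & Hf & E1 & E2). simpl.
    rewrite Nat.sub_0_r in E1. rewrite Nat.add_0_r in E2. rewrite E1, E2.
    replace (2 ^ Z.of_nat p <? 2 ^ Z.of_nat a) with false.
    2: { symmetry. apply Z.ltb_ge. apply Z.pow_le_mono_r; lia. }
    auto.
  - simpl. rewrite Nat.sub_diag. conjs; try lia; try frm; try (f_equal; lia).
    rewrite Hn. f_equal. lia.
  - ecs. lia.
Qed.

Lemma bflyE_size tau : (esz (bflyE tau) <= K)%nat /\ ec (bflyE tau) <= 170.
Proof. change (esz (bflyE tau)) with 83%nat. change (ec (bflyE tau)) with 167. lia. Qed.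

Lemma unbflyE_size tau : (esz (unbflyE tau) <= K)%nat /\ ec (unbflyE tau) <= 170.
Proof. change (esz (unbflyE tau)) with 63%nat. change (ec (unbflyE tau)) with 127. lia. Qed.

Lemma expandE_size tau : (esz (expandE tau) <= K)%nat /\ ec (expandE tau) <= 170.
Proof.
  assert ((esz (expandE tau) <= 170)%nat /\ (expr_cost (expandE tau) <= 170)%nat)
    by (split; apply Nat.leb_le; reflexivity).
  unfold ec. lia.
Qed.

Lemma foldE_size tau : (esz (foldE tau) <= K)%nat /\ ec (foldE tau) <= 170.
Proof.
  assert ((esz (foldE tau) <= 170)%nat /\ (expr_cost (foldE tau) <= 170)%nat)
    by (split; apply Nat.leb_le; reflexivity).
  unfold ec. lia.
Qed.

Lemma trm_bfly_pass tau s n r h nb L A amp (Q : state -> Prop) :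
  small s -> 0 < tau < M -> 0 < r -> 0 < h -> regs s rr = r -> regs s rh = h ->
  0 <= nb -> L = nb * (2 * h) * r -> regs s rL = L -> holds s tau L A amp ->
  2 * amp <= V -> L * 210 + 20 <= n ->
  (forall s', small s' -> frame [5]%nat [0; tau] s s' ->
     holds s' tau L (bfly r h A) (2 * amp) -> Q s') ->
  trm (pass tau (bflyE tau)) s n Q.
Proof.
  intros Hs Ht Hr Hhp Er Eh Hnb EL HL Hh HV' Hn HQ.
  destruct (bflyE_size tau) as [Z1 Z2].
  apply trm_pass_lin with (L0 := L) (L := L) (G := bfly r h) (A := A) (amp := amp);
    try assumption.
  - rewrite EL. nia.
  - intros i s' Hi Hf Hq.
    rewrite ev_bflyE, Hq, !(proj1 Hf), Er, Eh by fr_side. split; [|reflexivity].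
    apply okE_bflyE; rewrite ?(proj1 Hf) by fr_side; lia.
  - intros i Hi. rewrite EL in *. now apply bfly_lin2.
Qed.

Lemma trm_unbfly_pass tau s n r h nb L A amp (Q : state -> Prop) :
  small s -> 0 < tau < M -> 0 < r -> 0 < h -> regs s rr = r -> regs s rh = h ->
  0 <= nb -> L = nb * (2 * h) * r -> regs s rL = L -> holds s tau L A amp ->
  2 * amp <= V -> L * 210 + 20 <= n ->
  (forall s', small s' -> frame [5]%nat [0; tau] s s' ->
     holds s' tau L (unbfly r h A) (2 * amp) -> Q s') ->
  trm (pass tau (unbflyE tau)) s n Q.
Proof.
  intros Hs Ht Hr Hhp Er Eh Hnb EL HL Hh HV' Hn HQ.
  destruct (unbflyE_size tau) as [Z1 Z2].
  apply trm_pass_lin with (L0 := L) (L := L) (G := unbfly r h) (A := A) (amp := amp);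
    try assumption.
  - rewrite EL. nia.
  - intros i s' Hi Hf Hq.
    rewrite ev_unbflyE, Hq, !(proj1 Hf), Er, Eh by fr_side. split; [|reflexivity].
    apply okE_unbflyE; rewrite ?(proj1 Hf) by fr_side; lia.
  - intros i Hi. rewrite EL in *. now apply unbfly_lin2.
Qed.

Lemma trm_expand_pass tau s n r m nb L A amp (Q : state -> Prop) :
  small s -> 0 < tau < M -> 0 < r -> 0 < m -> regs s rr = r -> regs s rm = m ->
  0 <= nb -> L = nb * (2 * m) * r -> regs s rL = L ->
  holds s tau (nb * (r * m)) A amp ->
  2 * amp <= V -> L * 210 + 20 <= n ->
  (forall s', small s' -> frame [5]%nat [0; tau] s s' ->
     holds s' tau L (expand r m A) (2 * amp) -> Q s') ->
  trm (pass tau (expandE tau)) s n Q.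
Proof.
  intros Hs Ht Hr Hhp Er Eh Hnb EL HL Hh HV' Hn HQ.
  destruct (expandE_size tau) as [Z1 Z2].
  apply trm_pass_lin with (L0 := nb * (r * m)) (L := L) (G := expand r m) (A := A) (amp := amp);
    try assumption.
  - rewrite EL. nia.
  - intros i s' Hi Hf Hq.
    rewrite ev_expandE, Hq, !(proj1 Hf), Er, Eh by fr_side. split; [|reflexivity].
    apply okE_expandE; rewrite ?(proj1 Hf) by fr_side; lia.
  - intros i Hi. rewrite EL in *. now apply expand_lin2.
Qed.

Lemma trm_fold_pass tau s n r m nb L A amp (Q : state -> Prop) :
  small s -> 0 < tau < M -> 0 < r -> 0 < m -> regs s rr = r -> regs s rm = m ->
  0 <= nb -> L = nb * (r * m) -> regs s rL = L ->
  holds s tau (nb * (2 * m) * r) A amp ->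
  2 * amp <= V -> L * 210 + 20 <= n ->
  (forall s', small s' -> frame [5]%nat [0; tau] s s' ->
     holds s' tau L (fold r m A) (2 * amp) -> Q s') ->
  trm (pass tau (foldE tau)) s n Q.
Proof.
  intros Hs Ht Hr Hhp Er Eh Hnb EL HL Hh HV' Hn HQ.
  destruct (foldE_size tau) as [Z1 Z2].
  apply trm_pass_lin with (L0 := nb * (2 * m) * r) (L := L) (G := fold r m) (A := A) (amp := amp);
    try assumption.
  - rewrite EL. nia.
  - intros i s' Hi Hf Hq.
    rewrite ev_foldE, Hq, !(proj1 Hf), Er, Eh by fr_side. split; [|reflexivity].
    apply okE_foldE; rewrite ?(proj1 Hf) by fr_side; lia.
  - intros i Hi. rewrite EL in *. now apply fold_lin2.
Qed.

Definition bfly_loop (tau : Z) : cmd :=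
  While (Cst 0 <! Var rh) (pass tau (bflyE tau) ;; rh ::= Var rh /! Cst 2).

Lemma trm_bfly_step tau s n r h nb L A amp (Q : state -> Prop) :
  small s -> 0 < tau < M -> 0 < r -> 0 < h -> regs s rr = r -> regs s rh = h ->
  0 <= nb -> L = nb * (2 * h) * r -> regs s rL = L -> holds s tau L A amp ->
  2 * amp <= V ->
  (forall s', small s' -> frame [5; 11]%nat [0; tau] s s' -> regs s' rh = h / 2 ->
     holds s' tau L (bfly r h A) (2 * amp) -> trm (bfly_loop tau) s' n Q) ->
  trm (bfly_loop tau) s (L * 210 + 40 + n) Q.
Proof.
  intros Hs Ht Hr Hhp Er Eh Hnb EL HL Hh HV' HQ.
  apply trm_while_step with (n1 := L * 210 + 24) (n2 := n)
    (Q1 := fun s' => frame [5; 11]%nat [0; tau] s s' /\ regs s' rh = h / 2 /\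
             holds s' tau L (bfly r h A) (2 * amp)).
  - assumption.
  - esz_side.
  - esz_side.
  - simpl. rewrite Eh. replace (0 <? h) with true by (symmetry; now apply Z.ltb_lt). lia.
  - apply trm_bind with (n1 := L * 210 + 20)
    (n2 := 4); [|lia].
    apply trm_bfly_pass with (r := r) (h := h) (nb := nb) (L := L) (A := A) (amp := amp);
      try assumption; [lia|].
    intros s1 Hs1 Hf1 Hh1.
    assert (E1 : ev s1 (Var rh /! Cst 2) = h / 2)
      by (simpl; rewrite (proj1 Hf1), Eh by fr_side; reflexivity).
    assert (Z.abs h <= V) by (rewrite <- Eh; apply Hs).
    pose proof (Z.div_pos h 2 ltac:(lia) ltac:(lia)).
    pose proof (Z.div_le_upper_bound h 2 h ltac:(lia) ltac:(lia)).
    apply trm_assign.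
    + assumption.
    + simpl; lia.
    + esz_side.
    + rewrite E1. lia.
    + ec_side.
    + rewrite E1. conjs; [frm | apply set_reg_eq | exact Hh1].
  - intros s1 Hs1 (Hf1 & Eh1 & Hh1). now apply HQ.
  - ec_side.
Qed.

Lemma trm_bfly_loop tau a s n r nb L A amp (Q : state -> Prop) :
  small s -> 0 < tau < M -> 0 < r -> regs s rr = r ->
  regs s rh = 2 ^ Z.of_nat a -> 0 <= nb -> L = nb * (2 * 2 ^ Z.of_nat a) * r ->
  regs s rL = L -> holds s tau L A amp -> 0 <= amp ->
  amp * 2 ^ Z.of_nat (S a) <= V ->
  Z.of_nat (S a) * (L * 210 + 40) + 10 <= n ->
  (forall s', small s' -> frame [5; 11]%nat [0; tau] s s' ->
     holds s' tau L (bflys r a A) (amp * 2 ^ Z.of_nat (S a)) -> Q s') ->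
  trm (bfly_loop tau) s n Q.
Proof.
  revert s n nb A amp.
  induction a as [|a IH]; intros s n nb A amp Hs Ht Hr Er Eh Hnb EL HL Hh Hamp HV' Hn HQ.
  - replace n with (L * 210 + 40 + (n - (L * 210 + 40))) by lia.
    change (2 ^ Z.of_nat 0) with 1 in *. change (2 ^ Z.of_nat 1) with 2 in *.
    eapply trm_bfly_step with (r := r) (h := 1) (nb := nb) (A := A) (amp := amp);
      try eassumption; try lia.
    (* Integer division takes [h = 1] to 0, which ends the loop. *)
    intros s1 Hs1 Hf1 Eh1 Hh1. change (1 / 2) with 0 in Eh1.
    apply trm_while_exit; auto; try esz_side; try ec_side.
    + simpl. now rewrite Eh1.
    + apply HQ; auto. rewrite Z.mul_comm. exact Hh1.
  - pose proof (pow2_pos (S a)) as Hp.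
    replace n with (L * 210 + 40 + (n - (L * 210 + 40))) by lia.
    assert (Ep : 2 * amp * 2 ^ Z.of_nat (S a) = amp * 2 ^ Z.of_nat (S (S a)))
      by (rewrite (pow2_S (S a)); ring).
    eapply trm_bfly_step with (r := r) (h := 2 ^ Z.of_nat (S a)) (nb := nb) (A := A) (amp := amp);
      try eassumption.
    { apply Z.le_trans with (2 := HV'). rewrite <- Ep, <- (Z.mul_1_r (2 * amp)) at 1.
      apply Z.mul_le_mono_nonneg_l; lia. }
    intros s1 Hs1 Hf1 Eh1 Hh1.
    assert (Eh2 : 2 ^ Z.of_nat (S a) / 2 = 2 ^ Z.of_nat a).
    { rewrite pow2_S, Z.mul_comm, Z.div_mul; lia. }
    rewrite Eh2 in Eh1.
    apply IH with (nb := 2 * nb) (A := bfly r (2 ^ Z.of_nat (S a)) A) (amp := 2 * amp);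
      auto; try lia.
    + unframe. auto.
    + rewrite EL. rewrite pow2_S. ring.
    + unframe. auto.
    + intros s2 Hs2 Hf2 Hh2. apply HQ; auto.
      * frm.
      * rewrite <- Ep. exact Hh2.
Qed.

End Conv.

(** * Forward and inverse transforms *)

Section Conv.

Context {mc : Machine}.

Let HV : 2 <= V := V_ge.
Let HM : 8 <= M <= V := M_range.
Let HK0 : (300 <= K)%nat := K_ge.

Lemma small_reg s x : small s -> Z.abs (regs s x) <= V.
Proof. intros H. apply H. Qed.

(** The length [n] is pushed before it is replaced by [r]: the inverse transform undoes the levels
    in reverse order and recomputes each split from the stored length. *)
Definition fwd_body (tau : Z) : cmd :=
  Wr 3 (Var rl) (Var rn) ;; split_c ;; rL ::= Var rL *! Cst 2 ;;
  pass tau (expandE tau) ;; rh ::= Var rm ;; bfly_loop tau ;;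
  rn ::= Var rr ;; rl ::= Var rl +! Cst 1.

Lemma trm_fwd_body tau s n v p a nb L A amp d (Q : state -> Prop) :
  small s -> 0 < tau < M -> tau <> 3 ->
  (v = p + a /\ 1 <= a <= p /\ p <= S a)%nat ->
  regs s rn = 2 ^ Z.of_nat v -> regs s rL = L -> 0 <= nb ->
  L = nb * 2 ^ Z.of_nat v -> regs s rl = d -> 0 <= d -> d + 1 <= V -> 2 * L <= V ->
  holds s tau L A amp -> 0 <= amp -> amp * 2 ^ Z.of_nat (a + 2) <= V ->
  (Z.of_nat v + 3) * (2 * L * 210 + 100) <= n ->
  (forall s', small s' -> frame [5; 7; 8; 9; 10; 11; 12]%nat [0; 3; tau] s s' ->
     regs s' rn = 2 ^ Z.of_nat p -> regs s' rL = 2 * L -> regs s' rl = d + 1 ->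
     (forall i, arr s' 3 i = if i =? d then 2 ^ Z.of_nat v else arr s 3 i) ->
     holds s' tau (2 * L)
       (bflys (2 ^ Z.of_nat p) a (expand (2 ^ Z.of_nat p) (2 ^ Z.of_nat a) A))
       (amp * 2 ^ Z.of_nat (a + 2)) -> Q s') ->
  trm (fwd_body tau) s n Q.
Proof.
  intros Hs Ht Ht3 Hv En EL Hnb HL El Hd HdV HLV Hh Hamp HaV Hn HQ.
  pose proof (pow2_pos v) as Pv. pose proof (pow2_pos p) as Pp. pose proof (pow2_pos a) as Pa.
  assert (Epa : 2 ^ Z.of_nat v = 2 ^ Z.of_nat p * 2 ^ Z.of_nat a)
    by (rewrite <- pow2_add; f_equal; lia).
  assert (HL0 : 0 <= L) by (rewrite HL; nia).
  assert (Ea2 : amp * 2 ^ Z.of_nat (a + 2) = 2 * amp * 2 ^ Z.of_nat (S a)).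
  { replace (a + 2)%nat with (S (S a)) by lia. rewrite (pow2_S (S a)). ring. }
  assert (H2amp : 2 * amp <= V).
  { rewrite Ea2 in HaV. pose proof (pow2_pos (S a)).
    assert (2 * amp * 1 <= 2 * amp * 2 ^ Z.of_nat (S a))
      by (apply Z.mul_le_mono_nonneg_l; lia). lia. }
  assert (Hcost : 2 * L * 210 * (Z.of_nat a + 2) <= 2 * L * 210 * (Z.of_nat v + 3))
    by (apply Z.mul_le_mono_nonneg_l; lia).
  unfold fwd_body.
  apply trm_wr_seq with (n2 := n - 7); try assumption; try lia; try esz_side;
    try exact I; try ec_side.
  { apply small_reg; auto. }
  intros s1 Hs1 E1.
  assert (Hf1 : frame [] [3] s s1).
  { subst s1. apply frame_set_mem; [lia | simpl; auto]. }
  assert (A1 : forall i, arr s1 3 i = if i =? d then 2 ^ Z.of_nat v else arr s 3 i).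
  { intros i. subst s1. rewrite arr_set_mem by lia. simpl. now rewrite El, En. }
  clear E1.
  apply trm_bind with (n1 := Z.of_nat v * 20 + 20)
    (n2 := n - 27 - Z.of_nat v * 20); [|lia].
  apply trm_split with (v := v) (p := p) (a := a); auto; try lia.
  { unframe. auto. }
  intros s2 Hs2 Hf2 Er2 Em2.
  assert (EL2 : regs s2 rL = L).
  { unframe. auto. }
  apply trm_assign_seq with (n2 := n - 31 - Z.of_nat v * 20); try assumption;
    try exact I; try esz_side; try ec_side.
  intros Hs3. simpl ev in *. rewrite EL2 in *.
  set (s3 := set_reg s2 rL (L * 2)) in *.
  assert (Hf3 : frame [7]%nat [] s2 s3) by (apply frame_set_reg; simpl; auto).
  assert (EL3 : regs s3 rL = 2 * L) by (unfold s3; rewrite set_reg_eq; lia).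
  clearbody s3.
  apply trm_bind with (n1 := 2 * L * 210 + 20)
    (n2 := n - 51 - Z.of_nat v * 20 - 2 * L * 210); [|lia].
  apply trm_expand_pass with (r := 2 ^ Z.of_nat p) (m := 2 ^ Z.of_nat a) (nb := nb)
    (L := 2 * L) (A := A) (amp := amp); try assumption; try lia.
  { unframe. auto. }
  { unframe. auto. }
  { rewrite <- Epa, <- HL. intros i Hi.
    unframe. apply Hh; auto. }
  intros s4 Hs4 Hf4 Hh4.
  assert (Em4 : regs s4 rm = 2 ^ Z.of_nat a)
    by (unframe; auto).
  apply trm_assign_seq with (n2 := n - 53 - Z.of_nat v * 20 - 2 * L * 210); try assumption;
    try exact I; try esz_side; try ec_side.
  { apply small_reg; auto. }
  intros Hs5. simpl ev in *. rewrite Em4 in *.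
  set (s5 := set_reg s4 rh (2 ^ Z.of_nat a)) in *.
  assert (Hf5 : frame [11]%nat [] s4 s5) by (apply frame_set_reg; simpl; auto).
  assert (Eh5 : regs s5 rh = 2 ^ Z.of_nat a) by (unfold s5; now rewrite set_reg_eq).
  clearbody s5.
  apply trm_bind with (n1 := Z.of_nat (S a) * (2 * L * 210 + 40) + 10)
    (n2 := 6); [|lia].
  apply trm_bfly_loop with (a := a) (r := 2 ^ Z.of_nat p) (nb := nb) (L := 2 * L)
    (A := expand (2 ^ Z.of_nat p) (2 ^ Z.of_nat a) A) (amp := 2 * amp); try assumption; try lia.
  { unframe. auto. }
  { unframe. auto. }
  { eapply holds_frame; [exact Hh4 | exact Hf5 | lia | fr_side]. }
  intros s6 Hs6 Hf6 Hh6.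
  assert (Er6 : regs s6 rr = 2 ^ Z.of_nat p)
    by (unframe; auto).
  assert (El6 : regs s6 rl = d)
    by (unframe; auto).
  apply trm_assign_seq with (n2 := 4); try assumption;
    try exact I; try esz_side; try ec_side.
  { apply small_reg; auto. }
  intros Hs7. simpl ev in *. rewrite Er6 in *.
  apply trm_assign; try assumption; try esz_side; try ec_side.
  simpl ev. change (regs (set_reg s6 8 (2 ^ Z.of_nat p)) 12) with (regs s6 12).
  rewrite El6. apply HQ.
  - apply small_set_reg; auto. lia.
  - frm.
  - reflexivity.
  - simpl regs. rewrite (proj1 Hf6), (proj1 Hf5), (proj1 Hf4), EL3 by fr_side. auto.
  - reflexivity.
  - intros i. rewrite !arr_set_reg.
    unframe.
    apply A1.
  - rewrite Ea2. exact Hh6.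
Qed.

Fixpoint sizes (v : nat) (ls : list (nat * nat)) : list nat :=
  match ls with
  | [] => []
  | (p, _) :: ls' => v :: sizes p ls'
  end.

Definition fwd_loop (tau : Z) : cmd := While (Cst 2 <! Var rn) (fwd_body tau).

Lemma chain_ge1 v ls : chain v ls -> (1 <= v)%nat.
Proof. intros H. apply chain_length in H. lia. Qed.

Lemma pow_mono_le a b : (a <= b)%nat -> 2 ^ Z.of_nat a <= 2 ^ Z.of_nat b.
Proof. intros. apply Z.pow_le_mono_r; lia. Qed.

Lemma amp_le amp a b : 0 <= amp -> (a <= b)%nat ->
  amp * 2 ^ Z.of_nat b <= V -> amp * 2 ^ Z.of_nat a <= V.
Proof.
  intros H Hab Hb. eapply Z.le_trans; [|exact Hb].
  apply Z.mul_le_mono_nonneg_l; auto. now apply pow_mono_le.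
Qed.

(** [LB] bounds the array at the last and longest level and is charged at every level. The number
    [nb] of blocks is multiplied by [2 * 2^a] per level. *)
Lemma trm_fwd_loop tau ls v s n nb L A amp d LB (Q : state -> Prop) :
  small s -> 0 < tau < M -> tau <> 3 -> chain v ls ->
  regs s rn = 2 ^ Z.of_nat v -> regs s rL = L -> 0 <= nb ->
  L = nb * 2 ^ Z.of_nat v -> regs s rl = d -> 0 <= d ->
  d + Z.of_nat (length ls) <= V -> L * 2 ^ Z.of_nat (length ls) <= LB -> LB <= V ->
  holds s tau L A amp -> 0 <= amp -> amp * 2 ^ Z.of_nat (npass ls) <= V ->
  Z.of_nat (length ls) * ((Z.of_nat v + 3) * (LB * 210 + 100) + 10) + 10 <= n ->
  (forall s', small s' -> frame [5; 7; 8; 9; 10; 11; 12]%nat [0; 3; tau] s s' ->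
     regs s' rL = L * 2 ^ Z.of_nat (length ls) ->
     regs s' rl = d + Z.of_nat (length ls) ->
     (forall i, (i < length ls)%nat ->
        arr s' 3 (d + Z.of_nat i) = 2 ^ Z.of_nat (nth i (sizes v ls) 0%nat)) ->
     (forall i, i < d -> arr s' 3 i = arr s 3 i) ->
     holds s' tau (L * 2 ^ Z.of_nat (length ls)) (forward ls A)
       (amp * 2 ^ Z.of_nat (npass ls)) -> Q s') ->
  trm (fwd_loop tau) s n Q.
Proof.
  revert v s n nb L A amp d.
  induction ls as [|[p a] ls IH];
    intros v s n nb L A amp d Hs Ht Ht3 Hch En EL Hnb HL El Hd HdV HLB HLBV Hh Hamp HaV Hn HQ.
  - simpl in Hch. subst v. change (2 ^ Z.of_nat 1) with 2 in *.
    cbn [length] in *. change (Z.of_nat 0) with 0 in *. rewrite Z.mul_0_l in Hn.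
    apply trm_while_exit; try assumption; try esz_side; try ec_side.
    + simpl. now rewrite En.
    + change (npass []) with 0%nat in *. change (2 ^ 0) with 1 in *.
      change (2 ^ Z.of_nat 0) with 1 in *. rewrite !Z.mul_1_r in *.
      apply HQ; try assumption; try lia; auto. apply frame_refl.
  - destruct Hch as [Hv Hch]. cbn [length] in *. rewrite npass_cons in *.
    pose proof (chain_ge1 _ _ Hch) as Hp1.
    pose proof (pow2_pos v) as Pv.
    pose proof (pow2_pos (length ls)) as Pl.
    assert (HL0 : 0 <= L) by (rewrite HL; apply Z.mul_nonneg_nonneg; lia).
    rewrite pow2_S in *.
    assert (HL2 : 2 * L <= LB).
    { eapply Z.le_trans; [|exact HLB].
      replace (L * (2 * 2 ^ Z.of_nat (length ls))) with (2 * L * 2 ^ Z.of_nat (length ls)) by ring.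
      rewrite <- (Z.mul_1_r (2 * L)) at 1. apply Z.mul_le_mono_nonneg_l; lia. }
    assert (Hc : (Z.of_nat v + 3) * (2 * L * 210 + 100) <= (Z.of_nat v + 3) * (LB * 210 + 100))
      by (apply Z.mul_le_mono_nonneg_l; lia).
    set (bc := (Z.of_nat v + 3) * (LB * 210 + 100)) in *.
    apply trm_while_step with (n1 := bc) (n2 := n - bc - 10)
      (Q1 := fun s' => frame [5; 7; 8; 9; 10; 11; 12]%nat [0; 3; tau] s s' /\
        regs s' rn = 2 ^ Z.of_nat p /\ regs s' rL = 2 * L /\ regs s' rl = d + 1 /\
        (forall i, arr s' 3 i = if i =? d then 2 ^ Z.of_nat v else arr s 3 i) /\
        holds s' tau (2 * L)
          (bflys (2 ^ Z.of_nat p) a (expand (2 ^ Z.of_nat p) (2 ^ Z.of_nat a) A))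
          (amp * 2 ^ Z.of_nat (a + 2)));
      try assumption; try esz_side; try ec_side.
    + simpl. rewrite En. replace (2 <? 2 ^ Z.of_nat v) with true; [lia|].
      symmetry. apply Z.ltb_lt. change 2 with (2 ^ 1) at 1. apply Z.pow_lt_mono_r; lia.
    + apply trm_fwd_body with (v := v) (p := p) (a := a) (nb := nb) (L := L) (A := A)
        (amp := amp) (d := d); try assumption; try lia.
      * apply amp_le with (a + 2 + npass ls)%nat; auto. lia.
      * intros. conjs; auto.
    + intros s1 Hs1 (Hf1 & En1 & EL1 & El1 & A1 & Hh1).
      assert (Hamp1 : 0 <= amp * 2 ^ Z.of_nat (a + 2)) by (pose proof (pow2_pos (a + 2)); apply Z.mul_nonneg_nonneg; lia).
      assert (Ea : amp * 2 ^ Z.of_nat (a + 2) * 2 ^ Z.of_nat (npass ls)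
                   = amp * 2 ^ Z.of_nat (a + 2 + npass ls)).
      { rewrite (pow2_add (a + 2)). ring. }
      assert (EL' : 2 * L * 2 ^ Z.of_nat (length ls) = L * (2 * 2 ^ Z.of_nat (length ls))) by ring.
      apply IH with (v := p) (nb := nb * (2 * 2 ^ Z.of_nat a)) (L := 2 * L) (d := d + 1)
        (A := bflys (2 ^ Z.of_nat p) a (expand (2 ^ Z.of_nat p) (2 ^ Z.of_nat a) A))
        (amp := amp * 2 ^ Z.of_nat (a + 2)); try assumption; try lia.
      * rewrite HL. replace v with (p + a)%nat by lia. rewrite pow2_add. ring.
      * assert ((Z.of_nat p + 3) * (LB * 210 + 100) <= bc)
          by (apply Z.mul_le_mono_nonneg_r; lia).
        assert (Z.of_nat (length ls) * ((Z.of_nat p + 3) * (LB * 210 + 100) + 10)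
                <= Z.of_nat (length ls) * (bc + 10))
          by (apply Z.mul_le_mono_nonneg_l; lia).
        lia.
      * intros s2 Hs2 Hf2 EL2 El2 A2 B2 Hh2. apply HQ; auto.
        -- frm.
        -- rewrite EL2. auto.
        -- lia.
        -- intros i Hi. destruct i as [|i].
           ++ rewrite Z.add_0_r. rewrite B2 by lia. rewrite A1, Z.eqb_refl. reflexivity.
           ++ replace (d + Z.of_nat (S i)) with (d + 1 + Z.of_nat i) by lia.
              rewrite A2 by lia. reflexivity.
        -- intros i Hi. rewrite B2, A1 by lia.
           replace (i =? d) with false; auto. symmetry. apply Z.eqb_neq. lia.
        -- rewrite <- EL', <- Ea. exact Hh2.
Qed.

(** Register [rk] is doubled with every pass, so that over all levels it becomes [kappa], by which
    the last pass of the convolution divides. *)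
Definition unbfly_loop : cmd :=
  While (Var rh <! Var rm +! Cst 1)
    (pass 1 (unbflyE 1) ;; rh ::= Var rh *! Cst 2 ;; rk ::= Var rk *! Cst 2).

Lemma trm_unbfly_loop a s n r nb L C amp k0 (Q : state -> Prop) :
  small s -> 0 < r -> regs s rr = r -> regs s rm = 2 ^ Z.of_nat a ->
  regs s rh = 1 -> 0 <= nb -> L = nb * (2 * 2 ^ Z.of_nat a) * r -> regs s rL = L ->
  holds s 1 L C amp -> 0 <= amp -> amp * 2 ^ Z.of_nat (S a) <= V ->
  regs s rk = k0 -> 0 <= k0 -> k0 * 2 ^ Z.of_nat (S a) <= V ->
  2 * 2 ^ Z.of_nat a <= V ->
  Z.of_nat (S a) * (L * 210 + 50) + 10 <= n ->
  (forall s', small s' -> frame [5; 11; 13]%nat [0; 1] s s' ->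
     regs s' rk = k0 * 2 ^ Z.of_nat (S a) ->
     holds s' 1 L (unbflys r a C) (amp * 2 ^ Z.of_nat (S a)) -> Q s') ->
  trm unbfly_loop s n Q.
Proof.
  intros Hs Hr Er Em Eh Hnb EL HL Hh Hamp HaV Ek Hk0 HkV HmV Hn HQ.
  (* [unbflys r i] stands for [i + 1] passes, so the array after [i] passes needs this shift. *)
  pose (f := fun i => match i with O => C | S i' => unbflys r i' C end).
  pose proof (pow2_pos a) as Pa.
  assert (HL0 : 0 <= L) by (rewrite EL; repeat apply Z.mul_nonneg_nonneg; lia).
  apply trm_while with (N := S a) (nb := L * 210 + 30)
    (I := fun j s' => (j <= S a)%nat /\ frame [5; 11; 13]%nat [0; 1] s s' /\
       regs s' rh = 2 ^ Z.of_nat (S a - j) /\ regs s' rk = k0 * 2 ^ Z.of_nat (S a - j) /\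
       holds s' 1 L (f (S a - j)%nat) (amp * 2 ^ Z.of_nat (S a - j)));
    try assumption; try esz_side; try ec_side.
  - intros j s1 Hs1 (Hj & Hf1 & Eh1 & Ek1 & Hh1).
    replace (S a - S j)%nat with (a - j)%nat in * by lia.
    replace (S a - j)%nat with (S (a - j)) by lia.
    assert (Em1 : regs s1 rm = 2 ^ Z.of_nat a) by (unframe; auto).
    set (i := (a - j)%nat) in *. assert (Hi : (i <= a)%nat) by lia.
    pose proof (pow2_pos i) as Pi. pose proof (pow_mono_le i a Hi) as Pia.
    pose proof (pow_mono_le (S i) (S a) ltac:(lia)) as Psi.
    assert (Hk2 : k0 * 2 ^ Z.of_nat (S i) <= V) by (apply amp_le with (S a); auto; lia).
    assert (Ha2 : amp * 2 ^ Z.of_nat (S i) <= V) by (apply amp_le with (S a); auto; lia).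
    rewrite pow2_S in *.
    assert (0 <= amp * 2 ^ Z.of_nat i) by (apply Z.mul_nonneg_nonneg; lia).
    assert (0 <= k0 * 2 ^ Z.of_nat i) by (apply Z.mul_nonneg_nonneg; lia).
    split; [simpl; lia|]. split.
    { simpl. rewrite Eh1, Em1.
      replace (2 ^ Z.of_nat i <? 2 ^ Z.of_nat a + 1) with true; [lia|].
      symmetry. apply Z.ltb_lt. lia. }
    apply trm_bind with (n1 := L * 210 + 20)
    (n2 := 10); [|lia].
    apply trm_unbfly_pass with (r := r) (h := 2 ^ Z.of_nat i)
      (nb := nb * 2 ^ Z.of_nat (a - i)) (L := L) (A := f i) (amp := amp * 2 ^ Z.of_nat i);
      try assumption; try lia.
    + unframe. auto.
    + rewrite EL. replace a with (a - i + i)%nat at 1 by lia. rewrite pow2_add. ring.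
    + unframe. auto.
    + intros s2 Hs2 Hf2 Hh2.
      assert (Eh2 : regs s2 rh = 2 ^ Z.of_nat i) by (unframe; auto).
      assert (Ek2 : regs s2 rk = k0 * 2 ^ Z.of_nat i) by (unframe; auto).
      apply trm_assign_seq with (n2 := 4); try assumption; try esz_side; try ec_side.
      intros Hs3. apply trm_assign; try assumption; try esz_side; try ec_side.
      simpl ev. rewrite Eh2. simpl regs. rewrite Ek2. conjs.
      * lia.
      * frm.
      * simpl regs. lia.
      * simpl regs. lia.
      * intros x Hx. rewrite !arr_set_reg.
        replace (amp * (2 * 2 ^ Z.of_nat i)) with (2 * (amp * 2 ^ Z.of_nat i)) by ring.
        specialize (Hh2 x Hx). destruct i; exact Hh2.
  - intros s1 Hs1 (_ & Hf1 & Eh1 & Ek1 & Hh1). rewrite Nat.sub_0_r in *.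
    assert (Em1 : regs s1 rm = 2 ^ Z.of_nat a) by (unframe; auto).
    split; [simpl; lia|]. split.
    + simpl. rewrite Eh1, Em1, pow2_S.
      replace (2 * 2 ^ Z.of_nat a <? 2 ^ Z.of_nat a + 1) with false; auto.
      symmetry. apply Z.ltb_ge. lia.
    + apply HQ; auto.
  - rewrite Nat.sub_diag. change (2 ^ Z.of_nat 0) with 1. rewrite !Z.mul_1_r.
    conjs; auto. apply frame_refl.
Qed.

Definition inv_body : cmd :=
  rl ::= Var rl -! Cst 1 ;; rn ::= Rd 3 (Var rl) ;; split_c ;; rh ::= Cst 1 ;;
  unbfly_loop ;; rL ::= Var rL /! Cst 2 ;; pass 1 (foldE 1).

Lemma trm_inv_body s n v p a nb L C amp d k0 (Q : state -> Prop) :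
  small s -> (v = p + a /\ 1 <= a <= p /\ p <= S a)%nat ->
  regs s rl = d + 1 -> 0 <= d -> arr s 3 d = 2 ^ Z.of_nat v ->
  0 <= nb -> L = nb * 2 ^ Z.of_nat v -> regs s rL = 2 * L ->
  holds s 1 (2 * L) C amp -> 0 <= amp -> amp * 2 ^ Z.of_nat (a + 2) <= V ->
  regs s rk = k0 -> 0 <= k0 -> k0 * 2 ^ Z.of_nat (S a) <= V ->
  (Z.of_nat v + 3) * (2 * L * 210 + 100) <= n ->
  (forall s', small s' -> frame [5; 7; 8; 9; 10; 11; 12; 13]%nat [0; 1] s s' ->
     regs s' rl = d -> regs s' rL = L -> regs s' rk = k0 * 2 ^ Z.of_nat (S a) ->
     holds s' 1 L (fold (2 ^ Z.of_nat p) (2 ^ Z.of_nat a) (unbflys (2 ^ Z.of_nat p) a C))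
       (amp * 2 ^ Z.of_nat (a + 2)) -> Q s') ->
  trm inv_body s n Q.
Proof.
  intros Hs Hv El Hd A0 Hnb HL EL Hh Hamp HaV Ek Hk0 HkV Hn HQ.
  pose proof (pow2_pos v) as Pv. pose proof (pow2_pos p) as Pp. pose proof (pow2_pos a) as Pa.
  assert (HvV : 2 ^ Z.of_nat v <= V).
  { pose proof (proj2 Hs (d * M + 3)) as B. unfold arr in A0. rewrite A0 in B. lia. }
  assert (HaVV : 2 * 2 ^ Z.of_nat a <= V).
  { rewrite <- pow2_S. eapply Z.le_trans; [apply pow_mono_le|exact HvV]. lia. }
  assert (Epa : 2 ^ Z.of_nat v = 2 ^ Z.of_nat p * 2 ^ Z.of_nat a)
    by (rewrite <- pow2_add; f_equal; lia).
  assert (HL0 : 0 <= L) by (rewrite HL; apply Z.mul_nonneg_nonneg; lia).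
  assert (Ea2 : amp * 2 ^ Z.of_nat (a + 2) = 2 * (amp * 2 ^ Z.of_nat (S a))).
  { replace (a + 2)%nat with (S (S a)) by lia. rewrite (pow2_S (S a)). ring. }
  assert (HaV' : amp * 2 ^ Z.of_nat (S a) <= V) by (apply amp_le with (a + 2)%nat; auto; lia).
  assert (Hcost : 2 * L * 210 * (Z.of_nat a + 2) <= 2 * L * 210 * (Z.of_nat v + 3))
    by (apply Z.mul_le_mono_nonneg_l; lia).
  assert (HdV : d + 1 <= V) by (pose proof (small_reg s rl Hs); lia).
  unfold inv_body.
  apply trm_assign_seq with (n2 := n - 4); try assumption; try esz_side; try ec_side.
  intros Hs1. simpl ev in *. rewrite El in *.
  replace (d + 1 - 1) with d in * by lia.
  assert (Hf1 : frame [12]%nat [] s (set_reg s rl d)) by (apply frame_set_reg; simpl; auto).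
  assert (El1 : regs (set_reg s rl d) rl = d) by apply set_reg_eq.
  set (s1 := set_reg s rl d) in *. clearbody s1.
  assert (E1 : ev s1 (Rd 3 (Var rl)) = 2 ^ Z.of_nat v).
  { change (arr s1 3 (regs s1 rl) = 2 ^ Z.of_nat v).
    rewrite El1, (proj2 Hf1) by fr_side. auto. }
  apply trm_assign_seq with (n2 := n - 11); try assumption; try esz_side.
  { rewrite E1. lia. }
  2: { unfold Rd. ec_side. }
  intros Hs2. rewrite E1 in *.
  assert (Hf2 : frame [8]%nat [] s1 (set_reg s1 rn (2 ^ Z.of_nat v)))
    by (apply frame_set_reg; simpl; auto).
  assert (En2 : regs (set_reg s1 rn (2 ^ Z.of_nat v)) rn = 2 ^ Z.of_nat v) by apply set_reg_eq.
  set (s2 := set_reg s1 rn (2 ^ Z.of_nat v)) in *. clearbody s2.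
  apply trm_bind with (n1 := Z.of_nat v * 20 + 20)
    (n2 := n - 31 - Z.of_nat v * 20); [|lia].
  apply trm_split with (v := v) (p := p) (a := a); auto; try lia.
  intros s3 Hs3 Hf3 Er3 Em3.
  apply trm_assign_seq with (n2 := n - 33 - Z.of_nat v * 20); try assumption;
    try esz_side; try ec_side.
  intros Hs4. simpl ev in *.
  assert (Hf4 : frame [11]%nat [] s3 (set_reg s3 rh 1)) by (apply frame_set_reg; simpl; auto).
  assert (Eh4 : regs (set_reg s3 rh 1) rh = 1) by apply set_reg_eq.
  set (s4 := set_reg s3 rh 1) in *. clearbody s4.
  assert (EL4 : regs s4 rL = 2 * L)
    by (unframe; auto).
  apply trm_bind with (n1 := Z.of_nat (S a) * (2 * L * 210 + 50) + 10)
    (n2 := L * 210 + 24); [|lia].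
  apply trm_unbfly_loop with (a := a) (r := 2 ^ Z.of_nat p) (nb := nb) (L := 2 * L)
    (C := C) (amp := amp) (k0 := k0); try assumption; try lia.
  { unframe. auto. }
  { unframe. auto. }
  { intros i Hi. unframe.
    apply Hh; auto. }
  { unframe; auto. }
  intros s5 Hs5 Hf5 Ek5 Hh5.
  assert (E5 : ev s5 (Var rL /! Cst 2) = L).
  { simpl. rewrite (proj1 Hf5), EL4 by fr_side. rewrite Z.mul_comm, Z.div_mul; lia. }
  apply trm_assign_seq with (n2 := L * 210 + 20); try assumption; try esz_side; try ec_side.
  { rewrite E5. pose proof (small_reg s rL Hs). lia. }
  rewrite E5. intros Hs6.
  assert (Hf6 : frame [7]%nat [] s5 (set_reg s5 rL L)) by (apply frame_set_reg; simpl; auto).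
  assert (EL6 : regs (set_reg s5 rL L) rL = L) by apply set_reg_eq.
  set (s6 := set_reg s5 rL L) in *. clearbody s6.
  apply trm_fold_pass with (r := 2 ^ Z.of_nat p) (m := 2 ^ Z.of_nat a) (nb := nb) (L := L)
    (A := unbflys (2 ^ Z.of_nat p) a C) (amp := amp * 2 ^ Z.of_nat (S a));
    try assumption; try lia.
  { unframe. auto. }
  { unframe. auto. }
  { intros i Hi. unframe. apply Hh5. rewrite HL, Epa. lia. }
  intros s7 Hs7 Hf7 Hh7. apply HQ; auto.
  - frm.
  - unframe.
    auto.
  - unframe. auto.
  - unframe. auto.
  - rewrite Ea2. exact Hh7.
Qed.

Definition inv_loop : cmd := While (Cst 0 <! Var rl) inv_body.

(** The innermost level is on top of the stack and is undone first, whereas the head of [ls] is the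
    outermost. Hence the continuation form: once the levels of [ls] are undone, the rest of the same
    loop costs [n2]. The induction undoes the tail and then makes one more round. *)
Lemma trm_inv_loop ls v s n n2 nb L C amp d k0 LB (Q : state -> Prop) :
  small s -> chain v ls ->
  (forall i, (i < length ls)%nat ->
     arr s 3 (d + Z.of_nat i) = 2 ^ Z.of_nat (nth i (sizes v ls) 0%nat)) ->
  regs s rl = d + Z.of_nat (length ls) -> 0 <= d ->
  0 <= nb -> L = nb * 2 ^ Z.of_nat v ->
  regs s rL = L * 2 ^ Z.of_nat (length ls) -> L * 2 ^ Z.of_nat (length ls) <= LB ->
  holds s 1 (L * 2 ^ Z.of_nat (length ls)) C amp -> 0 <= amp ->
  amp * 2 ^ Z.of_nat (npass ls) <= V ->
  regs s rk = k0 -> 0 <= k0 -> k0 * kappa ls <= V ->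
  (forall s', small s' -> frame [5; 7; 8; 9; 10; 11; 12; 13]%nat [0; 1] s s' ->
     regs s' rl = d -> regs s' rL = L -> regs s' rk = k0 * kappa ls ->
     holds s' 1 L (backward ls C) (amp * 2 ^ Z.of_nat (npass ls)) ->
     trm inv_loop s' n2 Q) ->
  n2 + Z.of_nat (length ls) * ((Z.of_nat v + 3) * (LB * 210 + 100) + 10) <= n ->
  trm inv_loop s n Q.
Proof.
  revert v s n n2 nb L d.
  induction ls as [|[p a] ls IH];
    intros v s n n2 nb L d Hs Hch A0 El Hd Hnb HL EL HLB Hh Hamp HaV Ek Hk0 HkV HQ Hn.
  - simpl length in *. change (2 ^ Z.of_nat 0) with 1 in *. change (npass []) with 0%nat in *.
    change (2 ^ Z.of_nat 0) with 1 in *. change (kappa []) with 1 in *.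
    rewrite !Z.mul_1_r in *. simpl in El. rewrite Z.add_0_r in El.
    eapply trm_weaken; [apply HQ; auto; apply frame_refl | lia | auto].
  - destruct Hch as [Hv Hch]. cbn [length] in *. rewrite npass_cons in *.
    pose proof (chain_ge1 _ _ Hch) as Hp1.
    pose proof (pow2_pos v) as Pv. pose proof (pow2_pos a) as Pa.
    pose proof (pow2_pos (length ls)) as Pl. pose proof (kappa_pos ls) as Pk.
    assert (HL0 : 0 <= L) by (rewrite HL; apply Z.mul_nonneg_nonneg; lia).
    rewrite pow2_S in *.
    change (kappa ((p, a) :: ls)) with (2 ^ Z.of_nat (S a) * kappa ls) in *.
    assert (EL' : 2 * L * 2 ^ Z.of_nat (length ls) = L * (2 * 2 ^ Z.of_nat (length ls))) by ring.
    assert (HL2 : 2 * L <= LB).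
    { eapply Z.le_trans; [|exact HLB]. rewrite <- EL'.
      rewrite <- (Z.mul_1_r (2 * L)) at 1. apply Z.mul_le_mono_nonneg_l; lia. }
    assert (Hc : (Z.of_nat v + 3) * (2 * L * 210 + 100) <= (Z.of_nat v + 3) * (LB * 210 + 100))
      by (apply Z.mul_le_mono_nonneg_l; lia).
    set (bc := (Z.of_nat v + 3) * (LB * 210 + 100)) in *.
    assert (Ea : amp * 2 ^ Z.of_nat (npass ls) * 2 ^ Z.of_nat (a + 2)
                 = amp * 2 ^ Z.of_nat (a + 2 + npass ls)).
    { rewrite (pow2_add (a + 2)). ring. }
    assert (HaV1 : amp * 2 ^ Z.of_nat (npass ls) <= V)
      by (apply amp_le with (a + 2 + npass ls)%nat; auto; lia).
    pose proof (pow2_pos (npass ls)) as Pn.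
    assert (Hamp1 : 0 <= amp * 2 ^ Z.of_nat (npass ls)) by (apply Z.mul_nonneg_nonneg; lia).
    assert (Ek' : k0 * kappa ls * 2 ^ Z.of_nat (S a) = k0 * (2 ^ Z.of_nat (S a) * kappa ls)) by ring.
    assert (HkV1 : k0 * kappa ls <= V).
    { eapply Z.le_trans; [|exact HkV]. rewrite <- Ek'.
      rewrite <- (Z.mul_1_r (k0 * kappa ls)) at 1.
      pose proof (pow2_pos (S a)).
      apply Z.mul_le_mono_nonneg_l; [apply Z.mul_nonneg_nonneg|]; lia. }
    assert (Hk1 : 0 <= k0 * kappa ls) by (apply Z.mul_nonneg_nonneg; lia).
    apply IH with (v := p) (nb := nb * (2 * 2 ^ Z.of_nat a)) (L := 2 * L) (d := d + 1)
      (n2 := n2 + bc + 10); try assumption; try lia.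
    + intros i Hi. replace (d + 1 + Z.of_nat i) with (d + Z.of_nat (S i)) by lia.
      rewrite A0 by lia. reflexivity.
    + rewrite HL. replace v with (p + a)%nat by lia. rewrite pow2_add. ring.
    + rewrite EL'. exact Hh.
    + intros s1 Hs1 Hf1 El1 EL1 Ek1 Hh1.
      apply trm_while_step with (n1 := bc) (n2 := n2)
        (Q1 := fun s' => frame [5; 7; 8; 9; 10; 11; 12; 13]%nat [0; 1] s s' /\
          regs s' rl = d /\ regs s' rL = L /\
          regs s' rk = k0 * (2 ^ Z.of_nat (S a) * kappa ls) /\
          holds s' 1 L (backward ((p, a) :: ls) C) (amp * 2 ^ Z.of_nat (a + 2 + npass ls)));
        try assumption; try esz_side; try ec_side.
      * simpl. rewrite El1. replace (0 <? d + 1) with true; [lia|].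
        symmetry. apply Z.ltb_lt. lia.
      * apply trm_inv_body with (v := v) (p := p) (a := a) (nb := nb) (L := L)
          (C := backward ls C) (amp := amp * 2 ^ Z.of_nat (npass ls)) (d := d)
          (k0 := k0 * kappa ls); try assumption; try lia.
        -- unframe. specialize (A0 0%nat ltac:(lia)).
           rewrite Z.add_0_r in A0. exact A0.
        -- intros s2 Hs2 Hf2 El2 EL2 Ek2 Hh2. conjs; auto.
           ++ frm.
           ++ rewrite Ek2. auto.
           ++ rewrite <- Ea. exact Hh2.
      * intros s2 Hs2 (Hf2 & El2 & EL2 & Ek2 & Hh2). apply HQ; auto.
    + assert ((Z.of_nat p + 3) * (LB * 210 + 100) <= bc)
        by (apply Z.mul_le_mono_nonneg_r; lia).
      assert (Z.of_nat (length ls) * ((Z.of_nat p + 3) * (LB * 210 + 100) + 10)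
              <= Z.of_nat (length ls) * (bc + 10))
        by (apply Z.mul_le_mono_nonneg_l; lia).
      lia.
Qed.

End Conv.

Notation pol := Nussbaumer.pol.
Notation cf := Nussbaumer.cf.
Notation pmul := Nussbaumer.pmul.

Lemma pow2_cover (R : Z) : 0 <= R ->
  exists u : nat, (1 <= u)%nat /\ 2 * R + 2 <= 2 ^ Z.of_nat u <= 4 * R + 4 /\
    forall i, (i < u)%nat -> 2 ^ Z.of_nat i < 2 * R + 2.
Proof.
  intros HR. destruct (Z.log2_up_spec (2 * R + 2) ltac:(lia)) as [H1 H2].
  pose proof (Z.log2_up_pos (2 * R + 2) ltac:(lia)) as H3.
  set (l := Z.log2_up (2 * R + 2)) in *.
  exists (Z.to_nat l). rewrite Z2Nat.id by lia.
  assert (E : 2 ^ l = 2 * 2 ^ Z.pred l).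
  { rewrite <- Z.pow_succ_r by lia. f_equal. lia. }
  split; [lia|]. split; [lia|].
  intros i Hi. eapply Z.le_lt_trans; [|exact H1]. apply Z.pow_le_mono_r; lia.
Qed.

(** * The complete convolution *)

Section Conv.

Context {mc : Machine}.

Let HV : 2 <= V := V_ge.
Let HM : 8 <= M <= V := M_range.
Let HK0 : (300 <= K)%nat := K_ge.

Definition fwd_c (tau : Z) : cmd :=
  rn ::= Var rN ;; rL ::= Var rN ;; rl ::= Cst 0 ;; fwd_loop tau.

Lemma trm_fwd_c tau ls v s n A amp LB (Q : state -> Prop) :
  small s -> 0 < tau < M -> tau <> 3 -> chain v ls ->
  regs s rN = 2 ^ Z.of_nat v ->
  Z.of_nat (length ls) <= V ->
  2 ^ Z.of_nat v * 2 ^ Z.of_nat (length ls) <= LB -> LB <= V ->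
  holds s tau (2 ^ Z.of_nat v) A amp -> 0 <= amp -> amp * 2 ^ Z.of_nat (npass ls) <= V ->
  Z.of_nat (length ls) * ((Z.of_nat v + 3) * (LB * 210 + 100) + 10) + 20 <= n ->
  (forall s', small s' -> frame [5; 7; 8; 9; 10; 11; 12]%nat [0; 3; tau] s s' ->
     regs s' rL = 2 ^ Z.of_nat v * 2 ^ Z.of_nat (length ls) ->
     regs s' rl = Z.of_nat (length ls) ->
     (forall i, (i < length ls)%nat ->
        arr s' 3 (Z.of_nat i) = 2 ^ Z.of_nat (nth i (sizes v ls) 0%nat)) ->
     holds s' tau (2 ^ Z.of_nat v * 2 ^ Z.of_nat (length ls)) (forward ls A)
       (amp * 2 ^ Z.of_nat (npass ls)) -> Q s') ->
  trm (fwd_c tau) s n Q.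
Proof.
  intros Hs Ht Ht3 Hch EN Hl HLB HLBV Hh Hamp HaV Hn HQ.
  assert (HNV : 2 ^ Z.of_nat v <= V) by (pose proof (small_reg s rN Hs); lia).
  pose proof (pow2_pos v) as Pv.
  unfold fwd_c.
  apply trm_assign_seq with (n2 := n - 2);
    [assumption | exact I | esz_side | apply small_reg; assumption | | ec_side].
  intros Hs1. simpl ev in *. rewrite EN in *.
  apply trm_assign_seq with (n2 := n - 4);
    [assumption | exact I | esz_side | apply small_reg; assumption | | ec_side].
  intros Hs2. change (ev (set_reg s rn (2 ^ Z.of_nat v)) (Var rN)) with (regs s rN) in *.
  rewrite EN in *.
  apply trm_assign_seq with (n2 := n - 6);
    [assumption | simpl; lia | esz_side | simpl; lia | | ec_side].
  intros Hs3. simpl ev in *.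
  match type of Hs3 with small ?x =>
    assert (Hf3 : frame [7; 8; 12]%nat [] s x) by frm;
    assert (E1 : regs x rn = 2 ^ Z.of_nat v) by reflexivity;
    assert (E2 : regs x rL = 2 ^ Z.of_nat v) by reflexivity;
    assert (E3 : regs x rl = 0) by reflexivity;
    set (s3 := x) in *; clearbody s3 end.
  apply trm_fwd_loop with (ls := ls) (v := v) (nb := 1) (L := 2 ^ Z.of_nat v) (A := A)
    (amp := amp) (d := 0) (LB := LB); try assumption; try lia.
  { intros i Hi. unframe. apply Hh; auto. }
  intros s4 Hs4 Hf4 EL4 El4 A4 _ Hh4. apply HQ; auto. frm.
Qed.

(** Multiplying by the comparison truncates after index [R] and pads with zeros in one
    expression. *)
Definition load (t : Z) : expr := (Var rq <! Var rR +! Cst 1) *! Rd t (Var rq).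

Definition cut (R : Z) (F : Z -> Z) (z : Z) : Z := if z <? R + 1 then F z else 0.

Lemma trm_load tau t s n R N (F : Z -> Z) V0 (Q : state -> Prop) :
  small s -> 0 < tau < M -> 7 <= t < M -> t <> tau -> 0 <= N ->
  regs s rL = N -> regs s rR = R -> 0 <= R -> 0 <= V0 <= V ->
  (forall z, 0 <= z <= R -> arr s t z = F z /\ Z.abs (F z) <= V0) ->
  N * 210 + 20 <= n ->
  (forall s', small s' -> frame [5]%nat [0; tau] s s' ->
     holds s' tau N (cut R F) V0 -> Q s') ->
  trm (pass tau (load t)) s n Q.
Proof.
  intros Hs Ht Ht7 Htt HN EL ER HR HV0 HF Hn HQ.
  assert (Hb : forall i, 0 <= i < N -> Z.abs (cut R F i) <= V0).
  { intros i Hi. unfold cut. destruct (Z.ltb_spec i (R + 1)); [apply HF|]; lia. }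
  assert (Hec : ec (load t) = 12) by reflexivity.
  apply trm_pass with (g := cut R F); try assumption; try lia.
  - esz_side.
  - intros i s' Hi Hf Hs' Hq. rewrite EL in Hi. split; [simpl; repeat split; lia|].
    split; [|specialize (Hb i Hi); lia].
    change (ev s' (load t)) with
      ((if regs s' rq <? regs s' rR + 1 then 1 else 0) * arr s' t (regs s' rq)).
    rewrite Hq, (proj1 Hf rR), ER, (proj2 Hf) by fr_side. unfold cut.
    destruct (Z.ltb_spec i (R + 1)); [|lia].
    destruct (HF i ltac:(lia)) as [-> _]. lia.
  - intros s' Hs' Hf Ha. apply HQ; auto. intros i Hi. split; [|auto].
    rewrite Ha, EL. replace ((0 <=? i) && (i <? N))%bool with true; auto.
    symmetry. apply andb_true_intro. rewrite Z.leb_le, Z.ltb_lt. lia.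
Qed.

Lemma trm_base2 s n nb A B amp (Q : state -> Prop) :
  small s -> 0 <= nb -> regs s rL = 2 * nb ->
  holds s 1 (2 * nb) A amp -> holds s 2 (2 * nb) B amp -> 2 * (amp * amp) <= V ->
  2 * nb * 210 + 20 <= n ->
  (forall s', small s' -> frame [5]%nat [0; 1] s s' ->
     holds s' 1 (2 * nb) (base2 A B) (2 * (amp * amp)) -> Q s') ->
  trm (pass 1 base2E) s n Q.
Proof.
  intros Hs HN EL HA HB HaV Hn HQ.
  assert (Hb : forall F G i, 0 <= i < 2 * nb ->
    (forall i, 0 <= i < 2 * nb -> F i = A i) -> (forall i, 0 <= i < 2 * nb -> G i = B i) ->
    base2 F G i = base2 A B i /\ Z.abs (base2 A B i) <= 2 * (amp * amp)).
  { intros F G i Hi HF HG. apply base2_reads with nb; auto; intros; [apply HA | apply HB]; auto. }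
  assert (Hec : ec base2E = 55) by reflexivity.
  apply trm_pass with (g := base2 A B); try assumption; try lia.
  - assert ((esz base2E <= 100)%nat) by (apply Nat.leb_le; reflexivity). lia.
  - intros i s' Hi Hf Hs' Hq. rewrite EL in Hi. split; [apply okE_base2E|].
    rewrite ev_base2E, Hq.
    destruct (Hb (arr s' 1) (arr s' 2) i Hi) as [E1 E2].
    + intros x Hx. unframe. apply HA; auto.
    + intros x Hx. unframe. apply HB; auto.
    + split; auto. lia.
  - intros s' Hs' Hf Ha. apply HQ; auto. intros i Hi. split.
    + rewrite Ha, EL. replace ((0 <=? i) && (i <? 2 * nb))%bool with true; auto.
      symmetry. apply andb_true_intro. rewrite Z.leb_le, Z.ltb_lt. lia.
    + apply (Hb A B i); auto.
Qed.

Definition size_c : cmd :=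
  rN ::= Cst 2 ;;
  While (Var rN <! Var rR *! Cst 2 +! Cst 2) (rN ::= Var rN *! Cst 2).

Lemma trm_size s n R u (Q : state -> Prop) :
  small s -> regs s rR = R -> 0 <= R -> (1 <= u)%nat ->
  2 * R + 2 <= 2 ^ Z.of_nat u -> 2 ^ Z.of_nat u <= V ->
  (forall i, (i < u)%nat -> 2 ^ Z.of_nat i < 2 * R + 2) ->
  Z.of_nat u * 20 + 20 <= n ->
  (forall s', small s' -> frame [6]%nat [] s s' -> regs s' rN = 2 ^ Z.of_nat u -> Q s') ->
  trm size_c s n Q.
Proof.
  intros Hs ER HR Hu HN HNV Hlt Hn HQ. unfold size_c.
  apply trm_assign_seq with (n2 := n - 2);
    [assumption | simpl; lia | esz_side | simpl; lia | | ec_side].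
  intros Hs1. simpl ev in *.
  apply trm_while with (N := (u - 1)%nat) (nb := 4)
    (I := fun j s' => (j < u)%nat /\ frame [6]%nat [] s s' /\
       regs s' rN = 2 ^ Z.of_nat (u - j)); try assumption; try esz_side; try ec_side.
  - intros j s1 Hs1' (Hj & Hf & EN1).
    assert (ER1 : regs s1 rR = R) by (unframe; auto).
    split; [simpl; lia|]. split.
    { simpl. rewrite EN1, ER1.
      replace (2 ^ Z.of_nat (u - S j) <? R * 2 + 2) with true; [lia|].
      symmetry. apply Z.ltb_lt. specialize (Hlt (u - S j)%nat ltac:(lia)). lia. }
    assert (E2 : regs s1 rN * 2 = 2 ^ Z.of_nat (u - j)).
    { rewrite EN1. replace (u - j)%nat with (S (u - S j)) by lia. rewrite pow2_S. lia. }
    pose proof (pow_mono_le (u - j) u ltac:(lia)). pose proof (pow2_pos (u - j)).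
    apply trm_assign;
      [assumption | simpl; lia | esz_side
      | change (Z.abs (regs s1 rN * 2) <= V); lia | ec_side |].
    change (ev s1 (Var rN *! Cst 2)) with (regs s1 rN * 2). rewrite E2. conjs.
    + lia.
    + frm.
    + apply set_reg_eq.
  - intros s1 Hs1' (_ & Hf & EN1). rewrite Nat.sub_0_r in EN1.
    assert (ER1 : regs s1 rR = R) by (unframe; auto).
    split; [simpl; lia|]. split.
    + simpl. rewrite EN1, ER1.
      replace (2 ^ Z.of_nat u <? R * 2 + 2) with false; auto.
      symmetry. apply Z.ltb_ge. lia.
    + apply HQ; auto.
  - conjs; [lia | frm |]. replace (u - (u - 1))%nat with 1%nat by lia. reflexivity.
Qed.

Definition conv_c (t1 t2 dst : Z) : cmd :=
  size_c ;; rL ::= Var rN ;; pass 1 (load t1) ;; pass 2 (load t2) ;;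
  fwd_c 1 ;; fwd_c 2 ;; pass 1 base2E ;; rk ::= Cst 1 ;; inv_loop ;;
  rL ::= Var rR +! Cst 1 ;; pass dst (Rd 1 (Var rq) /! Var rk).

(** [4 R + 4] bounds the transform length. The three logarithms bound the number of levels
    (crudely), the passes per level and the growth of the array. *)
Definition conv_cost (R : Z) : Z :=
  5000 * (4 * R + 4) * (Z.log2 (4 * R + 4) + 3) ^ 3.

(** The amplitude is [V0] at the input, [V0 * P] after the forward transforms, [2 * (V0 * P)^2]
    after [base2], and gains another factor [P] on the way back. Only indices from 0 to [R] of the
    destination change, so its zeros at negative indices survive. *)
Lemma trm_conv t1 t2 dst s n R (p q : pol) V0 (Q : state -> Prop) :
  small s -> 7 <= t1 < M -> 7 <= t2 < M -> 7 <= dst < M ->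
  regs s rR = R -> 0 <= R -> 1 <= V0 ->
  let P := (4 * R + 4) ^ 4 in
  2 * (V0 * P * (V0 * P)) * P <= V ->
  (forall z, 0 <= z <= R -> arr s t1 z = cf p z /\ Z.abs (cf p z) <= V0) ->
  (forall z, 0 <= z <= R -> arr s t2 z = cf q z /\ Z.abs (cf q z) <= V0) ->
  conv_cost R <= n ->
  (forall s', small s' -> frame conv_regs [0; 1; 2; 3; dst] s s' ->
     (forall z, arr s' dst z
        = if ((0 <=? z) && (z <? R + 1))%bool then cf (pmul p q) z else arr s dst z) ->
     Q s') ->
  trm (conv_c t1 t2 dst) s n Q.
Proof.
  intros Hs Ht1 Ht2 Hd ER HR HV0 P HP Hp Hq Hn HQ.
  destruct (pow2_cover R HR) as (u & Hu & (Hu1 & Hu2) & Hu3).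
  destruct (chain_exists u Hu) as [ls Hch].
  pose proof (npass_bound u ls Hch) as Hnp. pose proof (chain_length u ls Hch) as Hlen.
  pose proof (proj1 (chain_blowup u ls Hch)) as Hbl.
  pose proof (kappa_bound ls) as Hkb. pose proof (kappa_pos ls) as Hkp.
  set (N := 2 ^ Z.of_nat u) in *. set (Pn := 2 ^ Z.of_nat (npass ls)) in *.
  assert (HPn : Pn <= P).
  { unfold Pn, P. apply Z.le_trans with (2 ^ (Z.of_nat u * 4)).
    - apply Z.pow_le_mono_r; lia.
    - rewrite Z.pow_mul_r by lia. apply Z.pow_le_mono_l. fold N. lia. }
  assert (HPn1 : 1 <= Pn) by (pose proof (pow2_pos (npass ls)); unfold Pn; lia).
  assert (HP1 : 4 * R + 4 <= P).
  { unfold P. rewrite <- (Z.pow_1_r (4 * R + 4)) at 1. apply Z.pow_le_mono_r; lia. }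
  assert (HPP : P * P <= V0 * P * (V0 * P)).
  { apply Z.mul_le_mono_nonneg; try lia; rewrite <- (Z.mul_1_l P) at 1;
      apply Z.mul_le_mono_nonneg_r; lia. }
  assert (HVP : V0 * P <= V /\ V0 <= V /\ 2 * (P * P) <= V /\ P <= V).
  { assert (V0 <= V0 * P) by (rewrite <- (Z.mul_1_r V0) at 1; apply Z.mul_le_mono_nonneg_l; lia).
    assert (P <= P * P) by (rewrite <- (Z.mul_1_r P) at 1; apply Z.mul_le_mono_nonneg_l; lia).
    set (Y := V0 * P) in *.
    assert (Y <= Y * Y) by (rewrite <- (Z.mul_1_r Y) at 1; apply Z.mul_le_mono_nonneg_l; lia).
    assert (2 * (Y * Y) <= 2 * (Y * Y) * P)
      by (rewrite <- (Z.mul_1_r (2 * (Y * Y))) at 1; apply Z.mul_le_mono_nonneg_l; lia).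
    lia. }
  destruct HVP as (HVP & HV0V & H2PP & HPV).
  assert (HNV : N <= V) by lia.
  assert (HuN : Z.of_nat u < N) by (apply Z.pow_gt_lin_r; lia).
  set (Ln := 2 ^ Z.of_nat (length ls)) in *.
  assert (HLn : 1 <= Ln <= 2 * Z.of_nat u).
  { unfold Ln. pose proof (pow2_pos (length ls)). split; [lia|].
    replace 2 with (Z.of_nat 2) at 1 by reflexivity. rewrite <- Nat2Z.inj_pow. lia. }
  set (LB := N * (2 * Z.of_nat u)).
  assert (HLB : N * Ln <= LB) by (apply Z.mul_le_mono_nonneg_l; lia).
  assert (HLBV : LB <= V).
  { apply Z.le_trans with (2 * (P * P)); [|lia]. unfold LB.
    replace (N * (2 * Z.of_nat u)) with (2 * (N * Z.of_nat u)) by ring.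
    apply Z.mul_le_mono_nonneg_l; [lia|]. apply Z.mul_le_mono_nonneg; lia. }
  assert (HLB0 : N <= LB).
  { unfold LB. rewrite <- (Z.mul_1_r N) at 1. apply Z.mul_le_mono_nonneg_l; lia. }
  set (fc := Z.of_nat (length ls) * ((Z.of_nat u + 3) * (LB * 210 + 100) + 10) + 20).
  (* Three transforms at [fc] each, the other passes over length [N], and [base2] over length at
     most [LB]; all terms are compared with [N * x^3] for [x = u + 3]. *)
  assert (Hfc : 3 * fc + N * 900 + LB * 210 + Z.of_nat u * 20 + 200 <= n).
  { eapply Z.le_trans; [|exact Hn].
    assert (Hlog : Z.of_nat u <= Z.log2 (4 * R + 4)) by (apply Z.log2_le_pow2; lia).
    unfold conv_cost.
    apply Z.le_trans with (5000 * N * (Z.of_nat u + 3) ^ 3).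
    2: { apply Z.mul_le_mono_nonneg; try lia. apply Z.pow_le_mono_l. lia. }
    set (x := Z.of_nat u + 3).
    assert (Hx : 4 <= x) by (unfold x; lia).
    assert (B1 : LB <= 2 * N * x) by (unfold LB, x; rewrite Z.mul_assoc, (Z.mul_comm N 2); apply Z.mul_le_mono_nonneg_l; lia).
    assert (HN2 : 2 <= N) by lia.
    assert (B2 : fc <= x * (x * (2 * N * x * 210 + 100) + 10) + 20).
    { unfold fc. apply Z.add_le_mono_r. fold x.
      apply Z.mul_le_mono_nonneg; [lia | unfold x; lia | |].
      - apply Z.add_nonneg_nonneg; [|lia]. apply Z.mul_nonneg_nonneg; lia.
      - apply Z.add_le_mono_r. apply Z.mul_le_mono_nonneg_l; lia. }
    clear - B1 B2 Hx HN2. assert (Z.of_nat u = x - 3) by (unfold x; lia).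
    rewrite H. clearbody x LB fc N. clear H.
    assert (C1 : x * x <= N * (x * x)) by nia.
    assert (C2 : N * (x * x) * 4 <= N * (x * x) * x) by nia.
    assert (C3 : x <= x * x) by nia.
    assert (C4 : N * x <= N * (x * x)) by nia.
    assert (C5 : N <= N * x) by nia.
    replace ((x) ^ 3) with (x * (x * x)) by ring.
    replace (5000 * N * (x * (x * x))) with (5000 * (N * (x * x) * x)) by ring.
    replace (x * (x * (2 * N * x * 210 + 100) + 10) + 20) with
      (420 * (N * (x * x) * x) + 100 * (x * x) + 10 * x + 20) in B2 by ring.
    replace (2 * N * x) with (2 * (N * x)) in B1 by ring. lia. }
  assert (Hfc0 : 0 <= fc).
  { unfold fc. apply Z.add_nonneg_nonneg; [|lia]. apply Z.mul_nonneg_nonneg; [lia|].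
    apply Z.add_nonneg_nonneg; [|lia]. apply Z.mul_nonneg_nonneg; lia. }
  assert (ENL : exists nb, 0 <= nb /\ N * Ln = 2 * nb).
  { exists (2 ^ Z.of_nat (u - 1) * Ln).
    pose proof (pow2_pos (u - 1)). split; [apply Z.mul_nonneg_nonneg; lia|].
    unfold N. replace u with (S (u - 1)) at 1 by lia. rewrite pow2_S. ring. }
  destruct ENL as (nb & Hnb & ENL).
  assert (HNL0 : 0 <= N * Ln) by (rewrite ENL; lia).
  assert (HVPn : 0 <= V0 * Pn <= V0 * P).
  { clear - HPn HPn1 HV0. split; [apply Z.mul_nonneg_nonneg | apply Z.mul_le_mono_nonneg_l]; lia. }
  set (amp1 := V0 * Pn) in *.
  assert (Hamp2P : 0 <= 2 * (amp1 * amp1) /\ 2 * (amp1 * amp1) * Pn <= V).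
  { clear - HVPn HPn HPn1 HP.
    assert (amp1 * amp1 <= V0 * P * (V0 * P)) by (apply Z.mul_le_mono_nonneg; lia).
    assert (0 <= amp1 * amp1) by (apply Z.mul_nonneg_nonneg; lia).
    split; [lia|]. eapply Z.le_trans; [|exact HP]. apply Z.mul_le_mono_nonneg; lia. }
  assert (Hamp2V : 2 * (amp1 * amp1) <= V).
  { clear - Hamp2P HPn1. eapply Z.le_trans; [|apply Hamp2P].
    rewrite <- (Z.mul_1_r (2 * (amp1 * amp1))) at 1. apply Z.mul_le_mono_nonneg_l; lia. }
  assert (Hamp1 : 0 <= amp1 <= V) by (clear - HVPn HVP; lia).
  assert (HkV : kappa ls <= V) by (clear - Hkb HPn HPV; lia).
  assert (HlenV : Z.of_nat (length ls) <= V) by (clear - Hlen HuN HNV; lia).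
  assert (HV0' : 0 <= V0 <= V) by lia.
  assert (HRV : R + 1 <= V) by (clear - Hu1 HNV HR; lia).
  assert (E1V0 : V0 * Pn = amp1) by reflexivity.
  destruct Hamp2P as [Hamp20 Hamp2P].
  assert (Hfce : fc = Z.of_nat (length ls) * ((Z.of_nat u + 3) * (LB * 210 + 100) + 10) + 20)
    by reflexivity.
  clearbody fc amp1 LB. clear HPP H2PP HPV HVP HV0V HP HPn HP1 HPn1 Hn Hlen Hbl Hnp HVPn HV0
    HuN HLn Hkb.
  clearbody P. clear P.
  unfold conv_c.
  apply trm_bind with (n1 := Z.of_nat u * 20 + 20)
    (n2 := 3 * fc + N * 900 + LB * 210 + 180); [|lia].
  apply trm_size with (R := R) (u := u); try assumption; try lia.
  intros s1 Hs1 Hf1 EN1. fold N in EN1.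
  apply trm_assign_seq with (n2 := 3 * fc + N * 900 + LB * 210 + 178);
    [assumption | exact I | esz_side | apply small_reg; assumption | | ec_side].
  intros Hs2. simpl ev in *. rewrite EN1 in *.
  assert (Hf2 : frame [7]%nat [] s1 (set_reg s1 rL N)) by (apply frame_set_reg; simpl; auto).
  assert (EL2 : regs (set_reg s1 rL N) rL = N) by apply set_reg_eq.
  set (s2 := set_reg s1 rL N) in *. clearbody s2.
  apply trm_bind with (n1 := N * 210 + 20)
    (n2 := 3 * fc + N * 690 + LB * 210 + 158); [|lia].
  apply trm_load with (R := R) (N := N) (F := cf p) (V0 := V0); try assumption; try lia.
  { unframe. auto. }
  { intros z Hz. unframe. auto. }
  intros s3 Hs3 Hf3 Hh3.
  apply trm_bind with (n1 := N * 210 + 20)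
    (n2 := 3 * fc + N * 480 + LB * 210 + 138); [|lia].
  apply trm_load with (R := R) (N := N) (F := cf q) (V0 := V0); try assumption; try lia.
  { unframe. auto. }
  { unframe. auto. }
  { intros z Hz. unframe. auto. }
  intros s4 Hs4 Hf4 Hh4.
  assert (Hh4' : holds s4 1 N (cut R (cf p)) V0)
    by (eapply holds_frame; [exact Hh3 | exact Hf4 | lia | fr_side]).
  assert (EN4 : regs s4 rN = N)
    by (unframe; auto).
  apply trm_bind with (n1 := fc)
    (n2 := 2 * fc + N * 480 + LB * 210 + 138); [|lia].
  apply trm_fwd_c with (ls := ls) (v := u) (A := cut R (cf p)) (amp := V0) (LB := LB);
    try assumption; try lia; fold N Ln Pn; rewrite ?E1V0; try assumption; try lia.
  intros s5 Hs5 Hf5 EL5 El5 A5 Hh5.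
  assert (Hh5' : holds s5 2 N (cut R (cf q)) V0)
    by (eapply holds_frame; [exact Hh4 | exact Hf5 | lia | fr_side]).
  assert (EN5 : regs s5 rN = N) by (unframe; auto).
  apply trm_bind with (n1 := fc)
    (n2 := fc + N * 480 + LB * 210 + 138); [|lia].
  apply trm_fwd_c with (ls := ls) (v := u) (A := cut R (cf q)) (amp := V0) (LB := LB);
    try assumption; try lia; fold N Ln Pn; rewrite ?E1V0; try assumption; try lia.
  intros s6 Hs6 Hf6 EL6 El6 A6 Hh6.
  assert (Hh6' : holds s6 1 (N * Ln) (forward ls (cut R (cf p))) amp1)
    by (eapply holds_frame; [exact Hh5 | exact Hf6 | lia | fr_side]).
  set (amp2 := 2 * (amp1 * amp1)) in *.
  apply trm_bind with (n1 := LB * 210 + 20)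
    (n2 := fc + N * 480 + 118); [|lia].
  apply trm_base2 with (nb := nb) (A := forward ls (cut R (cf p))) (B := forward ls (cut R (cf q)))
    (amp := amp1); try assumption; try lia; rewrite <- ?ENL; try assumption; try lia.
  intros s7 Hs7 Hf7 Hh7. fold amp2 in Hh7.
  set (C := base2 (forward ls (cut R (cf p))) (forward ls (cut R (cf q)))) in *.
  apply trm_assign_seq with (n2 := fc + N * 480 + 116);
    [assumption | simpl; lia | esz_side | simpl; lia | | ec_side].
  intros Hs8. simpl ev in *.
  assert (Hf8 : frame [13]%nat [] s7 (set_reg s7 rk 1)) by (apply frame_set_reg; simpl; auto).
  assert (Ek8 : regs (set_reg s7 rk 1) rk = 1) by apply set_reg_eq.
  set (s8 := set_reg s7 rk 1) in *. clearbody s8.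
  apply trm_bind with (n1 := fc)
    (n2 := N * 480 + 116); [|lia].
  apply trm_inv_loop with (ls := ls) (v := u) (n2 := 5) (nb := 1) (L := N) (C := C)
    (amp := amp2) (d := 0) (k0 := 1) (LB := LB); try assumption; try lia; fold Ln Pn;
    try assumption; try lia.
  { intros i Hi. rewrite Z.add_0_l.
    unframe. auto. }
  { rewrite (proj1 Hf8), (proj1 Hf7), El6 by fr_side. lia. }
  { rewrite (proj1 Hf8), (proj1 Hf7), EL6 by fr_side. reflexivity. }
  { eapply holds_frame; [exact Hh7 | exact Hf8 | lia | fr_side]. }
  intros s9 Hs9 Hf9 El9 EL9 Ek9 Hh9. rewrite Z.mul_1_l in Ek9.
  apply trm_while_exit; try assumption; try esz_side; try ec_side.
  { simpl. now rewrite El9. }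
  assert (ER9 : regs s9 rR = R).
  { unframe. auto. }
  assert (E9 : ev s9 (Var rR +! Cst 1) = R + 1) by (simpl; now rewrite ER9).
  apply trm_assign_seq with (n2 := N * 480 + 112);
    [assumption | simpl; lia | esz_side | rewrite E9; lia | | ec_side].
  rewrite E9. intros Hs10.
  assert (Hf10 : frame [7]%nat [] s9 (set_reg s9 rL (R + 1))) by (apply frame_set_reg; simpl; auto).
  assert (EL10 : regs (set_reg s9 rL (R + 1)) rL = R + 1) by apply set_reg_eq.
  set (s10 := set_reg s9 rL (R + 1)) in *. clearbody s10.
  (* The array holds [kappa] times the coefficient. As [kappa >= 1], the bound on the multiple also
     bounds the coefficient, and the division below is exact. *)
  assert (Hres : forall z, 0 <= z <= R ->
    arr s10 1 z = kappa ls * cf (pmul p q) z /\ Z.abs (cf (pmul p q) z) <= V).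
  { intros z Hz.
    assert (E : backward ls C z = kappa ls * cf (pmul p q) z).
    { unfold C. apply Nussbaumer.nussbaumer with (v := u) (R := R); auto. }
    destruct (Hh9 z ltac:(lia)) as [E1 E2]. rewrite (proj2 Hf10) by fr_side.
    rewrite E1, E. split; auto. rewrite E, Z.abs_mul in E2.
    assert (1 * Z.abs (cf (pmul p q) z) <= Z.abs (kappa ls) * Z.abs (cf (pmul p q) z))
      by (apply Z.mul_le_mono_nonneg_r; lia).
    lia. }
  assert (Hec : ec (Rd 1 (Var rq) /! Var rk) = 8) by reflexivity.
  apply trm_pass with (g := cf (pmul p q)); try assumption; try lia.
  - esz_side.
  - intros i s' Hi Hf Hs' Hqi. rewrite EL10 in Hi.
    assert (Ek' : regs s' rk = kappa ls)
      by (rewrite (proj1 Hf), (proj1 Hf10) by fr_side; auto).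
    destruct (Hres i ltac:(lia)) as [E1 E2].
    split; [simpl; repeat split; try lia|]. split; [|exact E2].
    change (ev s' (Rd 1 (Var rq) /! Var rk)) with (arr s' 1 (regs s' rq) / regs s' rk).
    rewrite Hqi, Ek', (proj2 Hf), E1 by fr_side. rewrite Z.mul_comm, Z.div_mul; lia.
  - intros s' Hs' Hf Ha. rewrite EL10 in Ha. apply HQ; auto.
    + unfold conv_regs. frm.
    + intros z. rewrite Ha. destruct ((0 <=? z) && (z <? R + 1))%bool; auto.
      destruct (in_dec Z.eq_dec dst [0; 1; 2; 3]) as [i|i]; [simpl in i; lia|].
      rewrite (proj2 Hf10), (proj2 Hf9), (proj2 Hf8), (proj2 Hf7), (proj2 Hf6), (proj2 Hf5),
        (proj2 Hf4), (proj2 Hf3), (proj2 Hf2), (proj2 Hf1) by fr_side. reflexivity.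
Qed.

End Conv.

(** * Products of the polynomials of the sets *)

Notation padd := Nussbaumer.padd.
Notation pone := Nussbaumer.pone.
Notation pzero := Nussbaumer.pzero.
Notation pmono := Nussbaumer.pmono.

Fixpoint mkpol (n : nat) (f : Z -> Z) : pol :=
  match n with
  | O => pzero
  | S n' => padd (mkpol n' f) (pmono (f (Z.of_nat n')) (Z.of_nat n'))
  end.

Lemma cf_mono c v z :
  0 <= v -> cf (pmono c v) z = if z =? v then c else 0.
Proof.
  intros Hv. rewrite <- (Nussbaumer.pmul1 (pmono c v)), Nussbaumer.pmulC.
  rewrite Nussbaumer.cf_mono_mul, Nussbaumer.cf_one by auto.
  destruct (Z.eqb_spec (z - v) 0), (Z.eqb_spec z v); lia.
Qed.

Lemma cf_mkpol n f z :
  cf (mkpol n f) z = if ((0 <=? z) && (z <? Z.of_nat n))%bool then f z else 0.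
Proof.
  induction n as [|n IH]; cbn [mkpol].
  - rewrite Nussbaumer.cf_zero. destruct (Z.leb_spec 0 z), (Z.ltb_spec z (Z.of_nat 0)); simpl; lia.
  - rewrite Nussbaumer.cf_add, IH, cf_mono by lia.
    destruct (Z.leb_spec 0 z), (Z.ltb_spec z (Z.of_nat n)), (Z.ltb_spec z (Z.of_nat (S n))),
      (Z.eqb_spec z (Z.of_nat n)); subst; simpl; lia.
Qed.

(** Multiplying by a generating polynomial adds one shifted copy of [q] per element of the set; the
    counting inductions run over this recurrence. *)
Lemma cf_mkpol_mul n f q z :
  cf (pmul (mkpol (S n) f) q) z
  = cf (pmul (mkpol n f) q) z + f (Z.of_nat n) * cf q (z - Z.of_nat n).
Proof.
  cbn [mkpol]. rewrite Nussbaumer.pmulDl, Nussbaumer.cf_add, Nussbaumer.cf_mono_mul; lia.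
Qed.

Definition zero_one (f : Z -> Z) : Prop := forall z, f z = 0 \/ f z = 1.

Lemma cf_mkpol_mul_bound n f q B z :
  zero_one f -> (forall x, 0 <= cf q x <= B) ->
  0 <= cf (pmul (mkpol n f) q) z <= Z.of_nat n * B.
Proof.
  intros Hf Hq. induction n as [|n IH].
  - cbn [mkpol]. rewrite Nussbaumer.pmul0, Nussbaumer.cf_zero. lia.
  - rewrite cf_mkpol_mul. specialize (Hq (z - Z.of_nat n)).
    destruct (Hf (Z.of_nat n)) as [-> | ->]; lia.
Qed.

Lemma cf_mkpol_mul_neq0 n f q z :
  zero_one f -> (forall x, 0 <= cf q x) ->
  cf (pmul (mkpol n f) q) z <> 0 <->
  exists x, 0 <= x < Z.of_nat n /\ f x = 1 /\ cf q (z - x) <> 0.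
Proof.
  intros Hf Hq. induction n as [|n IH].
  - cbn [mkpol]. rewrite Nussbaumer.pmul0, Nussbaumer.cf_zero.
    split; [congruence|]. intros (x & Hx & _). lia.
  - assert (H0 : 0 <= cf (pmul (mkpol n f) q) z).
    { clear IH. induction n as [|n IHn].
      - cbn [mkpol]. rewrite Nussbaumer.pmul0, Nussbaumer.cf_zero. lia.
      - rewrite cf_mkpol_mul. specialize (Hq (z - Z.of_nat n)).
        destruct (Hf (Z.of_nat n)) as [-> | ->]; lia. }
    rewrite cf_mkpol_mul. pose proof (Hq (z - Z.of_nat n)) as Hqn. split.
    + intros H. destruct (Z.eq_dec (cf (pmul (mkpol n f) q) z) 0) as [E|E].
      * exists (Z.of_nat n). destruct (Hf (Z.of_nat n)) as [E1|E1]; rewrite E1 in *; lia.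
      * apply IH in E as (x & Hx & E1 & E2). exists x. repeat split; auto; lia.
    + intros (x & Hx & E1 & E2).
      destruct (Z.eq_dec x (Z.of_nat n)) as [->|Hne]; [rewrite E1; lia|].
      assert (E : cf (pmul (mkpol n f) q) z <> 0)
        by (apply IH; exists x; repeat split; auto; lia).
      destruct (Hf (Z.of_nat n)) as [-> | ->]; lia.
Qed.

Definition pprod (g : nat -> pol) (l : list nat) : pol :=
  fold_right (fun j p => pmul (g j) p) pone l.

Lemma pprod_ext g g' l : (forall j, In j l -> g j = g' j) -> pprod g l = pprod g' l.
Proof.
  induction l as [|j l IH]; intros H; simpl; auto.
  rewrite H, IH; simpl; auto. intros. apply H. simpl; auto.
Qed.

Definition without (i : nat) (l : list nat) : list nat :=
  filter (fun j => negb (Nat.eqb j i)) l.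

Lemma without_notin i l : ~ In i l -> without i l = l.
Proof.
  induction l as [|j l IH]; intros H; simpl; auto.
  destruct (Nat.eqb_spec j i) as [->|]; simpl in *; [tauto|]. f_equal. tauto.
Qed.

Lemma pprod_split g i l :
  NoDup l -> In i l -> pprod g l = pmul (g i) (pprod g (without i l)).
Proof.
  induction l as [|j l IH]; intros Hd Hi; [destruct Hi|].
  apply NoDup_cons_iff in Hd as [Hj Hd]. simpl.
  destruct (Nat.eqb_spec j i) as [->|Hne]; simpl.
  - fold (without i l). now rewrite without_notin.
  - destruct Hi as [|Hi]; [congruence|]. rewrite IH by auto. fold (without i l).
    rewrite !Nussbaumer.pmulA. f_equal. apply Nussbaumer.pmulC.
Qed.

Lemma pprod_bound n f l z :
  (forall j, In j l -> zero_one (f j)) ->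
  0 <= cf (pprod (fun j => mkpol n (f j)) l) z <= Z.of_nat n ^ Z.of_nat (length l).
Proof.
  revert z. induction l as [|j l IH]; intros z H.
  - simpl. rewrite Nussbaumer.cf_one. destruct (z =? 0); lia.
  - cbn [pprod fold_right length]. rewrite Nat2Z.inj_succ, Z.pow_succ_r by lia.
    apply cf_mkpol_mul_bound; [apply H; simpl; auto|].
    intros x. apply IH. intros. apply H. simpl; auto.
Qed.

(** The coefficient counts the choices of one element per set with sum [z]; a query asks only
    whether it vanishes. *)
Lemma pprod_neq0 n f l z :
  (forall j, In j l -> zero_one (f j)) ->
  cf (pprod (fun j => mkpol n (f j)) l) z <> 0 <->
  exists xs, Forall2 (fun j x => 0 <= x < Z.of_nat n /\ f j x = 1) l xs /\
    fold_right Z.add 0 xs = z.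
Proof.
  revert z. induction l as [|j l IH]; intros z H.
  - simpl. rewrite Nussbaumer.cf_one. destruct (Z.eqb_spec z 0) as [->|Hz].
    + split; [|congruence]. intros _. exists []. auto.
    + split; [congruence|]. intros (xs & Hxs & E). inversion Hxs; subst. auto.
  - assert (Hl : forall j, In j l -> zero_one (f j)) by (intros; apply H; simpl; auto).
    cbn [pprod fold_right]. fold (pprod (fun j => mkpol n (f j)) l).
    rewrite cf_mkpol_mul_neq0; [|apply H; simpl; auto | intros; now apply pprod_bound].
    split.
    + intros (x & Hx & E1 & E2). apply IH in E2 as (xs & Hxs & E); auto.
      exists (x :: xs). split; [constructor; auto|]. simpl. lia.
    + intros (xs & Hxs & E). inversion Hxs as [|? x ? xs' [Hx E1] Hxs']; subst.
      exists x. repeat split; auto; try lia. apply IH; auto. exists xs'. split; auto.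
      simpl. lia.
Qed.

Definition mask_pol (k : nat) (old : nat -> pol) (U : nat) : pol :=
  pprod (fun j => if Nat.testbit U j then old j else pone) (seq 0 k).

Lemma mask_pol_0 k old : mask_pol k old 0 = pone.
Proof.
  unfold mask_pol. induction (seq 0 k) as [|j l IH]; auto.
  cbn [pprod fold_right]. rewrite Nat.bits_0. fold (pprod (fun j => if Nat.testbit 0 j then old j else pone) l).
  now rewrite Nussbaumer.pmul1.
Qed.

Lemma mask_pol_setbit k old U j :
  (j < k)%nat -> Nat.testbit U j = false ->
  mask_pol k old (Nat.setbit U j) = pmul (old j) (mask_pol k old U).
Proof.
  intros Hj Hb. unfold mask_pol.
  assert (Hi : In j (seq 0 k)) by (apply in_seq; lia).
  rewrite !(pprod_split _ j (seq 0 k)) by (auto using seq_NoDup).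
  rewrite Nat.setbit_eq, Hb, Nussbaumer.pmul1. f_equal.
  apply pprod_ext. intros i Hin. unfold without in Hin. apply filter_In in Hin as [_ Hin].
  rewrite Nat.setbit_neq; auto. intros ->. rewrite Nat.eqb_refl in Hin. discriminate.
Qed.

Lemma mask_pol_zero k old U j :
  (j < k)%nat -> Nat.testbit U j = true -> old j = pzero -> mask_pol k old U = pzero.
Proof.
  intros Hj Hb E. unfold mask_pol.
  rewrite (pprod_split _ j) by (auto using seq_NoDup; apply in_seq; lia).
  now rewrite Hb, E, Nussbaumer.pmul0.
Qed.

(** A set outside the mask contributes a factor 1, at most [n], so the exponent [k] serves all
    masks. *)
Lemma mask_pol_bound k n f U z :
  (1 <= n)%nat -> (forall j, (j < k)%nat -> zero_one (f j)) ->
  0 <= cf (mask_pol k (fun j => mkpol n (f j)) U) z <= Z.of_nat n ^ Z.of_nat k.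
Proof.
  intros Hn Hf. unfold mask_pol.
  assert (forall l, (forall j, In j l -> (j < k)%nat) ->
    0 <= cf (pprod (fun j => if Nat.testbit U j then mkpol n (f j) else pone) l) z
      <= Z.of_nat n ^ Z.of_nat (length l)) as H.
  { intros l. revert z. induction l as [|j l IH]; intros z Hl.
    - simpl. rewrite Nussbaumer.cf_one. destruct (z =? 0); lia.
    - cbn [pprod fold_right length]. rewrite Nat2Z.inj_succ, Z.pow_succ_r by lia.
      assert (Hl' : forall i, In i l -> (i < k)%nat) by (intros; apply Hl; simpl; auto).
      destruct (Nat.testbit U j).
      + apply cf_mkpol_mul_bound; [apply Hf, Hl; simpl; auto|]. intros x. now apply IH.
      + rewrite Nussbaumer.pmul1. specialize (IH z Hl'). unfold pprod in IH.
        assert (1 * Z.of_nat n ^ Z.of_nat (length l) <= Z.of_nat n * Z.of_nat n ^ Z.of_nat (length l))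
          by (apply Z.mul_le_mono_nonneg_r; lia).
        lia. }
  specialize (H (seq 0 k)). rewrite length_seq in H. apply H.
  intros j Hj. apply in_seq in Hj. lia.
Qed.

Lemma setbit_lt U j k : (U < 2 ^ k)%nat -> (j < k)%nat -> (Nat.setbit U j < 2 ^ k)%nat.
Proof.
  intros HU Hj. rewrite Nat.setbit_spec'.
  destruct (Nat.eq_dec (Nat.lor U (2 ^ j)) 0) as [->|Hne]; [lia|].
  apply Nat.log2_lt_pow2; [lia|]. rewrite Nat.log2_lor, Nat.log2_pow2 by lia.
  apply Nat.max_lub_lt; auto.
  destruct (Nat.eq_dec U 0) as [->|HU0].
  - rewrite Nat.log2_nonpos by lia. lia.
  - apply Nat.log2_lt_pow2; [lia | exact HU].
Qed.

Lemma setbit_neq0 U j : Nat.setbit U j <> 0%nat.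
Proof.
  intros E. pose proof (Nat.setbit_eq U j) as H. rewrite E, Nat.bits_0 in H. discriminate.
Qed.

(** Dropping the top bit gives a smaller mask, so in increasing order each table takes one
    convolution of an earlier table with one set. *)
Lemma mask_top q : (q <> 0)%nat ->
  let m := Nat.log2 q in let q' := (q - 2 ^ m)%nat in
  Nat.testbit q' m = false /\ q = Nat.setbit q' m /\ (q' < q)%nat.
Proof.
  intros Hq m q'. destruct (Nat.log2_spec q ltac:(lia)) as [H1 H2]. fold m in H1, H2.
  rewrite Nat.pow_succ_r' in H2.
  assert (Hb : Nat.testbit q' m = false).
  { destruct (Nat.eq_dec q' 0) as [->|Hne]; [apply Nat.bits_0|].
    apply Nat.bits_above_log2, Nat.log2_lt_pow2; unfold q' in *; lia. }
  split; auto. assert (0 < 2 ^ m)%nat by lia. split; [|unfold q'; lia].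
  assert (Hand : Nat.land q' (2 ^ m) = 0%nat).
  { apply Nat.bits_inj. intros i. rewrite Nat.land_spec, Nat.bits_0, Nat.pow2_bits_eqb.
    destruct (Nat.eqb_spec m i) as [->|]; [rewrite Hb|rewrite andb_false_r]; auto. }
  rewrite Nat.setbit_spec', <- Nat.lxor_lor, <- Nat.add_nocarry_lxor by auto.
  unfold q'. lia.
Qed.

(** The log is common to all sets; entries of other sets enter with coefficient 0. The sum is meant
    to be the current polynomial of set [j] minus its old one. *)
Fixpoint events (who val sgn : Z -> Z) (j n : nat) : pol :=
  match n with
  | O => pzero
  | S n' => padd (events who val sgn j n')
      (pmono ((if who (Z.of_nat n') =? Z.of_nat j then 1 else 0) * sgn (Z.of_nat n'))
         (val (Z.of_nat n')))
  end.

Lemma events_ext who val sgn who' val' sgn' j n :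
  (forall i, 0 <= i < Z.of_nat n -> who i = who' i /\ val i = val' i /\ sgn i = sgn' i) ->
  events who val sgn j n = events who' val' sgn' j n.
Proof.
  induction n as [|n IH]; intros H; cbn [events]; auto.
  destruct (H (Z.of_nat n) ltac:(lia)) as (-> & -> & ->).
  rewrite IH; auto. intros. apply H. lia.
Qed.

Lemma mkpol_update n f v s :
  0 <= v < Z.of_nat n ->
  mkpol n (fun z => if z =? v then f z + s else f z) = padd (mkpol n f) (pmono s v).
Proof.
  intros Hv. apply Nussbaumer.pol_ext. intros z.
  rewrite Nussbaumer.cf_add, !cf_mkpol, cf_mono by lia.
  destruct (Z.eqb_spec z v) as [->|].
  - replace ((0 <=? v) && (v <? Z.of_nat n))%bool with true; auto.
    symmetry. apply andb_true_intro. rewrite Z.leb_le, Z.ltb_lt. lia.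
  - destruct ((0 <=? z) && (z <? Z.of_nat n))%bool; lia.
Qed.

(** The product is linear in each factor, so a change [e] of one factor changes the count by [e]
    times the product of the others; this is what an update enumerates. *)
Lemma pprod_update (g g' : nat -> pol) i l e :
  NoDup l -> In i l -> g' i = padd (g i) e -> (forall j, j <> i -> g' j = g j) ->
  pprod g' l = padd (pprod g l) (pmul e (pprod g (without i l))).
Proof.
  intros Hd Hi E H. rewrite !(pprod_split _ i l) by auto.
  rewrite E, Nussbaumer.pmulDl.
  assert (E2 : pprod g' (without i l) = pprod g (without i l)).
  { apply pprod_ext. intros j Hj. apply H. intros ->. unfold without in Hj.
    apply filter_In in Hj as [_ Hj]. rewrite Nat.eqb_refl in Hj. discriminate. }
  now rewrite E2.
Qed.

(** * Counting the solutions through one element *)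

(* The table of the subfamily with bitmask [U], and the current [j]-th set. *)
Definition tT (U : nat) : Z := 7 + Z.of_nat U.
Definition tC (k j : nat) : Z := 7 + Z.of_nat (2 ^ k + j).

Definition zr (d : nat) : nat := (20 + 3 * d)%nat.
Definition cr (d : nat) : nat := (21 + 3 * d)%nat.
Definition qr (d : nat) : nat := (22 + 3 * d)%nat.

Definition is_nil {A} (l : list A) : bool := match l with [] => true | _ => false end.

Section Count.

Context {mc : Machine}.

Let HV : 2 <= V := V_ge.
Let HM : 8 <= M <= V := M_range.
Let HK0 : (300 <= K)%nat := K_ge.

Variables (k : nat) (R : Z).
Hypotheses (HR : 0 <= R <= V) (Hk : 7 + Z.of_nat (2 ^ k + k) <= M).

(* Adds to register 3 the coefficient, at the target in [zr d], of the product of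
   the old sets in [U] and the current sets in [js], times [cr d].  The first
   current set is expanded into its old set and the log; the special case keeps the
   nesting depth of the loops at [length js - 1] when [U] is empty. *)
Fixpoint gen (js : list nat) (U d : nat) : cmd :=
  match js with
  | [] => 3%nat ::= Var 3 +! Var (cr d) *! Rd (tT U) (Var (zr d))
  | j :: js' =>
      if (Nat.eqb U 0 && is_nil js')%bool
      then 3%nat ::= Var 3 +! Var (cr d) *! Rd (tC k j) (Var (zr d))
      else
        zr (S d) ::= Var (zr d) ;; cr (S d) ::= Var (cr d) ;;
        gen js' (Nat.setbit U j) (S d) ;;
        For (qr d) (Var 4)
          (zr (S d) ::= Var (zr d) -! Rd 4 (Var (qr d)) ;;
           cr (S d) ::= Var (cr d) *! ((Rd 5 (Var (qr d)) =! Cst (Z.of_nat j))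
                                       *! Rd 6 (Var (qr d))) ;;
           gen js' U (S d))
  end.

Definition rest_pol (old cur : nat -> pol) (js : list nat) (U : nat) : pol :=
  pmul (mask_pol k old U) (pprod cur js).

(** [old] describes the sets at the last rebuild. The table equations include negative [z], since
    subtracting log values may take the target below 0; it never exceeds [R] because log values are
    nonnegative. *)
Record counting (s : state) (t : Z) (old cur : nat -> pol) : Prop := {
  c_t : 0 <= t;
  c_table : forall U z, (U < 2 ^ k)%nat -> z <= R ->
    arr s (tT U) z = cf (mask_pol k old U) z;
  c_cur : forall j z, (j < k)%nat -> z <= R -> arr s (tC k j) z = cf (cur j) z;
  c_events : forall j, (j < k)%nat ->
    cur j = padd (old j) (events (arr s 5) (arr s 4) (arr s 6) j (Z.to_nat t));
  c_range : forall i, 0 <= i < t -> 0 <= arr s 4 i <= R /\ Z.abs (arr s 6 i) <= 1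
}.

Lemma counting_mem s s' t old cur :
  mem s' = mem s -> counting s t old cur -> counting s' t old cur.
Proof.
  intros E [H1 H2 H3 H4 H5].
  assert (Ea : arr s' = arr s) by (unfold arr; now rewrite E).
  constructor; rewrite ?Ea; auto.
Qed.

Lemma rest_pol_cons old cur js j U :
  (j < k)%nat -> Nat.testbit U j = false ->
  rest_pol old cur js (Nat.setbit U j) = pmul (old j) (rest_pol old cur js U).
Proof.
  intros Hj Hb. unfold rest_pol. rewrite mask_pol_setbit by auto.
  now rewrite Nussbaumer.pmulA.
Qed.

(** [m] remaining sets mean [m] nested choices, hence [(t + 1)^m]. As long as no old set is chosen
    one factor is saved, because the branch through log entries alone ends in a lookup of the last
    current set. With [m = k - 1] this is the exponent [k - 2]. *)
Definition gen_cost (js : list nat) (U : nat) (t : Z) : Z :=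
  let m := Z.of_nat (length js) in
  if (Nat.eqb U 0 && negb (is_nil js))%bool
  then (t + 1) ^ (m - 1) * (100 * (m * m))
  else (t + 1) ^ m * (60 * m + 20).

(** For an empty mask, choosing the old set leaves [m] sets at full exponent, and each of the [t]
    log entries leaves [m] sets at exponent [m - 1]: both parts are of order [(t + 1)^m]. The square
    in [100 * (m * m)] makes room for the linear term added at each level. *)
Lemma gen_cost_step j js U t :
  0 <= t -> (Nat.eqb U 0 && is_nil js)%bool = false ->
  gen_cost js (Nat.setbit U j) t + t * (gen_cost js U t + 35) + 10
  <= gen_cost (j :: js) U t.
Proof.
  intros Ht Hb. unfold gen_cost. cbn [length is_nil negb].
  rewrite andb_true_r.
  replace (Nat.eqb (Nat.setbit U j) 0) with false
    by (symmetry; apply Nat.eqb_neq, setbit_neq0).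
  cbn [andb].
  set (m := Z.of_nat (length js)).
  assert (Em : Z.of_nat (S (length js)) = m + 1) by (unfold m; lia).
  rewrite Em. assert (Hm : 0 <= m) by (unfold m; lia).
  assert (HP : 1 <= (t + 1) ^ m) by (assert (0 < (t + 1) ^ m) by (apply Z.pow_pos_nonneg; lia); lia).
  destruct (Nat.eqb U 0); cbn [andb] in *.
  - destruct js as [|j' js']; [discriminate|]. cbn [is_nil negb].
    replace (m + 1 - 1) with m by lia.
    assert (E : (t + 1) ^ m = (t + 1) * (t + 1) ^ (m - 1)).
    { rewrite <- Z.pow_succ_r by (unfold m; cbn [length]; lia). f_equal. lia. }
    assert (Hm1 : 1 <= m) by (unfold m; cbn [length]; lia).
    assert (HP1 : 0 < (t + 1) ^ (m - 1)) by (apply Z.pow_pos_nonneg; lia).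
    set (x := (t + 1) ^ (m - 1)) in *. rewrite E. clearbody x m. clear - HP1 Hm1 Ht.
    assert (t + 1 <= (t + 1) * x) by nia.
    set (y := (t + 1) * x) in *.
    assert (t * (x * (100 * (m * m))) <= y * (100 * (m * m))).
    { unfold y. rewrite Z.mul_assoc. apply Z.mul_le_mono_nonneg_r; nia. }
    assert (0 <= y * m) by nia.
    replace (y * (100 * ((m + 1) * (m + 1)))) with (y * (100 * (m * m)) + 200 * (y * m) + 100 * y) by ring.
    replace (y * (60 * m + 20)) with (60 * (y * m) + 20 * y) by ring.
    rewrite Z.mul_add_distr_l. assert (y <= y * m) by nia. lia.
  - rewrite Z.pow_add_r, Z.pow_1_r by lia.
    set (x := (t + 1) ^ m) in *. clearbody x m. clear - HP Hm Ht.
    assert (t + 1 <= x * (t + 1)) by nia.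
    replace (x * (t + 1) * (60 * (m + 1) + 20))
      with (x * (60 * m + 20) + t * (x * (60 * m + 20)) + 60 * (x * (t + 1))) by ring.
    lia.
Qed.

Lemma gen_cost_nonneg js U t : 0 <= t -> 0 <= gen_cost js U t.
Proof.
  intros Ht. unfold gen_cost. set (m := Z.of_nat (length js)).
  destruct (Nat.eqb U 0 && negb (is_nil js))%bool.
  - apply Z.mul_nonneg_nonneg; [apply Z.pow_nonneg; lia | nia].
  - apply Z.mul_nonneg_nonneg; [apply Z.pow_nonneg; lia | lia].
Qed.

Lemma tT_range U : (U < 2 ^ k)%nat -> 7 <= tT U < M.
Proof. unfold tT. lia. Qed.

Lemma tC_range j : (j < k)%nat -> 7 <= tC k j < M.
Proof. unfold tC. lia. Qed.

(** Each nesting level owns three registers, so recursive calls preserve the loops around them. At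
    most [(t + 1)^length] leaves contribute at most [Y] each, which keeps the accumulator within
    [V]; every level lowers the target by at most [R]. *)
Lemma trm_gen old cur Y js U d s n t z c (Q : state -> Prop) :
  small s -> counting s t old cur -> regs s 4 = t ->
  (forall U z, (U < 2 ^ k)%nat -> Z.abs (cf (mask_pol k old U) z) <= Y) ->
  (forall j z, (j < k)%nat -> Z.abs (cf (cur j) z) <= Y) ->
  0 <= Y -> NoDup js -> (forall j, In j js -> (j < k)%nat /\ Nat.testbit U j = false) ->
  (U < 2 ^ k)%nat ->
  regs s (zr d) = z -> regs s (cr d) = c -> Z.abs c <= 1 -> z <= R ->
  - V <= z - Z.of_nat (length js) * R ->
  Z.abs (regs s 3) + (t + 1) ^ Z.of_nat (length js) * Y <= V ->
  gen_cost js U t <= n ->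
  (forall s', small s' -> mem s' = mem s ->
     (forall x, (x < qr d)%nat -> x <> 3%nat -> regs s' x = regs s x) ->
     regs s' 3 = regs s 3 + c * cf (rest_pol old cur js U) z ->
     Z.abs (regs s' 3) <= Z.abs (regs s 3) + (t + 1) ^ Z.of_nat (length js) * Y ->
     Q s') ->
  trm (gen js U d) s n Q.
Proof.
  intros Hs Hc Et HYT HYC HY.
  revert U d s n z c Q Hs Hc Et.
  induction js as [|j js IH];
    intros U d s n z c Q Hs Hc Et Hd Hin HU Ez Ec Hcb Hz Hzl Hacc Hn HQ.
  - cbn [gen]. unfold gen_cost in Hn. cbn [length is_nil negb] in *.
    rewrite andb_false_r in Hn. change (Z.of_nat 0) with 0 in *. rewrite Z.pow_0_r, Z.mul_1_l in *.
    assert (E : ev s (Var 3 +! Var (cr d) *! Rd (tT U) (Var (zr d)))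
                = regs s 3 + c * cf (mask_pol k old U) z).
    { change (regs s 3 + regs s (cr d) * arr s (tT U) (regs s (zr d))
              = regs s 3 + c * cf (mask_pol k old U) z).
      rewrite Ez, Ec, (c_table _ _ _ _ Hc) by auto. reflexivity. }
    assert (Hb : Z.abs (c * cf (mask_pol k old U) z) <= Y).
    { rewrite Z.abs_mul. specialize (HYT U z HU). clear - Hcb HYT. nia. }
    pose proof (tT_range U HU) as HT.
    apply trm_assign; [assumption | simpl; repeat split; lia | simpl; lia
      | rewrite E; lia | unfold Rd; ecs; lia |].
    rewrite E. apply HQ.
    + apply small_set_reg; auto. lia.
    + reflexivity.
    + intros x _ Hx. apply set_reg_neq; auto.
    + rewrite set_reg_eq. unfold rest_pol. cbn [pprod fold_right].
      now rewrite (Nussbaumer.pmulC _ pone), Nussbaumer.pmul1.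
    + rewrite set_reg_eq. lia.
  - apply NoDup_cons_iff in Hd as [Hj Hd].
    destruct (Hin j ltac:(simpl; auto)) as [Hjk Hbit].
    cbn [gen]. destruct (Nat.eqb U 0 && is_nil js)%bool eqn:Hleaf.
    + apply andb_true_iff in Hleaf as [HU0 Hnil]. apply Nat.eqb_eq in HU0. subst U.
      destruct js; [|discriminate]. cbn [length] in *.
      assert (Hn' : 100 <= n).
      { unfold gen_cost in Hn. cbn [length is_nil negb Nat.eqb andb] in Hn.
        change (Z.of_nat 1) with 1 in Hn. rewrite Z.sub_diag, Z.pow_0_r in Hn. lia. }
      assert (E : ev s (Var 3 +! Var (cr d) *! Rd (tC k j) (Var (zr d)))
                  = regs s 3 + c * cf (cur j) z).
      { change (regs s 3 + regs s (cr d) * arr s (tC k j) (regs s (zr d))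
                = regs s 3 + c * cf (cur j) z).
        rewrite Ez, Ec, (c_cur _ _ _ _ Hc) by auto. reflexivity. }
      assert (Hb : Z.abs (c * cf (cur j) z) <= Y).
      { rewrite Z.abs_mul. specialize (HYC j z Hjk). clear - Hcb HYC. nia. }
      assert (HY1 : Y <= (t + 1) ^ Z.of_nat 1 * Y).
      { change (Z.of_nat 1) with 1. rewrite Z.pow_1_r. pose proof (c_t _ _ _ _ Hc).
        clear - H HY. nia. }
      pose proof (tC_range j Hjk) as HT.
      apply trm_assign; [assumption | simpl; repeat split; lia | simpl; lia
        | rewrite E; lia | unfold Rd; ecs; lia |].
      rewrite E. apply HQ.
      * apply small_set_reg; auto. lia.
      * reflexivity.
      * intros x _ Hx. apply set_reg_neq; auto.
      * rewrite set_reg_eq. unfold rest_pol. cbn [pprod fold_right].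
        rewrite mask_pol_0, Nussbaumer.pmul1.
        now rewrite (Nussbaumer.pmulC _ pone), Nussbaumer.pmul1.
      * rewrite set_reg_eq. lia.
    + assert (Ht0 : 0 <= t) by apply (c_t _ _ _ _ Hc).
      pose proof (gen_cost_step j js U t Ht0 Hleaf) as Hstep.
      pose proof (gen_cost_nonneg js U t Ht0) as Hg0.
      pose proof (gen_cost_nonneg js (Nat.setbit U j) t Ht0) as Hg1.
      set (gs := gen_cost js (Nat.setbit U j) t) in *. set (g := gen_cost js U t) in *.
      cbn [length] in *. rewrite Nat2Z.inj_succ in *.
      set (m := Z.of_nat (length js)) in *. assert (Hm0 : 0 <= m) by (unfold m; lia).
      rewrite Z.pow_succ_r in * by lia.
      assert (HG : 0 < (t + 1) ^ m) by (apply Z.pow_pos_nonneg; lia).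
      set (GY := (t + 1) ^ m * Y) in *.
      assert (HGY : 0 <= GY) by (apply Z.mul_nonneg_nonneg; lia).
      replace ((t + 1) * (t + 1) ^ m * Y) with ((t + 1) * GY) in * by (unfold GY; ring).
      assert (HtGY : 0 <= t * GY) by (apply Z.mul_nonneg_nonneg; lia).
      rewrite Z.mul_add_distr_r, Z.mul_1_l in *.
      assert (HtV : t <= V) by (pose proof (small_reg s 4 Hs); lia).
      assert (HmR : 0 <= m * R) by (apply Z.mul_nonneg_nonneg; lia).
      assert (Hin' : forall i, In i js -> (i < k)%nat /\ Nat.testbit U i = false)
        by (intros; apply Hin; simpl; auto).
      apply trm_assign_seq with (n2 := n - 2);
        [assumption | exact I | simpl; lia | apply small_reg; assumption | | ecs; lia].
      intros Hs1. change (ev s (Var (zr d))) with (regs s (zr d)) in *. rewrite Ez in *.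
      set (s1 := set_reg s (zr (S d)) z) in *.
      assert (F1 : forall x, (x < zr (S d))%nat -> regs s1 x = regs s x)
        by (intros; apply set_reg_neq; lia).
      assert (Z1 : regs s1 (zr (S d)) = z) by apply set_reg_eq.
      assert (M1 : mem s1 = mem s) by reflexivity. clearbody s1.
      assert (Ec1 : regs s1 (cr d) = c) by (rewrite F1; auto; unfold zr, cr; lia).
      apply trm_assign_seq with (n2 := n - 4);
        [assumption | exact I | simpl; lia | apply small_reg; assumption | | ecs; lia].
      intros Hs2. change (ev s1 (Var (cr d))) with (regs s1 (cr d)) in *. rewrite Ec1 in *.
      set (s2 := set_reg s1 (cr (S d)) c) in *.
      assert (F2 : forall x, (x < zr (S d))%nat -> regs s2 x = regs s x)
        by (intros; unfold s2; rewrite set_reg_neq by (unfold zr, cr in *; lia); auto).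
      assert (Z2 : regs s2 (zr (S d)) = z)
        by (unfold s2; rewrite set_reg_neq by (unfold zr, cr; lia); auto).
      assert (C2 : regs s2 (cr (S d)) = c) by apply set_reg_eq.
      assert (M2 : mem s2 = mem s) by exact M1. clearbody s2.
      assert (Q3 : (3 < zr (S d))%nat /\ (4 < zr (S d))%nat /\ (qr d < zr (S d))%nat)
        by (unfold zr, qr; lia).
      destruct Q3 as (Q3 & Q4 & Qq).
      apply trm_bind with (n1 := gs)
    (n2 := n - 4 - gs); [|lia].
      apply IH with (z := z) (c := c); auto; try lia.
      { apply counting_mem with s; auto. }
      { rewrite F2; auto. }
      { intros i Hi. destruct (Hin' i Hi). split; auto.
        rewrite Nat.setbit_neq; auto. congruence. }
      { now apply setbit_lt. }
      { rewrite F2 by auto. fold m GY. lia. }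
      intros s3 Hs3 M3 F3 A3 B3. fold m GY in B3. rewrite F2 in A3, B3 by auto.
      rewrite rest_pol_cons in A3 by auto.
      assert (F3' : forall x, (x < zr (S d))%nat -> x <> 3%nat -> regs s3 x = regs s x).
      { intros x Hx Hx3. rewrite F3 by (unfold qr, zr in *; lia). auto. }
      rewrite M2 in M3.
      set (G := rest_pol old cur js U) in *.
      set (E := events (arr s 5) (arr s 4) (arr s 6) j).
      (* After [i] log entries the accumulator accounts for the old set plus the first [i] events;
         at [i = t] that sum is the current set, by [c_events]. *)
      apply trm_for with (N := t) (nb := 27 + g)
        (I := fun i s' => mem s' = mem s /\
           (forall x, (x < qr d)%nat -> x <> 3%nat -> regs s' x = regs s x) /\
           regs s' 3 = regs s 3 + c * cf (pmul (padd (old j) (E (Z.to_nat i))) G) z /\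
           Z.abs (regs s' 3) <= Z.abs (regs s 3) + GY + i * GY);
        try assumption; try lia.
      * simpl. lia.
      * rewrite (set_reg_neq s3 (qr d) 3) by (unfold qr; lia). conjs.
        -- exact M3.
        -- intros x Hx Hx3. rewrite set_reg_neq by lia. apply F3'; auto. lia.
        -- rewrite A3. unfold E. cbn [events Z.to_nat]. now rewrite Nussbaumer.padd0.
        -- lia.
      * intros i s4 Hi Hs4 (M4 & F4 & _) _. simpl. rewrite F4 by (unfold qr; lia). auto.
      * intros i s4 Hi Hs4 (M4 & F4 & A4 & B4) Hq.
        assert (Ea : arr s4 = arr s) by (unfold arr; now rewrite M4).
        destruct (c_range _ _ _ _ Hc i Hi) as [Hv Hsg].
        set (v := arr s 4 i) in *. set (sg := arr s 6 i) in *.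
        assert (Ev : ev s4 (Var (zr d) -! Rd 4 (Var (qr d))) = z - v).
        { change (regs s4 (zr d) - arr s4 4 (regs s4 (qr d)) = z - v).
          rewrite Ea, Hq, F4, Ez by (unfold zr, qr; lia). reflexivity. }
        assert (Hzl' : - V <= z - v - m * R) by lia.
        apply trm_assign_seq with (n2 := 18 + g);
          [assumption | simpl; repeat split; lia | simpl; lia | rewrite Ev; lia | |
           unfold Rd; ecs; lia].
        rewrite Ev. intros Hs5.
        set (s5 := set_reg s4 (zr (S d)) (z - v)) in *.
        assert (F5 : forall x, (x < zr (S d))%nat -> regs s5 x = regs s4 x)
          by (intros; apply set_reg_neq; lia).
        assert (Z5 : regs s5 (zr (S d)) = z - v) by apply set_reg_eq.
        assert (M5 : mem s5 = mem s) by exact M4. clearbody s5.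
        assert (Ea5 : arr s5 = arr s) by (unfold arr; now rewrite M5).
        set (co := (if arr s 5 i =? Z.of_nat j then 1 else 0) * sg).
        assert (Ev5 : ev s5 (Var (cr d) *! ((Rd 5 (Var (qr d)) =! Cst (Z.of_nat j))
                               *! Rd 6 (Var (qr d)))) = c * co).
        { change (regs s5 (cr d) * ((if arr s5 5 (regs s5 (qr d)) =? Z.of_nat j then 1 else 0)
                    * arr s5 6 (regs s5 (qr d))) = c * co).
          rewrite Ea5, !F5, Hq, F4, Ec by (unfold zr, cr, qr; lia). reflexivity. }
        assert (Hco : Z.abs (c * co) <= 1).
        { unfold co. clear - Hcb Hsg. clearbody sg. rewrite !Z.abs_mul.
          destruct (arr s 5 i =? Z.of_nat j); simpl; nia. }
        apply trm_assign_seq with (n2 := g);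
          [assumption | simpl; repeat split; lia | simpl; lia | rewrite Ev5; lia | |
           unfold Rd; ecs; lia].
        rewrite Ev5. intros Hs6.
        set (s6 := set_reg s5 (cr (S d)) (c * co)) in *.
        assert (F6 : forall x, (x < zr (S d))%nat -> regs s6 x = regs s4 x)
          by (intros; unfold s6; rewrite set_reg_neq by (unfold zr, cr in *; lia); auto).
        assert (Z6 : regs s6 (zr (S d)) = z - v)
          by (unfold s6; rewrite set_reg_neq by (unfold zr, cr; lia); auto).
        assert (C6 : regs s6 (cr (S d)) = c * co) by apply set_reg_eq.
        assert (M6 : mem s6 = mem s) by exact M5. clearbody s6.
        assert (HiGY : i * GY + GY <= t * GY).
        { replace (i * GY + GY) with ((i + 1) * GY) by ring.
          apply Z.mul_le_mono_nonneg_r; lia. }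
        apply IH with (z := z - v) (c := c * co); auto; try lia.
        -- apply counting_mem with s; auto.
        -- rewrite F6, F4 by (unfold qr in *; lia). auto.
        -- rewrite F6 by auto. fold m GY. lia.
        -- intros s7 Hs7 M7 F7 A7 B7. fold m GY G in A7, B7. rewrite F6 in A7, B7 by auto.
           assert (F7' : forall x, (x < zr (S d))%nat -> x <> 3%nat -> regs s7 x = regs s4 x).
           { intros x Hx Hx3. rewrite F7 by (unfold qr, zr in *; lia). auto. }
           rewrite (set_reg_neq s7 (qr d) 3) by (unfold qr; lia). conjs.
           ++ rewrite F7' by (unfold qr in *; lia). auto.
           ++ change (mem s7 = mem s). congruence.
           ++ intros x Hx Hx3. rewrite set_reg_neq by lia. rewrite F7'; auto. lia.
           ++ rewrite A7, A4.
              replace (Z.to_nat (i + 1)) with (S (Z.to_nat i)) by lia.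
              unfold E. cbn [events]. rewrite Z2Nat.id by lia. fold v sg co.
              rewrite Nussbaumer.paddA, (Nussbaumer.pmulDl _ (pmono co v)), Nussbaumer.cf_add,
                Nussbaumer.cf_mono_mul by lia. ring.
           ++ lia.
      * intros s4 Hs4 (M4 & F4 & A4 & B4) _. apply HQ; auto; [|lia].
        rewrite A4. unfold E. rewrite <- (c_events _ _ _ _ Hc j Hjk).
        unfold G, rest_pol. cbn [pprod fold_right].
        rewrite !Nussbaumer.pmulA. now rewrite (Nussbaumer.pmulC (cur j)).
      * ecs. lia.
Qed.

End Count.

(** * Processing an operation *)

(** The power occurs only inside a test, as an intermediate value, so it may exceed [V]; the
    unfolded product has about [k] leaves, which [K] allows. *)
Fixpoint powE (n : nat) : expr :=
  match n with
  | O => Cst 1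
  | S n' => Var 4 *! powE n'
  end.

Lemma ev_powE s n : ev s (powE n) = regs s 4 ^ Z.of_nat n.
Proof.
  induction n as [|n IH]; [reflexivity|].
  rewrite Nat2Z.inj_succ, Z.pow_succ_r by lia. rewrite <- IH. reflexivity.
Qed.

Lemma esz_powE n : esz (powE n) = S n.
Proof. induction n; simpl; auto. Qed.

Lemma ec_powE n : ec (powE n) = 2 * Z.of_nat n + 1.
Proof.
  induction n as [|n IH]; [reflexivity|]. cbn [powE]. rewrite ec_bin, IH, ec_var. lia.
Qed.

Lemma length_without j n k : (n <= j < n + k)%nat ->
  length (without j (seq n k)) = (k - 1)%nat.
Proof.
  revert n. induction k as [|k IH]; intros n Hj; [lia|].
  cbn [seq without filter]. fold (without j (seq (S n) k)).
  destruct (Nat.eqb_spec n j) as [->|Hne]; cbn [negb].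
  - rewrite without_notin by (rewrite in_seq; lia). rewrite length_seq. lia.
  - cbn [length]. rewrite IH by lia. lia.
Qed.

Definition coef_bound (k : nat) (R : Z) : Z := (R + 1) ^ Z.of_nat k.

Section Ops.

Context {mc : Machine}.

Let HV : 2 <= V := V_ge.
Let HM : 8 <= M <= V := M_range.
Let HK0 : (300 <= K)%nat := K_ge.

Variables (k : nat) (R : Z).
Hypotheses (HR : 0 <= R) (Hk3 : (3 <= k)%nat) (Hk : 7 + Z.of_nat (2 ^ k + k) <= M)
  (HkK : (k + 10 <= K)%nat).

Definition conv_fits : Prop :=
  let D := coef_bound k R in let P := (4 * R + 4) ^ 4 in
  2 * (D * P * (D * P)) * P <= V.

Local Notation D := (coef_bound k R).

Hypotheses (HVconv : conv_fits) (HkR : (Z.of_nat k + 1) * R <= V).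

Definition arrpol (f : nat -> Z -> Z) (j : nat) : pol := mkpol (Z.to_nat R + 1) (f j).

Fixpoint rebuild_upto (n : nat) : cmd :=
  match n with
  | O => Skip
  | S n' =>
      rebuild_upto n' ;;
      conv_c (tT (n - 2 ^ Nat.log2 n)) (tC k (Nat.log2 n)) (tT n)
  end.

Lemma okE_powE s n : okE s (powE n).
Proof. induction n as [|n IH]; simpl; [lia | auto]. Qed.

Lemma D_ge1 : 1 <= D.
Proof.
  assert (0 < D) by (unfold coef_bound; apply Z.pow_pos_nonneg; lia). lia.
Qed.

Lemma R_lt_V : R + 1 <= V.
Proof.
  destruct (Z.eq_dec R 0) as [->|]; [lia|].
  assert ((2 * R) <= (Z.of_nat k + 1) * R) by (apply Z.mul_le_mono_nonneg_r; lia). lia.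
Qed.

Lemma mask_arrpol_bound f U z :
  (forall j, (j < k)%nat -> zero_one (f j)) ->
  0 <= cf (mask_pol k (arrpol f) U) z <= D.
Proof.
  intros Hf. unfold arrpol. pose proof (mask_pol_bound k (Z.to_nat R + 1) f U z) as H.
  replace (Z.of_nat (Z.to_nat R + 1)) with (R + 1) in H by lia. apply H; auto. lia.
Qed.

Lemma arrpol_bound f j z : zero_one (f j) -> 0 <= cf (arrpol f j) z <= 1.
Proof.
  intros Hf. unfold arrpol. rewrite cf_mkpol.
  destruct ((0 <=? z) && (z <? Z.of_nat (Z.to_nat R + 1)))%bool; [|lia].
  destruct (Hf z) as [-> | ->]; lia.
Qed.

Lemma cf_arrpol f j z :
  (forall x, ~ (0 <= x <= R) -> f j x = 0) -> cf (arrpol f j) z = f j z.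
Proof.
  intros Hf. unfold arrpol. rewrite cf_mkpol.
  destruct (Z.leb_spec 0 z), (Z.ltb_spec z (Z.of_nat (Z.to_nat R + 1))); simpl; auto;
    rewrite Hf; lia.
Qed.

Lemma trm_rebuild_upto n s c f (Q : state -> Prop) :
  (n < 2 ^ k)%nat -> small s -> regs s rR = R ->
  (forall j, (j < k)%nat -> zero_one (f j)) ->
  (forall j z, (j < k)%nat -> z <= R -> arr s (tC k j) z = cf (arrpol f j) z) ->
  (forall z, z <= R -> arr s (tT 0) z = cf pone z) ->
  (forall U z, (U < 2 ^ k)%nat -> z < 0 -> arr s (tT U) z = 0) ->
  Z.of_nat n * conv_cost R + 1 <= c ->
  (forall s', small s' ->
     (forall x, ~ In x conv_regs -> regs s' x = regs s x) ->
     (forall tau z, 4 <= tau < M -> (forall U, (U < 2 ^ k)%nat -> tau <> tT U) ->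
        arr s' tau z = arr s tau z) ->
     (forall U z, (U <= n)%nat -> z <= R -> arr s' (tT U) z = cf (mask_pol k (arrpol f) U) z) ->
     (forall U z, (U < 2 ^ k)%nat -> z < 0 -> arr s' (tT U) z = 0) -> Q s') ->
  trm (rebuild_upto n) s c Q.
Proof.
  revert c Q. induction n as [|n IH]; intros c Q Hn Hs ER Hf HC HT0 Hneg Hc HQ.
  - apply trm_skip; [assumption | lia |]. apply HQ; auto.
    intros U z HU Hz. replace U with 0%nat by lia. rewrite mask_pol_0. auto.
  - cbn [rebuild_upto].
    destruct (mask_top (S n) ltac:(lia)) as (Hb & Em & Hlt).
    set (m := Nat.log2 (S n)) in *. set (q' := (S n - 2 ^ m)%nat) in *.
    assert (Hm : (m < k)%nat) by (apply Nat.log2_lt_pow2; lia).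
    apply trm_bind with (n1 := Z.of_nat n * conv_cost R + 1)
    (n2 := conv_cost R); [|lia].
    apply IH; auto; try lia.
    intros s1 Hs1 F1 A1 T1 N1.
    assert (HCne : forall j U, (j < k)%nat -> (U < 2 ^ k)%nat -> tC k j <> tT U)
      by (intros; unfold tC, tT; lia).
    pose proof (tC_range k Hk m Hm) as R1.
    pose proof (tT_range k Hk (S n) Hn) as R2.
    pose proof (tT_range k Hk q' ltac:(lia)) as R3.
    pose proof D_ge1 as HD1.
    apply trm_conv with (R := R) (p := mask_pol k (arrpol f) q') (q := arrpol f m) (V0 := D);
      auto; try lia.
    + rewrite F1 by fr_side. auto.
    + intros z Hz. split; [apply T1; lia|].
      pose proof (mask_arrpol_bound f q' z Hf). lia.
    + intros z Hz. split.
      * rewrite A1; [apply HC; auto; lia | lia | intros; apply HCne; auto].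
      * pose proof (arrpol_bound f m z (Hf m Hm)). lia.
    + intros s2 Hs2 Hf2 A2.
      assert (Ep : mask_pol k (arrpol f) (S n) = pmul (mask_pol k (arrpol f) q') (arrpol f m)).
      { rewrite Em. rewrite mask_pol_setbit by auto. apply Nussbaumer.pmulC. }
      assert (O2 : forall tau z, 4 <= tau < M -> tau <> tT (S n) -> arr s2 tau z = arr s1 tau z).
      { intros tau z Ht Hne. apply (proj2 Hf2); [lia | simpl; lia]. }
      apply HQ; auto.
      * intros x Hx. rewrite (proj1 Hf2) by exact Hx. auto.
      * intros tau z Ht Hne. rewrite O2; auto.
      * intros U z HU Hz. destruct (Nat.eq_dec U (S n)) as [->|Hne].
        -- rewrite A2, Ep.
           destruct (Z.leb_spec 0 z), (Z.ltb_spec z (R + 1)); simpl; auto; try lia.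
           rewrite N1 by lia. now rewrite Nussbaumer.cf_neg by lia.
        -- rewrite O2; [apply T1; lia | | unfold tT; lia].
           pose proof (tT_range k Hk U ltac:(lia)). lia.
      * intros U z HU Hz. destruct (Nat.eq_dec U (S n)) as [->|Hne].
        -- rewrite A2. destruct (Z.leb_spec 0 z); simpl; [lia|]. apply N1; auto.
        -- rewrite O2; [apply N1; auto | | unfold tT; lia].
           pose proof (tT_range k Hk U ltac:(lia)). lia.
Qed.

(** [gen] has the array numbers built into its code, while the updated set is known only at run
    time; hence one copy per set, selected by comparison. *)
Fixpoint dispatch (l : list nat) : cmd :=
  match l with
  | [] => Skip
  | j :: l' =>
      If (Var 16 =! Cst (Z.of_nat j))
        (gen k (without j (seq 0 k)) 0 0 ;;
         Wr (tC k j) (Var 14) (Rd (tC k j) (Var 14) +! Var 15))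
        (dispatch l')
  end.

(** Registers 20 and 21 are [zr 0] and [cr 0]: solutions through the value [v] are the tuples of the
    other sets with sum [R - v], counted with the sign of the update. *)
Definition update_c : cmd :=
  20%nat ::= Var 2 -! Var 14 ;; 21%nat ::= Var 15 ;; dispatch (seq 0 k) ;;
  Wr 4 (Var 4) (Var 14) ;; Wr 5 (Var 4) (Var 16) ;; Wr 6 (Var 4) (Var 15) ;;
  4%nat ::= Var 4 +! Cst 1 ;;
  If (powE (k - 1) <! Var 2) Skip (rebuild_upto (2 ^ k - 1) ;; 4%nat ::= Cst 0).

(** [f] describes the sets as stored now and [g] those at the last rebuild. The clause [p_lt] limits
    the log for the cost analysis; [t = 0] covers the state just after a rebuild. *)
Record pinv (s : state) (t : Z) (f g : nat -> Z -> Z) : Prop := {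
  p_R : regs s 2 = R;
  p_t : regs s 4 = t;
  p_f : forall j, (j < k)%nat -> zero_one (f j) /\ forall z, ~ (0 <= z <= R) -> f j z = 0;
  p_g : forall j, (j < k)%nat -> zero_one (g j);
  p_cur : forall j z, (j < k)%nat -> arr s (tC k j) z = f j z;
  p_counting : counting k R s t (arrpol g) (arrpol f);
  p_count : regs s 3 = cf (pprod (arrpol f) (seq 0 k)) R;
  p_lt : t = 0 \/ t ^ Z.of_nat (k - 1) < R
}.

Definition bump_at (f : nat -> Z -> Z) (j : nat) (v sg : Z) (i : nat) (z : Z) : Z :=
  if Nat.eqb i j then (if z =? v then f i z + sg else f i z) else f i z.

Definition gc (t : Z) : Z :=
  (t + 1) ^ Z.of_nat (k - 2) * (100 * (Z.of_nat (k - 1) * Z.of_nat (k - 1))).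

Lemma gen_cost_others j t : (j < k)%nat -> gen_cost (without j (seq 0 k)) 0 t = gc t.
Proof.
  intros Hj. pose proof (length_without j 0 k ltac:(lia)) as Hl. unfold gen_cost.
  destruct (without j (seq 0 k)) eqn:E; [simpl in Hl; lia|]. rewrite Hl.
  cbn [Nat.eqb is_nil negb andb]. unfold gc. f_equal. f_equal. lia.
Qed.

Lemma gc_nonneg t : 0 <= t -> 0 <= gc t.
Proof. intros. unfold gc. apply Z.mul_nonneg_nonneg; [apply Z.pow_nonneg|]; nia. Qed.

Lemma trm_dispatch l j v sg s n t f g (Q : state -> Prop) :
  small s -> pinv s t f g -> In j l -> (forall i, In i l -> (i < k)%nat) ->
  0 <= v <= R -> Z.abs sg <= 1 -> Z.abs (f j v + sg) <= 1 ->
  regs s 14 = v -> regs s 15 = sg -> regs s 16 = Z.of_nat j ->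
  regs s 20 = R - v -> regs s 21 = sg ->
  D + (t + 1) ^ Z.of_nat (k - 1) * D <= V ->
  gc t + 30 + 5 * Z.of_nat (length l) <= n ->
  (forall s', small s' ->
     (forall x, (x < 22)%nat -> x <> 3%nat -> regs s' x = regs s x) ->
     regs s' 3 = cf (pprod (arrpol (bump_at f j v sg)) (seq 0 k)) R ->
     (forall tau z, 0 <= tau < M ->
        arr s' tau z = if ((tau =? tC k j) && (z =? v))%bool then f j v + sg else arr s tau z) ->
     Q s') ->
  trm (dispatch l) s n Q.
Proof.
  revert n. induction l as [|i l IH];
    intros n Hs Hp Hj Hl Hv Hsg Hfv E14 E15 E16 E20 E21 Hacc Hn HQ; [destruct Hj|].
  assert (Hi : (i < k)%nat) by (apply Hl; simpl; auto).
  assert (Ht0 : 0 <= t) by apply (c_t _ _ _ _ _ _ (p_counting _ _ _ _ Hp)).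
  pose proof (gc_nonneg t Ht0) as Hg0. pose proof R_lt_V as HRV. pose proof D_ge1 as HD.
  assert (HkM : Z.of_nat k <= V) by lia.
  cbn [dispatch length] in *.
  replace n with (1 + ec (Var 16 =! Cst (Z.of_nat i)) + (n - 4)) by (ecs; lia).
  apply trm_if; auto.
  { simpl. repeat split; lia. }
  { simpl. lia. }
  - intros Hev. simpl in Hev. rewrite E16 in Hev.
    destruct (Z.eqb_spec (Z.of_nat j) (Z.of_nat i)) as [E|]; [|lia].
    apply Nat2Z.inj in E. subst i.
    pose proof (length_without j 0 k ltac:(lia)) as Hlen.
    assert (HinW : forall x, In x (without j (seq 0 k)) -> (x < k)%nat /\ x <> j).
    { intros x Hx. unfold without in Hx. apply filter_In in Hx as [Hx1 Hx2].
      apply in_seq in Hx1. split; [lia|]. intros ->. now rewrite Nat.eqb_refl in Hx2. }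
    assert (HN3 : Z.abs (regs s 3) <= D).
    { rewrite (p_count _ _ _ _ Hp).
      pose proof (pprod_bound (Z.to_nat R + 1) f (seq 0 k) R) as B.
      rewrite length_seq in B. replace (Z.of_nat (Z.to_nat R + 1)) with (R + 1) in B by lia.
      assert (B' : 0 <= cf (pprod (arrpol f) (seq 0 k)) R <= D).
      { apply B. intros x Hx. apply in_seq in Hx. apply (p_f _ _ _ _ Hp). lia. }
      lia. }
    apply trm_bind with (n1 := gc t)
    (n2 := 15); [|lia].
    apply trm_gen with (R := R) (old := arrpol g) (cur := arrpol f) (Y := D) (t := t)
      (z := R - v) (c := sg); auto; try lia.
    + apply (p_counting _ _ _ _ Hp).
    + apply (p_t _ _ _ _ Hp).
    + intros U z HU. pose proof (mask_arrpol_bound g U z (p_g _ _ _ _ Hp)). lia.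
    + intros x z Hx. pose proof (arrpol_bound f x z (proj1 (p_f _ _ _ _ Hp x Hx))). lia.
    + apply NoDup_filter, seq_NoDup.
    + intros x Hx. split; [now apply HinW | apply Nat.bits_0].
    + clear. pose proof (Nat.pow_nonzero 2 k). lia.
    + rewrite Hlen. lia.
    + rewrite gen_cost_others by auto. lia.
    + intros s1 Hs1 M1 F1 A1 _.
      assert (Ea : arr s1 = arr s) by (unfold arr; now rewrite M1).
      assert (G14 : regs s1 14 = v) by (rewrite F1 by (unfold qr; lia); auto).
      assert (G15 : regs s1 15 = sg) by (rewrite F1 by (unfold qr; lia); auto).
      pose proof (tC_range k Hk j Hi) as HT.
      assert (Ev : ev s1 (Rd (tC k j) (Var 14) +! Var 15) = f j v + sg).
      { change (arr s1 (tC k j) (regs s1 14) + regs s1 15 = f j v + sg).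
        rewrite Ea, G14, G15, (p_cur _ _ _ _ Hp) by auto. reflexivity. }
      apply trm_wr; [assumption | lia | exact I | simpl; repeat split; lia | simpl; lia
        | simpl; lia | rewrite Ev; lia | unfold Rd; ecs; lia |].
      rewrite Ev. change (ev s1 (Var 14)) with (regs s1 14). rewrite G14.
      apply HQ.
      * apply small_set_mem; auto. lia.
      * intros x Hx Hx3. simpl regs. apply F1; auto.
      * simpl regs. rewrite A1, (p_count _ _ _ _ Hp).
        unfold rest_pol. rewrite mask_pol_0, Nussbaumer.pmul1.
        rewrite (pprod_update (arrpol f) (arrpol (bump_at f j v sg)) j (seq 0 k) (pmono sg v)).
        -- rewrite Nussbaumer.cf_add, Nussbaumer.cf_mono_mul by lia. reflexivity.
        -- apply seq_NoDup.
        -- apply in_seq. lia.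
        -- unfold arrpol. rewrite <- mkpol_update by lia.
           apply Nussbaumer.pol_ext. intros z. rewrite !cf_mkpol.
           unfold bump_at. now rewrite Nat.eqb_refl.
        -- intros x Hx. unfold arrpol. apply Nussbaumer.pol_ext. intros z.
           rewrite !cf_mkpol. unfold bump_at. now apply Nat.eqb_neq in Hx as ->.
      * intros tau z Htau. rewrite arr_set_mem by lia. now rewrite Ea.
  - intros Hev. simpl in Hev. rewrite E16 in Hev.
    destruct (Z.eqb_spec (Z.of_nat j) (Z.of_nat i)) as [|E]; [lia|].
    apply IH; auto; try lia.
    + destruct Hj as [->|]; [congruence|auto].
    + intros x Hx. apply Hl. simpl; auto.
Qed.

Lemma pmono_0 v : 0 <= v -> pmono 0 v = pzero.
Proof.
  intros Hv. apply Nussbaumer.pol_ext. intros z. rewrite cf_mono, Nussbaumer.cf_zero by auto.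
  now destruct (z =? v).
Qed.

Definition ucost (t : Z) : Z := gc t + 20 * Z.of_nat k + 150.
Definition rcost : Z := 2 ^ Z.of_nat k * conv_cost R + 10.

Lemma conv_cost_nonneg : 0 <= conv_cost R.
Proof.
  unfold conv_cost. pose proof (Z.log2_nonneg (4 * R + 4)).
  apply Z.mul_nonneg_nonneg; [lia | apply Z.pow_nonneg; lia].
Qed.

Lemma trm_update j v sg s t f g (Q : state -> Prop) :
  small s -> pinv s t f g -> (j < k)%nat ->
  0 <= v <= R -> Z.abs sg <= 1 -> zero_one (bump_at f j v sg j) ->
  regs s 14 = v -> regs s 15 = sg -> regs s 16 = Z.of_nat j ->
  D + (t + 1) ^ Z.of_nat (k - 1) * D <= V -> t + 1 <= V ->
  let b := (t + 1) ^ Z.of_nat (k - 1) <? R in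
  (forall s' g', small s' -> pinv s' (if b then t + 1 else 0) (bump_at f j v sg) g' -> Q s') ->
  trm update_c s (ucost t + if b then 0 else rcost) Q.
Proof.
  intros Hs Hp Hj Hv Hsg Hz1 E14 E15 E16 Hacc HtV b HQ.
  assert (Ht0 : 0 <= t) by apply (c_t _ _ _ _ _ _ (p_counting _ _ _ _ Hp)).
  pose proof (gc_nonneg t Ht0) as Hg0. pose proof R_lt_V as HRV.
  pose proof conv_cost_nonneg as Hcc.
  assert (Hrc : 0 <= if b then 0 else rcost).
  { destruct b; [lia|]. unfold rcost.
    assert (0 <= 2 ^ Z.of_nat k * conv_cost R)
      by (apply Z.mul_nonneg_nonneg; [apply Z.pow_nonneg|]; lia). lia. }
  assert (HkM : Z.of_nat k <= V) by lia.
  assert (Hfv : Z.abs (f j v + sg) <= 1).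
  { specialize (Hz1 v). unfold bump_at in Hz1. rewrite Nat.eqb_refl, Z.eqb_refl in Hz1. lia. }
  set (f' := bump_at f j v sg) in *.
  set (rc := if b then 0 else rcost) in *.
  unfold update_c, ucost.
  assert (E0 : ev s (Var 2 -! Var 14) = R - v) by (simpl; rewrite (p_R _ _ _ _ Hp), E14; auto).
  apply trm_assign_seq with (n2 := gc t + 20 * Z.of_nat k + 140 + rc);
    [assumption | simpl; auto | simpl; lia | rewrite E0; lia | | ecs; lia].
  rewrite E0. intros Hs1. set (s1 := set_reg s 20 (R - v)) in *.
  assert (F1 : forall x, (x < 20)%nat -> regs s1 x = regs s x)
    by (intros; apply set_reg_neq; lia).
  assert (G1 : regs s1 20 = R - v) by apply set_reg_eq.
  assert (M1 : mem s1 = mem s) by reflexivity. clearbody s1.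
  assert (E1 : ev s1 (Var 15) = sg) by (simpl; rewrite F1 by lia; auto).
  apply trm_assign_seq with (n2 := gc t + 20 * Z.of_nat k + 130 + rc);
    [assumption | exact I | simpl; lia | rewrite E1; lia | | ecs; lia].
  rewrite E1. intros Hs2. set (s2 := set_reg s1 21 sg) in *.
  assert (F2 : forall x, (x < 20)%nat -> regs s2 x = regs s x)
    by (intros; unfold s2; rewrite set_reg_neq by lia; apply F1; auto).
  assert (G2 : regs s2 20 = R - v)
    by (unfold s2; rewrite set_reg_neq by lia; auto).
  assert (H2 : regs s2 21 = sg) by apply set_reg_eq.
  assert (M2 : mem s2 = mem s) by exact M1. clearbody s2.
  assert (Ea2 : arr s2 = arr s) by (unfold arr; now rewrite M2).
  assert (Hp2 : pinv s2 t f g).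
  { destruct Hp as [P1 P2 P3 P4 P5 P6 P7 P8]. constructor; rewrite ?F2, ?Ea2 by lia; auto.
    apply counting_mem with s; auto. }
  apply trm_bind with (n1 := gc t + 30 + 5 * Z.of_nat k)
    (n2 := 15 * Z.of_nat k + 100 + rc); [|lia].
  apply trm_dispatch with (j := j) (v := v) (sg := sg) (t := t) (f := f) (g := g);
    auto; try (rewrite F2 by lia; assumption); try lia.
  { apply in_seq. lia. } { intros i Hi. apply in_seq in Hi. lia. }
  { rewrite length_seq. lia. }
  intros s3 Hs3 F3 N3 A3. rewrite Ea2 in A3. fold f' in N3.
  assert (F3' : forall x, (x < 20)%nat -> x <> 3%nat -> regs s3 x = regs s x).
  { intros x Hx Hx3. rewrite F3, F2 by lia. auto. }
  assert (E4 : regs s3 4 = t) by (rewrite F3' by lia; apply (p_t _ _ _ _ Hp)).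
  assert (G14 : regs s3 14 = v) by (rewrite F3' by lia; auto).
  assert (G15 : regs s3 15 = sg) by (rewrite F3' by lia; auto).
  assert (G16 : regs s3 16 = Z.of_nat j) by (rewrite F3' by lia; auto).
  pose proof (tC_range k Hk j Hj) as HTj.
  apply trm_wr_seq with (n2 := 15 * Z.of_nat k + 93 + rc);
    [assumption | lia | exact I | exact I | simpl; lia | simpl; lia
    | apply small_reg; assumption | | ecs; lia].
  intros s4 Hs4 E. change (ev s3 (Var 4)) with (regs s3 4) in E.
  change (ev s3 (Var 14)) with (regs s3 14) in E. rewrite E4, G14 in E.
  assert (R4 : forall x, regs s4 x = regs s3 x) by (intros; now subst s4).
  assert (A4 : forall tau z, 0 <= tau < M -> arr s4 tau z
     = if ((tau =? 4) && (z =? t))%bool then v else arr s3 tau z)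
    by (intros; subst s4; apply arr_set_mem; lia).
  clear E.
  apply trm_wr_seq with (n2 := 15 * Z.of_nat k + 86 + rc);
    [assumption | lia | exact I | exact I | simpl; lia | simpl; lia
    | apply small_reg; assumption | | ecs; lia].
  intros s5 Hs5 E. change (ev s4 (Var 4)) with (regs s4 4) in E.
  change (ev s4 (Var 16)) with (regs s4 16) in E. rewrite !R4, E4, G16 in E.
  assert (R5 : forall x, regs s5 x = regs s3 x) by (intros; subst s5; apply R4).
  assert (A5 : forall tau z, 0 <= tau < M -> arr s5 tau z
     = if ((tau =? 5) && (z =? t))%bool then Z.of_nat j else arr s4 tau z)
    by (intros; subst s5; apply arr_set_mem; lia).
  clear E.
  apply trm_wr_seq with (n2 := 15 * Z.of_nat k + 79 + rc);
    [assumption | lia | exact I | exact I | simpl; lia | simpl; lia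
    | apply small_reg; assumption | | ecs; lia].
  intros s6 Hs6 E. change (ev s5 (Var 4)) with (regs s5 4) in E.
  change (ev s5 (Var 15)) with (regs s5 15) in E. rewrite !R5, E4, G15 in E.
  assert (R6 : forall x, regs s6 x = regs s3 x) by (intros; subst s6; apply R5).
  assert (A6 : forall tau z, 0 <= tau < M -> arr s6 tau z
     = if ((tau =? 6) && (z =? t))%bool then sg else arr s5 tau z)
    by (intros; subst s6; apply arr_set_mem; lia).
  clear E.
  assert (E7 : ev s6 (Var 4 +! Cst 1) = t + 1) by (simpl; rewrite R6, E4; auto).
  apply trm_assign_seq with (n2 := 15 * Z.of_nat k + 70 + rc);
    [assumption | simpl; lia | simpl; lia | rewrite E7; lia | | ecs; lia].
  rewrite E7. intros Hs7. set (s7 := set_reg s6 4 (t + 1)) in *.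
  assert (T7 : regs s7 4 = t + 1) by apply set_reg_eq.
  assert (F7 : forall x, (x < 20)%nat -> x <> 3%nat -> x <> 4%nat -> regs s7 x = regs s x).
  { intros x Hx Hx3 Hx4. unfold s7. rewrite set_reg_neq, R6 by lia. apply F3'; lia. }
  assert (N7 : regs s7 3 = cf (pprod (arrpol f') (seq 0 k)) R)
    by (unfold s7; rewrite set_reg_neq, R6 by lia; auto).
  assert (A7 : forall tau z, 0 <= tau < M -> arr s7 tau z = arr s6 tau z) by reflexivity.
  clearbody s7.
  assert (Hlow : forall tau, 4 <= tau < 7 -> forall z, z <> t -> arr s7 tau z = arr s tau z).
  { intros tau Ht z Hz. rewrite A7, A6, A5, A4, A3 by lia.
    replace (z =? t) with false by (symmetry; apply Z.eqb_neq; auto). rewrite !andb_false_r.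
    replace (tau =? tC k j) with false by (symmetry; apply Z.eqb_neq; lia). reflexivity. }
  assert (Hhigh : forall tau z, 7 <= tau < M -> arr s7 tau z
     = if ((tau =? tC k j) && (z =? v))%bool then f j v + sg else arr s tau z).
  { intros tau z Ht. rewrite A7, A6, A5, A4, A3 by lia.
    replace (tau =? 4) with false by (symmetry; apply Z.eqb_neq; lia).
    replace (tau =? 5) with false by (symmetry; apply Z.eqb_neq; lia).
    replace (tau =? 6) with false by (symmetry; apply Z.eqb_neq; lia). reflexivity. }
  assert (Ht4 : arr s7 4 t = v).
  { rewrite A7, A6, A5, A4 by lia. cbn [Z.eqb Pos.eqb andb]. now rewrite Z.eqb_refl. }
  assert (Ht5 : arr s7 5 t = Z.of_nat j).
  { rewrite A7, A6, A5 by lia. cbn [Z.eqb Pos.eqb andb]. now rewrite Z.eqb_refl. }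
  assert (Ht6 : arr s7 6 t = sg).
  { rewrite A7, A6 by lia. cbn [Z.eqb Pos.eqb andb]. now rewrite Z.eqb_refl. }
  assert (Hf' : forall i, (i < k)%nat -> zero_one (f' i) /\ forall z, ~ (0 <= z <= R) -> f' i z = 0).
  { intros i Hi. destruct (p_f _ _ _ _ Hp i Hi) as [B1 B2]. split.
    - destruct (Nat.eq_dec i j) as [->|Hne]; auto.
      intros z. unfold f', bump_at. apply Nat.eqb_neq in Hne as ->. apply B1.
    - intros z Hz. unfold f', bump_at. destruct (Nat.eqb i j); auto.
      destruct (Z.eqb_spec z v); [lia|]. auto. }
  assert (C7 : forall i z, (i < k)%nat -> arr s7 (tC k i) z = f' i z).
  { intros i z Hi. pose proof (tC_range k Hk i Hi). rewrite Hhigh by lia.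
    rewrite (p_cur _ _ _ _ Hp) by auto. unfold f', bump_at.
    destruct (Nat.eqb_spec i j) as [->|Hne].
    - rewrite Z.eqb_refl. cbn [andb]. destruct (Z.eqb_spec z v) as [->|]; auto.
    - replace (tC k i =? tC k j) with false; auto.
      symmetry. apply Z.eqb_neq. unfold tC. lia. }
  assert (T7' : forall U z, (U < 2 ^ k)%nat -> arr s7 (tT U) z = arr s (tT U) z).
  { intros U z HU. pose proof (tT_range k Hk U HU). rewrite Hhigh by lia.
    replace (tT U =? tC k j) with false; auto.
    symmetry. apply Z.eqb_neq. unfold tC, tT. lia. }
  pose proof (p_counting _ _ _ _ Hp) as Hcnt.
  assert (Hpre : ev s7 (powE (k - 1) <! Var 2) = if b then 1 else 0).
  { change (ev s7 (powE (k - 1) <! Var 2))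
      with (if ev s7 (powE (k - 1)) <? regs s7 2 then 1 else 0).
    rewrite ev_powE, T7, F7, (p_R _ _ _ _ Hp) by lia. reflexivity. }
  assert (Hcost : ec (powE (k - 1) <! Var 2) <= 2 * Z.of_nat k + 1)
    by (rewrite ec_bin, ec_powE, ec_var; lia).
  eapply trm_weaken with (n := 1 + ec (powE (k - 1) <! Var 2) + (10 + rc));
    [|lia|intros ? ? H; exact H].
  apply trm_if; auto.
  { cbn [okE]. split; [apply okE_powE | auto]. }
  { cbn [esz]. rewrite esz_powE. simpl. lia. }
  (* No rebuild: tables and [g] stay, and the new log entry accounts for the change from [f] to
     [f']. *)
  - intros Hev. apply trm_skip; auto; [lia|].
    assert (Eb : b = true) by (destruct b; auto; rewrite Hpre in Hev; lia).
    rewrite Eb in HQ. apply HQ with (g' := g); auto.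
    constructor.
    + rewrite F7 by lia. apply (p_R _ _ _ _ Hp).
    + exact T7.
    + exact Hf'.
    + apply (p_g _ _ _ _ Hp).
    + exact C7.
    + constructor.
      * lia.
      * intros U z HU Hz. rewrite T7' by auto. apply (c_table _ _ _ _ _ _ Hcnt); auto.
      * intros i z Hi Hz. rewrite C7 by auto. symmetry. apply cf_arrpol. now apply Hf'.
      * intros i Hi. replace (Z.to_nat (t + 1)) with (S (Z.to_nat t)) by lia.
        cbn [events]. rewrite Z2Nat.id, Ht4, Ht5, Ht6 by lia.
        rewrite (events_ext _ _ _ (arr s 5) (arr s 4) (arr s 6)).
        2: { intros x Hx. rewrite !Hlow by lia. auto. }
        rewrite Nussbaumer.paddA, <- (c_events _ _ _ _ _ _ Hcnt i Hi).
        destruct (Nat.eq_dec i j) as [->|Hne].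
        -- rewrite Z.eqb_refl, Z.mul_1_l. unfold arrpol. rewrite <- mkpol_update by lia.
           apply Nussbaumer.pol_ext. intros z. rewrite !cf_mkpol.
           unfold f', bump_at. now rewrite Nat.eqb_refl.
        -- replace (Z.of_nat j =? Z.of_nat i) with false by (symmetry; apply Z.eqb_neq; lia).
           rewrite Z.mul_0_l, pmono_0, Nussbaumer.padd0 by lia.
           unfold arrpol. apply Nussbaumer.pol_ext. intros z. rewrite !cf_mkpol.
           unfold f', bump_at. now apply Nat.eqb_neq in Hne as ->.
      * intros i Hi. destruct (Z.eq_dec i t) as [->|Hne].
        -- rewrite Ht4, Ht6. lia.
        -- rewrite !Hlow by lia. apply (c_range _ _ _ _ _ _ Hcnt). lia.
    + exact N7.
    + right. apply Z.ltb_lt. exact Eb.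
  (* Rebuild: the current sets become the old ones, and resetting [t] empties the log, whose stale
     entries now lie beyond its end. *)
  - intros Hev.
    assert (Eb : b = false) by (destruct b; auto; rewrite Hpre in Hev; lia).
    unfold rc. rewrite Eb in *. unfold rcost.
    assert (H2k : (0 < 2 ^ k)%nat) by (pose proof (Nat.pow_nonzero 2 k); lia).
    assert (Hpow : Z.of_nat (2 ^ k - 1) * conv_cost R <= 2 ^ Z.of_nat k * conv_cost R).
    { apply Z.mul_le_mono_nonneg_r; auto. rewrite Nat2Z.inj_sub, Nat2Z.inj_pow by lia.
      change (Z.of_nat 2) with 2. lia. }
    apply trm_bind with (n1 := Z.of_nat (2 ^ k - 1) * conv_cost R + 1)
    (n2 := 2); [|lia].
    apply trm_rebuild_upto with (f := f'); auto; try lia.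
    + rewrite F7 by lia. apply (p_R _ _ _ _ Hp).
    + intros i Hi. now apply Hf'.
    + intros i z Hi Hz. rewrite C7 by auto. symmetry. apply cf_arrpol. now apply Hf'.
    + intros z Hz. rewrite T7', (c_table _ _ _ _ _ _ Hcnt) by auto. now rewrite mask_pol_0.
    + intros U z HU Hz. rewrite T7', (c_table _ _ _ _ _ _ Hcnt) by (auto; lia).
      now apply Nussbaumer.cf_neg.
    + intros s8 Hs8 F8 A8 T8 _.
      assert (HCne : forall j U, (j < k)%nat -> (U < 2 ^ k)%nat -> tC k j <> tT U)
        by (intros; unfold tC, tT; lia).
      assert (C8 : forall i z, (i < k)%nat -> arr s8 (tC k i) z = f' i z).
      { intros i z Hi. pose proof (tC_range k Hk i Hi).
        rewrite A8; [apply C7; auto | lia | intros; apply HCne; auto]. }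
      apply trm_assign; [assumption | simpl; lia | simpl; lia | simpl; lia | ecs; lia |].
      change (ev s8 (Cst 0)) with 0.
      apply HQ with (g' := f').
      * apply small_set_reg; auto. lia.
      * constructor.
        -- rewrite set_reg_neq, F8, F7 by fr_side. apply (p_R _ _ _ _ Hp).
        -- apply set_reg_eq.
        -- exact Hf'.
        -- intros i Hi. now apply Hf'.
        -- intros i z Hi. rewrite arr_set_reg. auto.
        -- constructor.
           ++ lia.
           ++ intros U z HU Hz. rewrite arr_set_reg. apply T8; auto. lia.
           ++ intros i z Hi Hz. rewrite arr_set_reg, C8 by auto.
              symmetry. apply cf_arrpol. now apply Hf'.
           ++ intros i Hi. cbn [Z.to_nat events]. now rewrite Nussbaumer.padd0.
           ++ intros i Hi. lia.
        -- rewrite set_reg_neq, F8 by fr_side. exact N7.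
        -- auto.
Qed.

End Ops.

Section Alg.

Context {mc : Machine}.

Variable k : nat.

Definition on_change (sg : Z) : cmd :=
  15%nat ::= Cst sg ;; 16%nat ::= Var 0 -! Cst 1 ;; 14%nat ::= Var 1 ;;
  If (Var 0 =! Cst (Z.of_nat k)) (14%nat ::= Var 2 -! Var 1) Skip ;; update_c k.

Definition ksum_algorithm : algorithm := {|
  init := 2%nat ::= Var 0 ;; Wr (tT 0) (Cst 0) (Cst 1);
  on_insert := on_change 1;
  on_delete := on_change (-1);
  on_query := 0%nat ::= Cst 1 -! (Var 3 =! Cst 0)
|}.

End Alg.

Section Serve.

Context {mc : Machine}.

Let HV : 2 <= V := V_ge.
Let HM : 8 <= M <= V := M_range.
Let HK0 : (300 <= K)%nat := K_ge.

Variables (k : nat) (R : Z).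
Hypotheses (HR : 0 <= R) (Hk3 : (3 <= k)%nat) (Hk : 7 + Z.of_nat (2 ^ k + k) <= M)
  (HkK : (k + 10 <= K)%nat) (HVconv : conv_fits k R) (HkR : (Z.of_nat k + 1) * R <= V).

Local Notation D := (coef_bound k R).

(* The last set is stored reflected, so that a solution is a [k]-tuple of stored
   values with sum [R]. *)
Definition stored (j : nat) (z : Z) : Z := if Nat.eqb (S j) k then R - z else z.

Lemma stored_invol j z : stored j (stored j z) = z.
Proof. unfold stored. destruct (Nat.eqb (S j) k); lia. Qed.

Lemma stored_range j z : 0 <= z <= R -> 0 <= stored j z <= R.
Proof. unfold stored. destruct (Nat.eqb (S j) k); lia. Qed.

Definition represents (A : sets) (f : nat -> Z -> Z) : Prop :=
  forall j, (j < k)%nat ->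
    (forall z, f j z = 1 <-> 0 <= z <= R /\ A (S j) (stored j z)) /\
    (forall a, A (S j) a -> 0 <= a <= R).

Lemma fold_add_app l1 l2 :
  fold_right Z.add 0 (l1 ++ l2) = fold_right Z.add 0 l1 + fold_right Z.add 0 l2.
Proof. induction l1; simpl; lia. Qed.

Lemma Forall2_map_r (Pr : nat -> Z -> Prop) (h : nat -> Z) l :
  (forall j, In j l -> Pr j (h j)) -> Forall2 Pr l (map h l).
Proof. induction l; simpl; intros H; constructor; auto. Qed.

Lemma Forall2_seq_nth (Pr : nat -> Z -> Prop) n len xs :
  Forall2 Pr (seq n len) xs -> forall j, (j < len)%nat -> Pr (n + j)%nat (nth j xs 0).
Proof.
  revert n xs. induction len as [|len IH]; intros n xs H j Hj; [lia|].
  cbn [seq] in H. inversion H as [|? x ? xs' Hx Hxs]; subst.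
  destruct j as [|j]; simpl; [now rewrite Nat.add_0_r|].
  replace (n + S j)%nat with (S n + j)%nat by lia. apply IH; auto. lia.
Qed.

(** The reflected last set contributes [R - a k], so the stored values add up to [R] exactly when
    the first [k - 1] values add up to [a k]. *)
Lemma sum_stored (a : nat -> Z) :
  fold_right Z.add 0 (map (fun j => stored j (a (S j))) (seq 0 k))
  = fold_right Z.add 0 (map a (seq 1 (k - 1))) + R - a k.
Proof.
  replace k with (k - 1 + 1)%nat at 1 by lia.
  rewrite seq_app, map_app, fold_add_app. cbn [seq map fold_right Nat.add].
  unfold stored at 2. replace (S (k - 1)) with k by lia. rewrite Nat.eqb_refl.
  rewrite <- seq_shift, map_map.
  rewrite (map_ext_in (fun j => stored j (a (S j))) (fun j => a (S j))); [lia|].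
  intros j Hj. apply in_seq in Hj. unfold stored.
  replace (Nat.eqb (S j) k) with false; auto. symmetry. apply Nat.eqb_neq. lia.
Qed.

Lemma ksum_iff A f :
  represents A f -> (forall j, (j < k)%nat -> zero_one (f j)) ->
  has_ksum k A <-> cf (pprod (arrpol R f) (seq 0 k)) R <> 0.
Proof.
  intros Hr Hz. unfold arrpol. rewrite pprod_neq0.
  2: { intros j Hj. apply in_seq in Hj. apply Hz. lia. }
  replace (Z.of_nat (Z.to_nat R + 1)) with (R + 1) by lia. split.
  - intros (a & Ha & Hsum). exists (map (fun j => stored j (a (S j))) (seq 0 k)). split.
    + apply Forall2_map_r. intros j Hj. apply in_seq in Hj.
      destruct (Hr j ltac:(lia)) as [H1 H2].
      assert (Hj' : A (S j) (a (S j))) by (apply Ha; lia).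
      assert (Hrg : 0 <= stored j (a (S j)) <= R) by (apply stored_range; auto).
      split; [lia|]. apply H1. rewrite stored_invol. auto.
    + rewrite sum_stored. lia.
  - intros (xs & Hxs & Hsum).
    pose proof (Forall2_seq_nth _ _ _ _ Hxs) as Hn. cbn [Nat.add] in Hn.
    exists (fun i => stored (i - 1) (nth (i - 1) xs 0)). split.
    + intros i Hi. destruct (Hn (i - 1)%nat ltac:(lia)) as [_ H1].
      destruct (Hr (i - 1)%nat ltac:(lia)) as [H2 _].
      apply H2 in H1. replace (S (i - 1)) with i in H1 by lia. apply H1.
    + pose proof (sum_stored (fun i => stored (i - 1) (nth (i - 1) xs 0))) as E.
      assert (E2 : map (fun j => stored j (stored (S j - 1) (nth (S j - 1) xs 0))) (seq 0 k) = xs).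
      { pose proof (Forall2_length Hxs) as Hl. rewrite length_seq in Hl.
        apply nth_ext with (d := 0) (d' := 0).
        - now rewrite length_map, length_seq.
        - intros j Hj. rewrite length_map, length_seq in Hj.
          (* [map_nth] needs as default the image of a point, here of index 0. *)
          rewrite nth_indep with (d' := stored 0 (stored (1 - 1) (nth (1 - 1) xs 0)))
            by (rewrite length_map, length_seq; auto).
          rewrite (map_nth (fun j => stored j (stored (S j - 1) (nth (S j - 1) xs 0))) _ 0%nat).
          rewrite seq_nth by auto. cbn [Nat.add].
          replace (S j - 1)%nat with j by lia. apply stored_invol. }
      cbv beta in E. rewrite E2 in E. lia.
Qed.

(** Validity of the operation keeps the bumped value 0 or 1: an inserted element was absent, a
    deleted one present. [A'] is described up to equivalence, so that insertion and deletion are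
    treated together. *)
Lemma represents_bump A A' f i a sg :
  represents A f -> (1 <= i <= k)%nat -> 0 <= a <= R ->
  (forall j, (j < k)%nat -> zero_one (f j)) ->
  (sg = 1 /\ ~ A i a /\ (forall j b, A' j b <-> A j b \/ (j = i /\ b = a)) \/
   sg = -1 /\ A i a /\ (forall j b, A' j b <-> A j b /\ ~ (j = i /\ b = a))) ->
  let v := stored (i - 1) a in
  zero_one (bump_at f (i - 1) v sg (i - 1)) /\ represents A' (bump_at f (i - 1) v sg).
Proof.
  intros Hr Hi Ha Hz Hop v.
  destruct (Hr (i - 1)%nat ltac:(lia)) as [H1 H2].
  replace (S (i - 1)) with i in * by lia.
  assert (Hv : 0 <= v <= R) by (apply stored_range; auto).
  assert (Hfv : f (i - 1)%nat v = 1 <-> A i a).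
  { rewrite H1. unfold v. rewrite stored_invol. tauto. }
  assert (Hz1 : f (i - 1)%nat v = 0 \/ f (i - 1)%nat v = 1) by (apply Hz; lia).
  split.
  - intros z. unfold bump_at. rewrite Nat.eqb_refl. destruct (Z.eqb_spec z v) as [->|].
    + destruct Hop as [(-> & HA & _)|(-> & HA & _)].
      * right. destruct Hz1; [lia|tauto].
      * left. apply Hfv in HA. lia.
    + apply Hz. lia.
  - intros j Hj. destruct (Hr j Hj) as [J1 J2]. split.
    + intros z. unfold bump_at. destruct (Nat.eqb_spec j (i - 1)) as [->|Hne].
      * replace (S (i - 1)) with i in * by lia.
        destruct (Z.eqb_spec z v) as [->|Hzv].
        -- assert (Esv : stored (i - 1) v = a) by apply stored_invol. rewrite Esv.
           destruct Hop as [(-> & HA & HA')|(-> & HA & HA')].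
           ++ split; [|intros _; destruct Hz1; [lia|tauto]].
              intros _. split; auto. apply HA'. auto.
           ++ split; [apply Hfv in HA; lia|]. intros [_ H]. apply HA' in H. tauto.
        -- assert (Hne : stored (i - 1) z <> a).
           { intros E. apply Hzv. unfold v. now rewrite <- E, stored_invol. }
           rewrite J1. destruct Hop as [(_ & _ & HA')|(_ & _ & HA')]; rewrite HA'; tauto.
      * assert (S j <> i) by lia.
        rewrite J1. destruct Hop as [(_ & _ & HA')|(_ & _ & HA')]; rewrite HA'; tauto.
    + intros b Hb. destruct Hop as [(_ & _ & HA')|(_ & _ & HA')]; apply HA' in Hb.
      * destruct Hb as [Hb|[_ ->]]; auto.
      * apply J2. tauto.
Qed.

Lemma pinv_regs s s' t f g :
  mem s' = mem s -> (forall x, (2 <= x <= 4)%nat -> regs s' x = regs s x) ->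
  pinv k R s t f g -> pinv k R s' t f g.
Proof.
  intros Em Er [P1 P2 P3 P4 P5 P6 P7 P8].
  assert (Ea : arr s' = arr s) by (unfold arr; now rewrite Em).
  constructor; rewrite ?Er, ?Ea by lia; auto.
  apply counting_mem with s; auto.
Qed.

Definition op_cost (t : Z) : Z :=
  30 + (ucost k t + if (t + 1) ^ Z.of_nat (k - 1) <? R then 0 else rcost k R).

Lemma trm_change i a sg s t f g (Q : state -> Prop) :
  small s -> pinv k R s t f g -> (1 <= i <= k)%nat -> 0 <= a <= R -> Z.abs sg <= 1 ->
  regs s 0 = Z.of_nat i -> regs s 1 = a ->
  let v := stored (i - 1) a in
  zero_one (bump_at f (i - 1) v sg (i - 1)) ->
  D + (t + 1) ^ Z.of_nat (k - 1) * D <= V -> t + 1 <= V ->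
  (forall s' g', small s' ->
     pinv k R s' (if (t + 1) ^ Z.of_nat (k - 1) <? R then t + 1 else 0)
       (bump_at f (i - 1) v sg) g' -> Q s') ->
  trm (on_change k sg) s (op_cost t) Q.
Proof.
  intros Hs Hp Hi Ha Hsg E0 E1 v Hz Hacc HtV HQ.
  pose proof (R_lt_V k R HR Hk3 Hk HkK HkR) as HRV.
  assert (Hv : 0 <= v <= R) by (apply stored_range; auto).
  unfold on_change, op_cost.
  set (uc := ucost k t + if (t + 1) ^ Z.of_nat (k - 1) <? R then 0 else rcost k R) in *.
  apply trm_assign_seq with (n2 := 28 + uc);
    [assumption | simpl; lia | simpl; lia | simpl; lia | | ecs; lia].
  change (ev s (Cst sg)) with sg. intros Hs1. set (s1 := set_reg s 15 sg) in *.
  assert (F1 : forall x, (x < 15)%nat -> regs s1 x = regs s x)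
    by (intros; apply set_reg_neq; lia).
  assert (G1 : regs s1 15 = sg) by apply set_reg_eq.
  assert (M1 : mem s1 = mem s) by reflexivity. clearbody s1.
  assert (E2 : ev s1 (Var 0 -! Cst 1) = Z.of_nat (i - 1)).
  { simpl. rewrite F1, E0 by lia. lia. }
  apply trm_assign_seq with (n2 := 24 + uc);
    [assumption | simpl; lia | simpl; lia | rewrite E2; lia | | ecs; lia].
  rewrite E2. intros Hs2. set (s2 := set_reg s1 16 (Z.of_nat (i - 1))) in *.
  assert (F2 : forall x, (x < 15)%nat -> regs s2 x = regs s x)
    by (intros; unfold s2; rewrite set_reg_neq by lia; auto).
  assert (G2 : regs s2 15 = sg) by (unfold s2; rewrite set_reg_neq by lia; auto).
  assert (H2 : regs s2 16 = Z.of_nat (i - 1)) by apply set_reg_eq.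
  assert (M2 : mem s2 = mem s) by exact M1. clearbody s2.
  assert (E3 : ev s2 (Var 1) = a) by (simpl; rewrite F2 by lia; auto).
  apply trm_assign_seq with (n2 := 22 + uc);
    [assumption | exact I | simpl; lia | rewrite E3; lia | | ecs; lia].
  rewrite E3. intros Hs3. set (s3 := set_reg s2 14 a) in *.
  assert (F3 : forall x, (x < 14)%nat -> regs s3 x = regs s x)
    by (intros; unfold s3; rewrite set_reg_neq by lia; auto).
  assert (G3 : regs s3 15 = sg) by (unfold s3; rewrite set_reg_neq by lia; auto).
  assert (H3 : regs s3 16 = Z.of_nat (i - 1)) by (unfold s3; rewrite set_reg_neq by lia; auto).
  assert (I3 : regs s3 14 = a) by apply set_reg_eq.
  assert (M3 : mem s3 = mem s) by exact M2. clearbody s3.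
  eapply trm_seq_le with (n1 := 14) (n2 := uc)
    (Q1 := fun s' => mem s' = mem s /\ (forall x, (x < 14)%nat -> regs s' x = regs s x) /\
       regs s' 15 = sg /\ regs s' 16 = Z.of_nat (i - 1) /\ regs s' 14 = v); [| |lia].
  - replace 14 with (1 + ec (Var 0 =! Cst (Z.of_nat k)) + 10) by (ecs; lia).
    apply trm_if; auto; [simpl; repeat split; lia | simpl; lia | |]; intros Hev;
      simpl in Hev; rewrite F3, E0 in Hev by lia.
    + destruct (Z.eqb_spec (Z.of_nat i) (Z.of_nat k)) as [E|]; [|lia].
      assert (Ev : v = R - a).
      { unfold v, stored. replace (Nat.eqb (S (i - 1)) k) with true; auto.
        symmetry. apply Nat.eqb_eq. lia. }
      assert (E4 : ev s3 (Var 2 -! Var 1) = v).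
      { simpl. rewrite !F3, E1, (p_R _ _ _ _ _ _ Hp) by lia. auto. }
      apply trm_assign; [assumption | simpl; auto | simpl; lia | rewrite E4; lia | ecs; lia |].
      rewrite E4. conjs.
      * exact M3.
      * intros x Hx. rewrite set_reg_neq by lia. auto.
      * rewrite set_reg_neq by lia. auto.
      * rewrite set_reg_neq by lia. auto.
      * apply set_reg_eq.
    + destruct (Z.eqb_spec (Z.of_nat i) (Z.of_nat k)) as [|E]; [lia|].
      apply trm_skip; auto; [lia|]. conjs; auto.
      unfold v, stored. replace (Nat.eqb (S (i - 1)) k) with false; auto.
      symmetry. apply Nat.eqb_neq. lia.
  - intros s4 Hs4 (M4 & F4 & G4 & H4 & I4).
    apply trm_update with (R := R) (j := (i - 1)%nat) (v := v) (sg := sg) (f := f) (g := g);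
      auto; try lia.
    apply pinv_regs with s; auto. intros x Hx. apply F4. lia.
Qed.

Lemma represents_empty : represents empty_sets (fun _ _ => 0).
Proof.
  intros j Hj. split.
  - intros z. split; [lia|]. intros [_ []].
  - intros a [].
Qed.

Lemma arrpol_zero j : arrpol R (fun _ _ => 0) j = pzero.
Proof.
  apply Nussbaumer.pol_ext. intros z. unfold arrpol.
  rewrite cf_mkpol, Nussbaumer.cf_zero.
  now destruct ((0 <=? z) && (z <? Z.of_nat (Z.to_nat R + 1)))%bool.
Qed.

(** With all sets empty every product over a nonempty mask is zero, as is the memory; only the
    coefficient 1 of the empty product has to be written. Initialisation is thus independent of
    [rmax]. *)
Lemma trm_init s : R <= V -> s = set_reg zero_state 0 R ->
  trm (init (ksum_algorithm k)) s 20
    (fun s' => pinv k R s' 0 (fun _ _ => 0) (fun _ _ => 0)).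
Proof.
  intros HRV Es. cbn [init ksum_algorithm].
  assert (Hs : small s).
  { subst s. apply small_set_reg; [|lia]. split; simpl; intros; lia. }
  assert (H2k : (0 < 2 ^ k)%nat) by (pose proof (Nat.pow_nonzero 2 k); lia).
  pose proof (tT_range k Hk 0 H2k) as HT.
  assert (E0 : ev s (Var 0) = R) by (subst s; reflexivity).
  apply trm_assign_seq with (n2 := 18);
    [assumption | exact I | simpl; lia | rewrite E0; lia | | ecs; lia].
  rewrite E0. intros Hs1.
  apply trm_wr; [assumption | lia | simpl; lia | simpl; lia | simpl; lia | simpl; lia
    | simpl; lia | ecs; lia |].
  change (ev (set_reg s 2 R) (Cst 0)) with 0. change (ev (set_reg s 2 R) (Cst 1)) with 1.
  set (s' := set_mem (set_reg s 2 R) (0 * M + tT 0) 1).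
  assert (A' : forall tau z, 0 <= tau < M ->
    arr s' tau z = if ((tau =? tT 0) && (z =? 0))%bool then 1 else 0).
  { intros tau z Ht. unfold s'. rewrite arr_set_mem by lia. subst s.
    destruct ((tau =? tT 0) && (z =? 0))%bool; reflexivity. }
  assert (Hz : zero_one (fun _ : Z => 0)) by (intros z; auto).
  constructor; try (subst s; reflexivity); auto.
  - intros j z Hj. pose proof (tC_range k Hk j Hj). rewrite A' by lia.
    replace (tC k j =? tT 0) with false; auto.
    symmetry. apply Z.eqb_neq. unfold tC, tT. lia.
  - constructor.
    + lia.
    + intros U z HU _. pose proof (tT_range k Hk U HU). rewrite A' by lia.
      destruct (Nat.eq_dec U 0) as [->|HU0].
      * rewrite Z.eqb_refl, mask_pol_0, Nussbaumer.cf_one. reflexivity.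
      * replace (tT U =? tT 0) with false by (symmetry; apply Z.eqb_neq; unfold tT; lia).
        rewrite (mask_pol_zero k _ U (Nat.log2 U)).
        -- cbn [andb]. now rewrite Nussbaumer.cf_zero.
        -- apply Nat.log2_lt_pow2; lia.
        -- now apply Nat.bit_log2.
        -- apply arrpol_zero.
    + intros j z Hj _. pose proof (tC_range k Hk j Hj). rewrite A' by lia.
      replace (tC k j =? tT 0) with false by (symmetry; apply Z.eqb_neq; unfold tC, tT; lia).
      rewrite arrpol_zero, Nussbaumer.cf_zero. reflexivity.
    + intros j Hj. cbn [Z.to_nat events]. now rewrite Nussbaumer.padd0.
    + intros i Hi. lia.
  - transitivity 0; [subst s; reflexivity|].
    rewrite (pprod_split _ 0%nat) by (auto using seq_NoDup; apply in_seq; lia).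
    now rewrite arrpol_zero, Nussbaumer.pmul0, Nussbaumer.cf_zero.
Qed.

Lemma trm_query s t f g :
  small s -> pinv k R s t f g ->
  trm (on_query (ksum_algorithm k)) s 6
    (fun s' => pinv k R s' t f g /\
       regs s' 0 = 1 - (if cf (pprod (arrpol R f) (seq 0 k)) R =? 0 then 1 else 0)).
Proof.
  intros Hs Hp. cbn [on_query ksum_algorithm].
  assert (E : ev s (Cst 1 -! (Var 3 =! Cst 0))
    = 1 - (if cf (pprod (arrpol R f) (seq 0 k)) R =? 0 then 1 else 0)).
  { simpl. now rewrite (p_count _ _ _ _ _ _ Hp). }
  apply trm_assign; [assumption | simpl; lia | simpl; lia | | ecs; lia |]; rewrite E.
  - destruct (cf (pprod (arrpol R f) (seq 0 k)) R =? 0); lia.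
  - split; [|apply set_reg_eq].
    apply pinv_regs with s; auto. intros x Hx. apply set_reg_neq. lia.
Qed.

(* Every logged update has paid [K2] towards the next rebuild. *)
Lemma serve_ok mtot (K1 K2 : Rdefinitions.R) :
  (forall t, 0 <= t < mtot -> D + (t + 1) ^ Z.of_nat (k - 1) * D <= V /\ t + 1 <= V) ->
  (forall t, 0 <= t < mtot -> t = 0 \/ t ^ Z.of_nat (k - 1) < R ->
     (IZR (30 + ucost k t) <= K1)%R) ->
  (forall t, 0 <= t < mtot -> R <= (t + 1) ^ Z.of_nat (k - 1) ->
     (IZR (rcost k R) <= K2 * IZR (t + 1))%R) ->
  (6 <= K1)%R -> (0 <= K2)%R -> R <= V -> Z.of_nat k <= V ->
  forall oprs A s t f g,
  small s -> pinv k R s t f g -> represents A f -> valid_ops k R A oprs ->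
  t + Z.of_nat (length oprs) <= mtot ->
  exists n, serve word_size k (ksum_algorithm k) A s oprs n /\
    (INR n <= INR (length oprs) * (K1 + K2) + IZR t * K2)%R.
Proof.
  intros Hacc HK1 HK2 H6 HK20 HRV HkV.
  (* Insertion and deletion share this argument; the induction hypothesis is a premise so that it
     can precede the induction. *)
  assert (Hmain : forall oprs, (forall A s t f g,
    small s -> pinv k R s t f g -> represents A f -> valid_ops k R A oprs ->
    t + Z.of_nat (length oprs) <= mtot ->
    exists n, serve word_size k (ksum_algorithm k) A s oprs n /\
      (INR n <= INR (length oprs) * (K1 + K2) + IZR t * K2)%R) ->
    forall A A' s t f g i a sg,
    small s -> pinv k R s t f g -> represents A f -> valid_ops k R A' oprs ->
    t + 1 + Z.of_nat (length oprs) <= mtot ->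
    (1 <= i <= k)%nat -> 0 <= a <= R ->
    (sg = 1 /\ ~ A i a /\ (forall j b, A' j b <-> A j b \/ (j = i /\ b = a)) \/
     sg = -1 /\ A i a /\ (forall j b, A' j b <-> A j b /\ ~ (j = i /\ b = a))) ->
    exists n s' m,
      exec word_size (on_change k sg) (set_reg (set_reg s 0 (Z.of_nat i)) 1 a) n s' /\
      serve word_size k (ksum_algorithm k) A' s' oprs m /\
      (INR (n + m) <= (INR (length oprs) + 1) * (K1 + K2) + IZR t * K2)%R).
  { intros oprs IH A A' s t f g i a sg Hs Hp Hr Hv Hm Hi Ha Hop.
    assert (Hz : forall j, (j < k)%nat -> zero_one (f j))
      by (intros j Hj; apply (p_f _ _ _ _ _ _ Hp j Hj)).
    destruct (represents_bump A A' f i a sg Hr Hi Ha Hz Hop) as [Hz' Hr'].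
    assert (Ht0 : 0 <= t) by apply (c_t _ _ _ _ _ _ (p_counting _ _ _ _ _ _ Hp)).
    destruct (Hacc t ltac:(lia)) as [Ac1 Ac2].
    set (b := (t + 1) ^ Z.of_nat (k - 1) <? R).
    assert (Ht : trm (on_change k sg) (set_reg (set_reg s 0 (Z.of_nat i)) 1 a) (op_cost t)
      (fun s' => exists g', pinv k R s' (if b then t + 1 else 0)
         (bump_at f (i - 1) (stored (i - 1) a) sg) g')).
    { apply trm_change with (i := i) (a := a) (f := f) (g := g); auto; try lia.
      - apply small_set_reg; [apply small_set_reg; auto|]; lia.
      - apply pinv_regs with s; auto. intros x Hx. now rewrite !set_reg_neq by lia.
      - intros s' g' _ Hp'. exists g'. exact Hp'. }
    destruct Ht as (n & s' & He & Hn & Hs' & g' & Hp').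
    destruct (IH A' s' (if b then t + 1 else 0) _ g' Hs' Hp' Hr' Hv) as (m & Hserve & Hcost).
    { destruct b; lia. }
    exists n, s', m. split; auto. split; auto.
    rewrite plus_INR.
    assert (Hn' : (INR n <= IZR (op_cost t))%R) by (rewrite INR_IZR_INZ; now apply IZR_le).
    unfold op_cost in Hn'. fold b in Hn'. rewrite Z.add_assoc, plus_IZR in Hn'.
    pose proof (HK1 t ltac:(lia) (p_lt _ _ _ _ _ _ Hp)) as B1.
    (* Without a rebuild the credit [t * K2] grows by [K2]. A rebuild costs at most [K2 * (t + 1)],
       the credit plus the share of this update, and resets [t] to 0. *)
    destruct b eqn:Eb.
    - rewrite plus_IZR in Hcost. simpl (IZR 0) in *. lra.
    - assert (Hge : R <= (t + 1) ^ Z.of_nat (k - 1)) by (apply Z.ltb_ge; exact Eb).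
      pose proof (HK2 t ltac:(lia) Hge) as B2. rewrite plus_IZR in B2.
      simpl (IZR 0) in *. lra. }
  induction oprs as [|o oprs IH]; intros A s t f g Hs Hp Hr Hv Hm.
  - exists 0%nat. split; [constructor|]. simpl.
    assert (Ht0 : 0 <= t) by apply (c_t _ _ _ _ _ _ (p_counting _ _ _ _ _ _ Hp)).
    apply IZR_le in Ht0. pose proof (Rmult_le_pos _ _ Ht0 HK20). lra.
  - destruct Hv as [Ho Hv]. cbn [length] in *.
    assert (Hm' : t + 1 + Z.of_nat (length oprs) <= mtot) by lia. rewrite S_INR.
    destruct o as [i a|i a|].
    + destruct Ho as (Hi & Ha & HA).
      destruct (Hmain oprs IH A (update A (Insert i a)) s t f g i a 1) as
        (n & s' & m & H1 & H2 & H3); auto.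
      { left. split; [reflexivity|]. split; [exact HA|]. intros; reflexivity. }
      exists (n + m)%nat. split; [econstructor; eauto | exact H3].
    + destruct Ho as (Hi & HA).
      assert (Ha : 0 <= a <= R).
      { destruct (Hr (i - 1)%nat ltac:(lia)) as [_ H2].
        replace (S (i - 1)) with i in H2 by lia. auto. }
      destruct (Hmain oprs IH A (update A (Delete i a)) s t f g i a (-1)) as
        (n & s' & m & H1 & H2 & H3); auto.
      { right. split; [reflexivity|]. split; [exact HA|]. intros; reflexivity. }
      exists (n + m)%nat. split; [econstructor; eauto | exact H3].
    + destruct (trm_query s t f g Hs Hp) as (n & s' & He & Hn & Hs' & Hp' & E0).
      destruct (IH A s' t f g Hs' Hp' Hr Hv) as (m & Hserve & Hcost); [lia|].
      exists (n + m)%nat. split.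
      * econstructor; eauto.
        assert (Hz : forall j, (j < k)%nat -> zero_one (f j))
          by (intros j Hj; apply (p_f _ _ _ _ _ _ Hp j Hj)).
        rewrite (ksum_iff A f Hr Hz).
        destruct (Z.eqb_spec (cf (pprod (arrpol R f) (seq 0 k)) R) 0) as [E|E]; rewrite E0.
        -- right. split; auto.
        -- left. split; auto.
      * rewrite plus_INR.
        assert (Hn' : (INR n <= 6)%R) by (rewrite INR_IZR_INZ; now apply IZR_le).
        lra.
Qed.

End Serve.

(** * Choice of the word size and final bounds *)

Definition narrays (k : nat) : Z := 7 + Z.of_nat (2 ^ k + k).
(** The exponent comes from [conv_fits]: with [D <= X^k] and [P <= X^12], the number
    [2 * (D * P)^2 * P] is at most [X^(1 + 2 * (k + 12) + 12)]. *)
Definition value_bound (k : nat) (X : Z) : Z := X ^ Z.of_nat (2 * k + 37).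
Definition max_size (k : nat) : nat := (300 + 2 * k)%nat.

Lemma pow_ge1 X n : 3 <= X -> 1 <= X ^ Z.of_nat n.
Proof. intros. assert (0 < X ^ Z.of_nat n) by (apply Z.pow_pos_nonneg; lia). lia. Qed.

Lemma Zpow_le_exp X a b : 3 <= X -> (a <= b)%nat -> X ^ Z.of_nat a <= X ^ Z.of_nat b.
Proof. intros. apply Z.pow_le_mono_r; lia. Qed.

Lemma pow_addn X a b : X ^ Z.of_nat (a + b) = X ^ Z.of_nat a * X ^ Z.of_nat b.
Proof. rewrite Nat2Z.inj_add, Z.pow_add_r by lia. reflexivity. Qed.

Lemma two_pow_nat k : Z.of_nat (2 ^ k) = 2 ^ Z.of_nat k.
Proof. now rewrite Nat2Z.inj_pow. Qed.

Lemma narrays_range k X : (3 <= k)%nat -> 3 <= X -> 8 <= narrays k <= value_bound k X.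
Proof.
  intros Hk HX. unfold narrays.
  pose proof (Nat.pow_gt_lin_r 2 k ltac:(lia)) as Hlin.
  split; [lia|].
  assert (H2 : Z.of_nat (2 ^ k) <= X ^ Z.of_nat k).
  { rewrite two_pow_nat. apply Z.pow_le_mono_l. lia. }
  apply Z.le_trans with (X ^ Z.of_nat (2 + k)); [|apply Zpow_le_exp; lia].
  rewrite pow_addn. change (X ^ Z.of_nat 2) with (X * (X * 1)).
  assert (9 <= X * (X * 1)) by nia.
  assert (9 * X ^ Z.of_nat k <= X * (X * 1) * X ^ Z.of_nat k)
    by (apply Z.mul_le_mono_nonneg_r; [apply Z.pow_nonneg|]; lia).
  lia.
Qed.

Lemma word_size_ok k X w :
  3 <= X ->
  Z.of_nat ((2 * k + 37) * max_size k + 1) * Z.log2_up X <= w ->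
  value_bound k X ^ Z.of_nat (max_size k) < 2 ^ (w - 1).
Proof.
  intros HX Hw. unfold value_bound.
  assert (Hl : 2 <= Z.log2_up X).
  { apply Z.le_trans with (Z.log2_up 3); [reflexivity | apply Z.log2_up_le_mono; lia]. }
  assert (HXl : X <= 2 ^ Z.log2_up X) by (apply Z.log2_up_spec; lia).
  set (l := Z.log2_up X) in *.
  rewrite <- Z.pow_mul_r by lia. rewrite <- Nat2Z.inj_mul.
  set (e := ((2 * k + 37) * max_size k)%nat) in *.
  apply Z.le_lt_trans with ((2 ^ l) ^ Z.of_nat e).
  - apply Z.pow_le_mono_l. lia.
  - rewrite <- Z.pow_mul_r by lia. apply Z.pow_lt_mono_r; [lia| |].
    + nia.
    + rewrite Nat2Z.inj_add in Hw. change (Z.of_nat 1) with 1 in Hw. lia.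
Qed.

Section Instance.

Variables (k : nat) (X w : Z).
Hypotheses (Hk : (3 <= k)%nat) (HX : 3 <= X)
  (Hw : Z.of_nat ((2 * k + 37) * max_size k + 1) * Z.log2_up X <= w).

Lemma value_bound_ge2 : 2 <= value_bound k X.
Proof.
  unfold value_bound. apply Z.le_trans with (X ^ Z.of_nat 1); [|apply Zpow_le_exp; lia].
  change (Z.of_nat 1) with 1. rewrite Z.pow_1_r. lia.
Qed.

Lemma max_size_ge : (300 <= max_size k)%nat.
Proof. unfold max_size. lia. Qed.

Definition ksum_machine : Machine := {|
  word_size := w; V := value_bound k X; M := narrays k; K := max_size k;
  V_ge := value_bound_ge2; M_range := narrays_range k X Hk HX;
  K_ge := max_size_ge; word_fits := word_size_ok k X w HX Hw
|}.

End Instance.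

(* Programs depend on the machine only through the number of arrays, hence the
   choice of [X] and [w] here is immaterial. *)
Definition the_algorithm (k : nat) (Hk : (3 <= k)%nat) : algorithm :=
  @ksum_algorithm
    (ksum_machine k 3 (Z.of_nat ((2 * k + 37) * max_size k + 1) * Z.log2_up 3)
       Hk (Z.le_refl 3) (Z.le_refl _)) k.

Lemma the_algorithm_eq k Hk X w HX Hw :
  @ksum_algorithm (ksum_machine k X w Hk HX Hw) k = the_algorithm k Hk.
Proof. reflexivity. Qed.

Lemma coef_bound_le k X R : 0 <= R -> R + 1 <= X -> coef_bound k R <= X ^ Z.of_nat k.
Proof. intros. unfold coef_bound. apply Z.pow_le_mono_l. lia. Qed.

Lemma conv_fits_ok k X w Hk HX Hw R :
  0 <= R -> R + 3 <= X -> @conv_fits (ksum_machine k X w Hk HX Hw) k R.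
Proof.
  intros HR HRX. unfold conv_fits. cbn [V ksum_machine]. unfold value_bound.
  set (D := coef_bound k R). set (P := (4 * R + 4) ^ 4).
  assert (HD : 0 <= D <= X ^ Z.of_nat k).
  { split; [unfold D, coef_bound; apply Z.pow_nonneg; lia | apply coef_bound_le; lia]. }
  assert (HP : 0 <= P <= X ^ Z.of_nat 12).
  { unfold P. split; [apply Z.pow_nonneg; lia|].
    change (Z.of_nat 12) with (3 * 4). rewrite Z.pow_mul_r by lia.
    apply Z.pow_le_mono_l. split; [lia|].
    replace (X ^ 3) with (X * X * X) by ring.
    assert (9 <= X * X) by nia.
    assert (9 * X <= X * X * X) by (apply Z.mul_le_mono_nonneg_r; lia). lia. }
  assert (HDP : 0 <= D * P <= X ^ Z.of_nat (k + 12)).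
  { rewrite pow_addn. split; [apply Z.mul_nonneg_nonneg | apply Z.mul_le_mono_nonneg]; lia. }
  replace (2 * k + 37)%nat with (1 + ((k + 12) + (k + 12)) + 12)%nat by lia.
  rewrite (pow_addn X (1 + (k + 12 + (k + 12))) 12), (pow_addn X 1 (k + 12 + (k + 12))),
    (pow_addn X (k + 12) (k + 12)).
  change (X ^ Z.of_nat 1) with (X * 1).
  assert (0 <= D * P * (D * P) <= X ^ Z.of_nat (k + 12) * X ^ Z.of_nat (k + 12)).
  { split; [apply Z.mul_nonneg_nonneg | apply Z.mul_le_mono_nonneg]; lia. }
  apply Z.mul_le_mono_nonneg; try lia.
  apply Z.mul_le_mono_nonneg; lia.
Qed.

Lemma kR_fits k X R :
  (3 <= k)%nat -> 3 <= X -> 0 <= R -> R + 3 <= X -> (Z.of_nat k + 1) * R <= value_bound k X.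
Proof.
  intros Hk HX HR HRX. pose proof (Nat.pow_gt_lin_r 2 k ltac:(lia)) as Hlin.
  unfold value_bound. apply Z.le_trans with (X ^ Z.of_nat (k + 1)); [|apply Zpow_le_exp; lia].
  rewrite pow_addn. change (X ^ Z.of_nat 1) with (X * 1).
  assert (Z.of_nat (2 ^ k) <= X ^ Z.of_nat k).
  { rewrite two_pow_nat. apply Z.pow_le_mono_l. lia. }
  apply Z.mul_le_mono_nonneg; lia.
Qed.

Lemma acc_fits k X R t :
  (3 <= k)%nat -> 3 <= X -> 0 <= R -> R + 3 <= X -> 0 <= t -> t + 1 <= X ->
  coef_bound k R + (t + 1) ^ Z.of_nat (k - 1) * coef_bound k R <= value_bound k X /\
  t + 1 <= value_bound k X.
Proof.
  intros Hk HX HR HRX Ht HtX. unfold value_bound.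
  pose proof (coef_bound_le k X R HR ltac:(lia)) as HD.
  assert (HD0 : 0 <= coef_bound k R) by (unfold coef_bound; apply Z.pow_nonneg; lia).
  assert (Hp : (t + 1) ^ Z.of_nat (k - 1) <= X ^ Z.of_nat (k - 1))
    by (apply Z.pow_le_mono_l; lia).
  assert (Hp0 : 0 <= (t + 1) ^ Z.of_nat (k - 1)) by (apply Z.pow_nonneg; lia).
  pose proof (pow_ge1 X (k - 1) HX) as H1. pose proof (pow_ge1 X k HX) as H2.
  split.
  - apply Z.le_trans with (X ^ Z.of_nat (1 + ((k - 1) + k))); [|apply Zpow_le_exp; lia].
    rewrite (pow_addn X 1), pow_addn. change (X ^ Z.of_nat 1) with (X * 1).
    assert ((t + 1) ^ Z.of_nat (k - 1) * coef_bound k R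
            <= X ^ Z.of_nat (k - 1) * X ^ Z.of_nat k)
      by (apply Z.mul_le_mono_nonneg; lia).
    set (A := X ^ Z.of_nat (k - 1)) in *. set (B := X ^ Z.of_nat k) in *.
    assert (1 * B <= A * B) by (apply Z.mul_le_mono_nonneg_r; lia).
    assert (2 * (A * B) <= X * 1 * (A * B)) by (apply Z.mul_le_mono_nonneg_r; lia).
    lia.
  - apply Z.le_trans with (X ^ Z.of_nat 1); [|apply Zpow_le_exp; lia].
    change (X ^ Z.of_nat 1) with (X * 1). lia.
Qed.

(** * The bounds in real numbers *)

Open Scope R_scope.

Lemma ln_3_ge1 : 1 <= ln 3.
Proof.
  rewrite <- (ln_exp 1). destruct exp_le_3 as [H | ->]; [|lra].
  left. apply ln_increasing; auto using exp_pos.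
Qed.

Lemma ln_ge1 x : 3 <= x -> 1 <= ln x.
Proof.
  intros Hx. apply Rle_trans with (ln 3); [apply ln_3_ge1|].
  destruct Hx as [Hx | ->]; [left; apply ln_increasing; lra | lra].
Qed.

Lemma ln_le x y : 0 < x -> x <= y -> ln x <= ln y.
Proof. intros Hx [H | ->]; [left; now apply ln_increasing | lra]. Qed.

Lemma IZR_pow z n : IZR (z ^ Z.of_nat n) = IZR z ^ n.
Proof. symmetry. apply pow_IZR. Qed.

(** [ln 2 > 1/2] bounds the binary logarithm by twice the natural one, and the cube contributes the
    factor 3. *)
Lemma log2_ln n X : (1 <= n)%Z -> (3 <= X)%Z -> (n <= X ^ 3)%Z ->
  IZR (Z.log2 n) <= 6 * ln (IZR X).
Proof.
  intros Hn HX Hle.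
  pose proof (Z.log2_nonneg n) as H0.
  assert (H1 : (2 ^ Z.log2 n <= X ^ 3)%Z) by (pose proof (Z.log2_spec n ltac:(lia)); lia).
  rewrite <- (Z2Nat.id (Z.log2 n)) in * by auto.
  set (l := Z.to_nat (Z.log2 n)) in *.
  apply IZR_le in H1. change 3%Z with (Z.of_nat 3) in H1. rewrite !IZR_pow in H1.
  assert (HXr : 3 <= IZR X) by (apply IZR_le; auto).
  assert (H2 : ln (2 ^ l) <= ln (IZR X ^ 3)).
  { apply ln_le; auto. apply pow_lt. lra. }
  rewrite !ln_pow in H2 by lra. rewrite <- INR_IZR_INZ.
  pose proof ln_lt_2. pose proof (pos_INR l).
  assert (INR l * (/ 2) <= INR l * ln 2) by (apply Rmult_le_compat_l; lra).
  simpl (INR 3) in H2. lra.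
Qed.

Section Bounds.

Variables (k : nat) (rmax : Z) (oprs : list operation).
Hypotheses (Hk : (3 <= k)%nat) (HR : (0 <= rmax)%Z) (Hne : oprs <> nil).

Let m := length oprs.
Let beta := ksum_bound k rmax oprs.
Let L := ln (IZR (param rmax oprs)).
Let Mx := IZR (Z.max 1 rmax).

Lemma m_ge1 : (1 <= m)%nat.
Proof. unfold m. destruct oprs; [congruence | simpl; lia]. Qed.

Lemma param_ge : (rmax + 3 <= param rmax oprs)%Z.
Proof. pose proof m_ge1. unfold param. fold m. lia. Qed.

Lemma L_ge1 : 1 <= L.
Proof. apply ln_ge1. apply IZR_le. pose proof param_ge. lia. Qed.

Lemma Mx_ge1 : 1 <= Mx.
Proof. apply IZR_le. lia. Qed.

Lemma ratio_pos : 0 < INR (k - 2) / INR (k - 1).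
Proof. apply Rdiv_lt_0_compat; apply lt_0_INR; lia. Qed.

Lemma Mx_power_ge1 : 1 <= Rpower Mx (INR (k - 2) / INR (k - 1)).
Proof.
  pose proof Mx_ge1. pose proof ratio_pos.
  rewrite <- (Rpower_O Mx) by lra. apply Rle_Rpower; lra.
Qed.

(** Lets additive constants be absorbed into multiples of the claimed bound. *)
Lemma beta_ge1 : 1 <= beta.
Proof.
  unfold beta, ksum_bound. apply Rmin_glb.
  - apply pow_R1_Rle. fold m. replace 1 with (INR 1) by reflexivity. apply le_INR, m_ge1.
  - apply Mx_power_ge1.
Qed.

(* [x ^ (k-2) = (x ^ (k-1)) ^ ((k-2)/(k-1))] *)
Lemma pow_ratio x : 0 < x ->
  x ^ (k - 2) = Rpower (x ^ (k - 1)) (INR (k - 2) / INR (k - 1)).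
Proof.
  intros Hx. rewrite <- !Rpower_pow by auto. rewrite Rpower_mult. f_equal.
  field. apply not_0_INR. lia.
Qed.

(** One argument per term of the minimum: [t + 1 <= m] gives [m^(k-2)], and [t^(k-1) < rmax] gives
    [t^(k-2)] below the root term. Passing from [t + 1] to [2 t] costs [2^(k-2)]. *)
Lemma step_bound t :
  (0 <= t < Z.of_nat m)%Z -> t = 0%Z \/ (t ^ Z.of_nat (k - 1) < rmax)%Z ->
  IZR (t + 1) ^ (k - 2) <= 2 ^ (k - 2) * beta.
Proof.
  intros Ht Hlt. pose proof beta_ge1 as Hb.
  assert (H2 : 1 <= 2 ^ (k - 2)) by (apply pow_R1_Rle; lra).
  unfold beta, ksum_bound. fold m.
  apply Rmin_case.
  - apply Rle_trans with (1 * INR m ^ (k - 2)).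
    + rewrite Rmult_1_l. apply pow_incr. split; [apply IZR_le; lia|].
      rewrite INR_IZR_INZ. apply IZR_le. lia.
    + apply Rmult_le_compat_r; auto. apply pow_le, pos_INR.
  - fold Mx. pose proof Mx_power_ge1 as Hp. destruct Hlt as [-> | Hlt].
    + change (IZR (0 + 1)) with 1. rewrite pow1.
      rewrite <- (Rmult_1_r 1). apply Rmult_le_compat; lra.
    + destruct (Z.eq_dec t 0) as [->|Ht0].
      { change (IZR (0 + 1)) with 1. rewrite pow1.
        rewrite <- (Rmult_1_r 1). apply Rmult_le_compat; lra. }
      assert (Ht1 : 1 <= IZR t) by (apply IZR_le; lia).
      apply Rle_trans with ((2 * IZR t) ^ (k - 2)).
      * apply pow_incr. rewrite plus_IZR. lra.
      * rewrite Rpow_mult_distr. apply Rmult_le_compat_l; [lra|].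
        rewrite (pow_ratio (IZR t)) by lra. apply Rle_Rpower_l.
        -- pose proof ratio_pos. lra.
        -- split; [apply pow_lt; lra|]. rewrite <- IZR_pow. apply IZR_le. lia.
Qed.

(** For the first term, [u^(k-1) = u^(k-2) * u] and [u <= m]. For the second, [Mx] is its power
    [(k-2)/(k-1)] times its power [1/(k-1)], and the latter is at most [u]. *)
Lemma rebuild_bound u :
  (1 <= u <= Z.of_nat m)%Z -> (rmax <= u ^ Z.of_nat (k - 1))%Z -> Mx <= beta * IZR u.
Proof.
  intros Hu Hge.
  assert (Hu1 : 1 <= IZR u) by (apply IZR_le; lia).
  assert (Hge' : Mx <= IZR u ^ (k - 1)).
  { rewrite <- IZR_pow. apply IZR_le.
    assert (0 < u ^ Z.of_nat (k - 1))%Z by (apply Z.pow_pos_nonneg; lia). lia. }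
  pose proof Mx_ge1 as HM1.
  unfold beta, ksum_bound. fold m Mx. apply Rmin_case.
  - apply Rle_trans with (1 := Hge').
    replace (k - 1)%nat with (S (k - 2)) by lia. rewrite <- tech_pow_Rmult, Rmult_comm.
    apply Rmult_le_compat_r; [lra|]. apply pow_incr. split; [lra|].
    rewrite INR_IZR_INZ. apply IZR_le. lia.
  - assert (Hk1 : INR (k - 1) = INR (k - 2) + 1)
      by (replace (k - 1)%nat with (S (k - 2)) by lia; apply S_INR).
    pose proof (pos_INR (k - 2)) as Hk2.
    assert (E : Mx = Rpower Mx (INR (k - 2) / INR (k - 1)) * Rpower Mx (/ INR (k - 1))).
    { rewrite <- Rpower_plus.
      replace (INR (k - 2) / INR (k - 1) + / INR (k - 1)) with 1 by (rewrite Hk1; field; lra).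
      now rewrite Rpower_1 by lra. }
    rewrite E at 1. apply Rmult_le_compat_l; [left; apply exp_pos|].
    apply Rle_trans with (Rpower (IZR u ^ (k - 1)) (/ INR (k - 1))).
    + apply Rle_Rpower_l; [left; apply Rinv_0_lt_compat; lra | lra].
    + rewrite <- Rpower_pow, Rpower_mult by lra. rewrite Rinv_r by lra.
      rewrite Rpower_1 by lra. lra.
Qed.

(** From [4 * rmax + 4 <= 8 * Mx] and a logarithm plus 3 of at most [9 * L]:
    [5000 * 8 * 9^3 = 29160000], rounded up. *)
Lemma conv_cost_bound : IZR (conv_cost rmax) <= 30000000 * L ^ 3 * Mx.
Proof.
  unfold conv_cost. rewrite !mult_IZR. change 3%Z with (Z.of_nat 3) at 2. rewrite IZR_pow.
  rewrite (plus_IZR (Z.log2 _)). pose proof param_ge as Hpar. pose proof L_ge1 as HL. pose proof Mx_ge1 as HM.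
  assert (Hlog : IZR (Z.log2 (4 * rmax + 4)) <= 6 * L).
  { apply log2_ln; try lia. set (X := param rmax oprs) in *.
    replace (X ^ 3)%Z with (X * X * X)%Z by ring.
    assert (9 <= X * X)%Z by nia.
    assert (9 * X <= X * X * X)%Z by (apply Z.mul_le_mono_nonneg_r; lia). lia. }
  assert (H8 : IZR (4 * rmax + 4) <= 8 * Mx).
  { unfold Mx. rewrite <- mult_IZR. apply IZR_le. lia. }
  assert (H80 : 0 <= IZR (4 * rmax + 4)) by (apply IZR_le; lia).
  assert (Hl0 : 0 <= IZR (Z.log2 (4 * rmax + 4))) by (apply IZR_le, Z.log2_nonneg).
  assert (H9 : (IZR (Z.log2 (4 * rmax + 4)) + 3) ^ 3 <= (9 * L) ^ 3)
    by (apply pow_incr; lra).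
  apply Rle_trans with (5000 * (8 * Mx) * (9 * L) ^ 3).
  - apply Rmult_le_compat; [| apply pow_le; lra | | exact H9].
    + apply Rmult_le_pos; lra.
    + apply Rmult_le_compat_l; lra.
  - rewrite Rpow_mult_distr.
    assert (0 <= L ^ 3 * Mx) by (apply Rmult_le_pos; [apply pow_le|]; lra).
    replace (5000 * (8 * Mx) * (9 ^ 3 * L ^ 3)) with (29160000 * (L ^ 3 * Mx)) by ring.
    replace (30000000 * L ^ 3 * Mx) with (30000000 * (L ^ 3 * Mx)) by ring. lra.
Qed.

Definition step_const : R :=
  2 ^ (k - 2) * (100 * (INR (k - 1) * INR (k - 1))) + 20 * INR k + 180.

Definition rebuild_const : R := 2 ^ k * 30000000 + 10.

Lemma step_const_ge : 180 <= step_const.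
Proof.
  unfold step_const. pose proof (pos_INR k). pose proof (pos_INR (k - 1)).
  assert (0 <= 2 ^ (k - 2)) by (apply pow_le; lra).
  assert (0 <= 2 ^ (k - 2) * (100 * (INR (k - 1) * INR (k - 1)))).
  { apply Rmult_le_pos; auto. apply Rmult_le_pos; [lra|]. now apply Rmult_le_pos. }
  lra.
Qed.

Lemma rebuild_const_pos : 0 <= rebuild_const.
Proof. unfold rebuild_const. pose proof (pow_lt 2 k ltac:(lra)). lra. Qed.

Lemma ucost_bound t :
  (0 <= t < Z.of_nat m)%Z -> t = 0%Z \/ (t ^ Z.of_nat (k - 1) < rmax)%Z ->
  IZR (30 + ucost k t) <= step_const * beta.
Proof.
  intros Ht Hlt. pose proof (step_bound t Ht Hlt) as Hs. pose proof beta_ge1 as Hb.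
  unfold ucost, gc, step_const.
  rewrite !plus_IZR, !mult_IZR, IZR_pow, <- !INR_IZR_INZ.
  pose proof (pos_INR k) as Hk0. pose proof (pos_INR (k - 1)) as Hk1.
  set (q := 100 * (INR (k - 1) * INR (k - 1))).
  assert (Hq : 0 <= q) by (unfold q; apply Rmult_le_pos; [lra | now apply Rmult_le_pos]).
  assert (H1 : IZR (t + 1) ^ (k - 2) * q <= 2 ^ (k - 2) * beta * q)
    by (apply Rmult_le_compat_r; auto).
  assert (H2 : (20 * INR k + 180) * 1 <= (20 * INR k + 180) * beta)
    by (apply Rmult_le_compat_l; lra).
  replace ((2 ^ (k - 2) * q + 20 * INR k + 180) * beta)
    with (2 ^ (k - 2) * beta * q + (20 * INR k + 180) * beta) by ring.
  lra.
Qed.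

Lemma rcost_bound t :
  (0 <= t < Z.of_nat m)%Z -> (rmax <= (t + 1) ^ Z.of_nat (k - 1))%Z ->
  IZR (rcost k rmax) <= rebuild_const * L ^ 3 * beta * IZR (t + 1).
Proof.
  intros Ht Hge. pose proof (rebuild_bound (t + 1) ltac:(lia) Hge) as Hr.
  pose proof conv_cost_bound as Hc. pose proof L_ge1 as HL. pose proof Mx_ge1 as HM.
  unfold rcost, rebuild_const. rewrite plus_IZR, mult_IZR, IZR_pow.
  assert (HL3 : 1 <= L ^ 3) by (apply pow_R1_Rle; lra).
  pose proof (pow_lt 2 k ltac:(lra)) as H2k.
  assert (H1 : 2 ^ k * IZR (conv_cost rmax) <= 2 ^ k * (30000000 * L ^ 3 * Mx))
    by (apply Rmult_le_compat_l; lra).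
  assert (HLM : 1 <= L ^ 3 * Mx).
  { rewrite <- (Rmult_1_r 1). apply Rmult_le_compat; lra. }
  apply Rle_trans with ((2 ^ k * 30000000 + 10) * (L ^ 3 * Mx)).
  - replace ((2 ^ k * 30000000 + 10) * (L ^ 3 * Mx))
      with (2 ^ k * (30000000 * L ^ 3 * Mx) + 10 * (L ^ 3 * Mx)) by ring. lra.
  - replace ((2 ^ k * 30000000 + 10) * L ^ 3 * beta * IZR (t + 1))
      with ((2 ^ k * 30000000 + 10) * (L ^ 3 * (beta * IZR (t + 1)))) by ring.
    apply Rmult_le_compat_l; [lra|]. apply Rmult_le_compat_l; lra.
Qed.

End Bounds.

Theorem theorem5 (k : nat) (hk : (3 <= k)%nat) :
  exists (P : algorithm) (c d : nat) (C : R),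
    forall (rmax : Z) (oprs : list operation) (w : Z),
      (0 <= rmax)%Z ->
      oprs <> nil ->
      valid_ops k rmax empty_sets oprs ->
      (Z.of_nat c * Z.log2_up (param rmax oprs) <= w)%Z ->
      exists T : nat,
        solves_in w k P rmax oprs T /\
        amortized_time T oprs
          <= C * ln (IZR (param rmax oprs)) ^ d * ksum_bound k rmax oprs.
Proof.
  (* The word-size constant is that of [word_size_ok], and 3 is the exponent of the logarithm in
     [conv_cost]. In the last constant 20 pays for initialisation, the other terms for single
     operations and for rebuilds. *)
  exists (the_algorithm k hk), ((2 * k + 37) * max_size k + 1)%nat, 3%nat,
    (20 + step_const k + rebuild_const k).
  intros rmax oprs w HR Hne Hv Hw.
  pose proof (param_ge k rmax oprs hk Hne) as Hpar.
  set (X := param rmax oprs) in *.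
  assert (HX : (3 <= X)%Z) by lia.
  pose (mc := ksum_machine k X w hk HX Hw).
  rewrite <- (the_algorithm_eq k hk X w HX Hw). fold mc.
  assert (HmX : (Z.of_nat (length oprs) + 2 <= X)%Z) by (unfold X, param; lia).
  assert (HXV : (X <= value_bound k X)%Z).
  { unfold value_bound. rewrite <- (Z.pow_1_r X) at 1. apply Z.pow_le_mono_r; lia. }
  assert (HkV : (Z.of_nat k <= @V mc)%Z).
  { change (@V mc) with (value_bound k X).
    pose proof (narrays_range k X hk HX). unfold narrays in *. lia. }
  assert (HM : (7 + Z.of_nat (2 ^ k + k) <= @M mc)%Z)
    by (change (@M mc) with (narrays k); unfold narrays; lia).
  assert (HK : (k + 10 <= @K mc)%nat)
    by (change (@K mc) with (max_size k); unfold max_size; lia).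
  assert (Hcf : @conv_fits mc k rmax) by (apply conv_fits_ok; lia).
  assert (HkR : ((Z.of_nat k + 1) * rmax <= @V mc)%Z) by (apply kR_fits; lia).
  assert (HRV : (rmax <= @V mc)%Z) by (change (@V mc) with (value_bound k X); lia).
  set (beta := ksum_bound k rmax oprs). set (L := ln (IZR X)).
  pose proof (beta_ge1 k rmax oprs hk Hne) as Hb. fold beta in Hb.
  pose proof (L_ge1 k rmax oprs hk HR Hne) as HL. fold X L in HL.
  pose proof (step_const_ge k) as Hsc. pose proof (rebuild_const_pos k) as Hrc.
  assert (HL3 : 1 <= L ^ 3) by (apply pow_R1_Rle; lra).
  assert (Hs0 : @small mc (set_reg zero_state 0 rmax)).
  { apply small_set_reg; [split; simpl; intros; pose proof (@V_ge mc); lia|]. lia. }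
  destruct (@trm_init mc k rmax HR hk HM HK _ HRV eq_refl)
    as (n & s & He & Hn & Hs & Hp).
  (* The log starts empty and grows by at most one per operation, so the number of operations serves
     as [mtot]. *)
  destruct (@serve_ok mc k rmax HR hk HM HK Hcf HkR (Z.of_nat (length oprs))
      (step_const k * beta) (rebuild_const k * L ^ 3 * beta))
    with (oprs := oprs) (A := empty_sets) (s := s) (t := 0%Z)
      (f := fun (_ : nat) (_ : Z) => 0%Z) (g := fun (_ : nat) (_ : Z) => 0%Z)
    as (n' & Hserve & Hcost); auto.
  - intros t Ht. apply acc_fits; lia.
  - intros t Ht Hlt. apply ucost_bound; auto.
  - intros t Ht Hge. apply rcost_bound; auto.
  - apply Rle_trans with (6 * 1); [lra|]. apply Rmult_le_compat; lra.
  - apply Rmult_le_pos; [apply Rmult_le_pos|]; lra.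
  - now apply (@represents_empty mc).
  - lia.
  - exists (n + n')%nat. split.
    + exists n, s, n'. auto.
    + unfold amortized_time. rewrite plus_INR.
      assert (Hm1 : 1 <= INR (length oprs)).
      { replace 1 with (INR 1) by reflexivity. apply le_INR. destruct oprs; [congruence | simpl; lia]. }
      assert (Hn20 : INR n <= 20) by (rewrite INR_IZR_INZ; now apply IZR_le).
      rewrite Rmult_0_l, Rplus_0_r in Hcost.
      apply Rmult_le_reg_r with (INR (length oprs)); [lra|].
      unfold Rdiv. rewrite Rmult_assoc, Rinv_l, Rmult_1_r by lra.
      set (mm := INR (length oprs)) in *.
      assert (HLb : 1 <= L ^ 3 * beta) by (rewrite <- (Rmult_1_r 1); apply Rmult_le_compat; lra).
      assert (H20 : 20 * 1 * 1 <= 20 * (L ^ 3 * beta) * mm)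
        by (apply Rmult_le_compat; lra).
      assert (Hst : step_const k * beta <= step_const k * (L ^ 3 * beta)).
      { apply Rmult_le_compat_l; [lra|]. rewrite <- (Rmult_1_l beta) at 1.
        apply Rmult_le_compat_r; lra. }
      assert (Hst' : mm * (step_const k * beta) <= mm * (step_const k * (L ^ 3 * beta)))
        by (apply Rmult_le_compat_l; lra).
      replace ((20 + step_const k + rebuild_const k) * L ^ 3 * beta * mm)
        with (20 * (L ^ 3 * beta) * mm + mm * (step_const k * (L ^ 3 * beta))
              + mm * (rebuild_const k * L ^ 3 * beta)) by ring.
      rewrite Rmult_plus_distr_l in Hcost. lra.
Qed.
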